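(* Suppose that $F/\mathbb{Q}_p$ is unramified and that $r\in\mathbb{Z}/(q-1)\mathbb{Z}$ is generic. (1) The $\mathrm{GL}_2(\mathcal{O}/\mathfrak{m}^2)$-module $M_{(\varnothing,\mathbb{Z}/f\mathbb{Z})}$ is multiplicity-free, and the set of its Jordan-Hölder constituents is $\mathrm{JH}(M_{(\varnothing,\mathbb{Z}/f\mathbb{Z})})=\{\sigma_\theta:\theta\in\widetilde{\Theta}_1\}$. (2) Let $\theta=(J,I)\in\widetilde{\Theta}_1$. Then $M_\theta$ is the unique submodule of $M_{(\varnothing,\mathbb{Z}/f\mathbb{Z})}$ with cosocle $\sigma_\theta$, and its Jordan-Hölder constituents are $\mathrm{JH}(M_\theta)=\{\sigma_{\theta'}:\theta'\in\widetilde{\Theta}_1,\ \theta'\sqsubseteq\theta\}$.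
   Context: Let $p$ be an odd prime, $F/\mathbb{Q}_p$ a finite unramified extension with valuation ring $\mathcal{O}$, maximal ideal $\mathfrak{m}$, uniformizer $\varpi$, residue field $k$ of cardinality $q=p^f$. Representations are over an extension field $E$ of $k$. Every $\lambda\in\mathcal{O}/\mathfrak{m}^2$ is written uniquely as $[\lambda_0]+[\lambda_1]\varpi$ with $\lambda_i\in k$, $[\cdot]$ the Teichmüller lift. Indices $i\in\{0,\dots,f-1\}$ are viewed in $\mathbb{Z}/f\mathbb{Z}$. For $I\subseteq\mathbb{Z}/f\mathbb{Z}$ put $p^I=\sum_{i\in I}p^i$ and $I-1=\{i-1:i\in I\}$. For $a\in\mathbb{Z}/(q-1)\mathbb{Z}$ the digits $a_i\in\{0,\dots,p-1\}$ are those of its representative $\sum_ia_ip^i\in\{1,\dots,q-1\}$. $r$ is generic if $3\le r_i\le p-3$ for all $i$. Let $G_2=\mathrm{GL}_2(\mathcal{O}/\mathfrak{m}^2)$, $B_2\le G_2$ the upper triangular matrices, $\chi_r:B_2\to k^\times$, $\begin{pmatrix}a&b\\0&d\end{pmatrix}\mapsto(d\bmod\mathfrak{m})^r$. $V_{2,r}=\mathrm{Ind}_{B_2}^{G_2}\chi_r$ is the space of functions $\varphi:G_2\to E$ with $\varphi(bg)=\chi_r(b)\varphi(g)$, under right translation; $g\otimes v$ is the function supported on $B_2g^{-1}$ with value $\chi_r(b)v$ at $bg^{-1}$. For integers $j_0,j_1\ge0$ put $f_{(j_0,j_1)}=\sum_{\lambda\in\mathcal{O}/\mathfrak{m}^2}\begin{pmatrix}\lambda&1\\1&0\end{pmatrix}\otimes\lambda_0^{j_0}\lambda_1^{j_1}$,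 with $0^0=1$. For $a\in\mathbb{Z}/(q-1)\mathbb{Z}$ and $J\subseteq\mathbb{Z}/f\mathbb{Z}$ let $s_J(a)=\sum_is_{J,i}(a)p^i$ with $s_{J,i}(a)=0$ if $i\notin J$; $a_i+1$ if $i-1\notin J,i\in J$; $a_i$ if $i-1,i\in J$. Let $t_{J,i}(a)=a_i$ if $i-1,i\notin J$; $a_i-1$ if $i-1\in J,i\notin J$; $p-2-a_i$ if $i-1\notin J,i\in J$; $p-1-a_i$ if $i-1,i\in J$. Let $\sigma_J(a)=\det^{s_J(a)}\otimes\bigotimes_i(\mathrm{Sym}^{t_{J,i}(a)}E^2)^{(i)}$, a representation of $\mathrm{GL}_2(k)$, where $(i)$ denotes twisting by the $i$-th power of the Frobenius $x\mapsto x^p$ of $k$; it is inflated to $G_2$. Let $\widetilde{\Theta}_1=\{(J,I):I,J\subseteq\mathbb{Z}/f\mathbb{Z},\ J\cap(I-1)=\varnothing\}$, with partial order $(J',I')\sqsubseteq(J,I)$ iff $I'\subseteq I$ and $J'\subseteq J\cup((I\setminus I')-1)$. For $\theta=(J,I)\in\widetilde{\Theta}_1$, $M_\theta$ is the $G_2$-submodule of $V_{2,r}$ generated by $f_{(s_J(r-2p^I),\,p^I)}$, and $\sigma_\theta=\det^{p^I}\otimes\sigma_J(r-2p^I)$. *)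

(* Defs.v *)
From HB Require Import structures.
From mathcomp Require Import all_boot all_order all_algebra.
From mathcomp Require Import all_fingroup all_solvable all_field all_character.
From mathcomp Require Import ring.

Set Implicit Arguments.
Unset Strict Implicit.
Unset Printing Implicit Defensive.

Import Order.TTheory GRing.Theory Num.Theory.
Local Open Scope ring_scope.

Section LocalFields.

(* A valuation is a function to int whose value at 0 is irrelevant;
   v_ge v x n reads "v(x) >= n" with the convention v(0) = +oo. *)
Definition v_ge (K : fieldType) (v : K -> int) (x : K) (n : int) : bool :=
  (x == 0) || (n <= v x).

Definition normalized_valuation (K : fieldType) (v : K -> int) : Prop :=
  [/\ forall x y, x != 0 -> y != 0 -> v (x * y) = v x + v y,
      forall x y n, v_ge v x n -> v_ge v y n -> v_ge v (x + y) n
    & exists2 x, x != 0 & v x = 1].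

Definition v_cauchy (K : fieldType) (v : K -> int) (u : nat -> K) : Prop :=
  forall N : int, exists n0 : nat, forall m n : nat,
    (n0 <= m)%N -> (n0 <= n)%N -> v_ge v (u m - u n) N.

Definition v_limit (K : fieldType) (v : K -> int) (u : nat -> K) (l : K) : Prop :=
  forall N : int, exists n0 : nat, forall n : nat,
    (n0 <= n)%N -> v_ge v (u n - l) N.

(* (K, v) is the completion of the rationals for the p-adic valuation; this
   determines (K, v) up to unique isomorphism. *)
Definition padic_numbers (p : nat) (K : fieldType) (v : K -> int) : Prop :=
  [/\ normalized_valuation v,
      forall n : nat, (0 < n)%N -> n%:R != 0 :> K /\ v n%:R = (logn p n)%:Z,
      forall (x : K) (N : int), exists a : rat, v_ge v (x - ratr a) N
    & forall u, v_cauchy v u -> exists l, v_limit v u l].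

(* Ramification index 1: the normalized valuation of F restricts to the
   normalized valuation of K (residue fields being finite, the residue
   extension is separable). *)
Definition unramified_extension (K : fieldType) (v : K -> int)
    (F : fieldExtType K) (w : F -> int) : Prop :=
  normalized_valuation w /\ (forall x : K, x != 0 -> w (x%:A) = v x).

(* inc identifies the ring O with the valuation ring of (F, w). *)
Definition valuation_ring (F : fieldType) (w : F -> int) (O : idomainType)
    (inc : O -> F) : Prop :=
  injective inc /\ (forall x : F, v_ge w x 0 <-> exists o, inc o = x).

(* h identifies the ring S with O / cO. *)
Definition quotient_by (O : comNzRingType) (S : nzRingType) (h : O -> S) (c : O)
    : Prop :=
  (forall s, exists x, h x = s) /\
  (forall x, h x = 0 <-> exists y, x = c * y).

(* The Teichmuller lift is the unique multiplicative section of reduction. *)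
Definition teichmuller (O k : nzRingType) (res : O -> k) (teich : k -> O) : Prop :=
  cancel teich res /\ {morph teich : x y / x * y}.

End LocalFields.

Section ModuleNotions.

Variables (F : fieldType) (gT : finGroupType) (G : {group gT}).
Variables (n : nat) (rG : mx_representation F G n).

Definition JH_constituent (M : 'M[F]_n) m (s : mx_representation F G m) : Prop :=
  exists U (compU : mx_composition_series rG U), (last 0 U :=: M)%MS /\
    exists2 i, (i < size U)%N & mx_rsim (series_repr i compU) s.

Definition multiplicity_free (M : 'M[F]_n) : Prop :=
  forall U (compU : mx_composition_series rG U), (last 0 U :=: M)%MS ->
  forall i j, (i < size U)%N -> (j < size U)%N ->
    mx_rsim (series_repr i compU) (series_repr j compU) -> i = j.

(* JH(M) = {s_t : t in S}, as sets of isomorphism classes. *)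
Definition JH_set_eq (M : 'M[F]_n) (T : Type) (S : T -> Prop)
    (s : T -> representation F G) : Prop :=
  (forall t, S t -> JH_constituent M (s t)) /\
  (forall m (s' : mx_representation F G m), JH_constituent M s' ->
     exists2 t, S t & mx_rsim s' (s t)).

(* R is the intersection of the maximal submodules of M. *)
Definition is_radical (M R : 'M[F]_n) : Prop :=
  forall W : 'M[F]_n, (W <= R)%MS <->
    (W <= M)%MS /\
    (forall K : 'M[F]_n, mxmodule rG K -> max_submod rG K M -> (W <= K)%MS).

Definition has_cosocle (M : 'M[F]_n) m (s : mx_representation F G m) : Prop :=
  exists (R : 'M[F]_n) (modR : mxmodule rG R) (modM : mxmodule rG M),
    is_radical M R /\ mx_rsim (section_repr modR modM) s.

(* Submodules in mxrepresentation are spaces of row vectors, on which G acts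
   on the right.  A left module given by matrices rG acting on column vectors
   corresponds to the right module v.g := g^-1 v, i.e. to the row action of
   the matrices (rG g^-1)^T. *)
Lemma left_module_subproof : mx_repr G (fun g => (rG g^-1%g)^T).
Proof.
split=> [|x y Gx Gy]; first by rewrite invg1 repr_mx1 trmx1.
by rewrite invMg repr_mxM ?groupV // trmx_mul.
Qed.

Definition left_module := MxRepresentation left_module_subproof.

End ModuleNotions.

Section FunctionSpace.

Variables (E : fieldType) (gT : finGroupType) (G : {group gT}).

Definition fun_row (phi : gT -> E) : 'rV[E]_(gcard G) :=
  \row_i phi (enum_val i).

(* Hence the row module regular_repr is the space of functions G -> E, with
   phi.x := x^-1 phi for the left action (g phi)(h) = phi (h g). *)
Lemma fun_row_translate (phi : gT -> E) x : x \in G ->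
  fun_row phi *m regular_repr E G x = fun_row (fun h => phi (h * x^-1)%g).
Proof.
move=> Gx; apply/rowP=> j; rewrite !mxE.
have Gj : (enum_val j * x^-1)%g \in G by rewrite groupM ?groupV ?enum_valP.
rewrite (bigD1 (gring_index G (enum_val j * x^-1)%g)) //= big1 => [|i ne_i].
  rewrite !mxE gring_indexK // mulgKV gring_valK !eqxx mulr1 addr0.
  by [].
rewrite !mxE eqxx /=; case: eqP => [ej|_]; last by rewrite mulr0.
case/eqP: ne_i; rewrite ej gring_indexK ?mulgK ?gring_valK //.
by rewrite groupM ?enum_valP.
Qed.

End FunctionSpace.

Section SymmetricPowers.

Variable E : fieldType.

(* With X, Y the standard basis of E^2 (column vectors), the j-th column of
   sym_mx t g holds the coordinates of
     g (X^(t-j) Y^j) = (g00 X + g10 Y)^(t-j) (g01 X + g11 Y)^j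
   in the basis X^(t-i) Y^i of Sym^t E^2; it is computed with X = 1. *)
Definition sym_mx (t : nat) (g : 'M[E]_2) : 'M[E]_t.+1 :=
  \matrix_(i, j)
    (((g 0 0)%:P + g 1 0 *: 'X) ^+ (t - j) *
     ((g 0 1)%:P + g 1 1 *: 'X) ^+ j)`_i.

Local Definition lin (a b : E) : {poly E} := a%:P + b *: 'X.
Local Definition homog t (p u v : {poly E}) : {poly E} :=
  \sum_(i < t.+1) p`_i *: (u ^+ (t - i) * v ^+ i).

Local Lemma size_lin a b : (size (lin a b) <= 2)%N.
Proof.
apply: leq_trans (size_polyD _ _) _; rewrite geq_max.
rewrite (leq_trans (size_polyC_leq1 _)) //=.
by rewrite (leq_trans (size_scale_leq _ _)) ?size_polyX.
Qed.

Local Lemma homog_lin t a b (p u v : {poly E}) : (size p <= t.+1)%N ->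
  homog t.+1 (lin a b * p) u v = (a *: u + b *: v) * homog t p u v.
Proof.
move=> sz_p; rewrite /homog /lin.
have coefE i : ((a%:P + b *: 'X) * p)`_i
    = a * p`_i + b * (if i is i'.+1 then p`_i' else 0).
  rewrite mulrDl coefD mul_polyC coefZ -scalerAl coefZ coefXM.
  by case: i.
under eq_bigr do rewrite coefE scalerDl.
rewrite big_split /= mulrDl; congr (_ + _).
  rewrite big_ord_recr /= [p`_t.+1]nth_default // mulr0 scale0r addr0.
  rewrite mulr_sumr; apply: eq_bigr => i _.
  by rewrite subSn ?leq_ord // exprS -scalerAl -scalerAr scalerA mulrA.
rewrite big_ord_recl /= mulr0 scale0r add0r mulr_sumr.
apply: eq_bigr => i _; rewrite /bump /= add1n subSS exprS.
by rewrite -scalerAl -scalerAr scalerA mulrCA.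
Qed.

Local Lemma size_linX a b m : (size (lin a b ^+ m) <= m.+1)%N.
Proof.
elim: m => [|m IHm]; first by rewrite expr0 size_poly1.
rewrite exprS; apply: leq_trans (size_polyMleq _ _) _.
by rewrite -subn1 leq_subLR (leq_trans (leq_add (size_lin a b) IHm)).
Qed.

Local Lemma size_linXX a b m c d l : (size (lin a b ^+ m * lin c d ^+ l)%R <= (m + l).+1)%N.
Proof.
apply: leq_trans (size_polyMleq _ _) _; rewrite -subn1 leq_subLR.
by rewrite (leq_trans (leq_add (size_linX _ _ _) (size_linX _ _ _))) // addnS.
Qed.

Local Lemma homog_linXX m l a b c d (u v : {poly E}) :
  homog (m + l) (lin a b ^+ m * lin c d ^+ l) u v
    = (a *: u + b *: v) ^+ m * (c *: u + d *: v) ^+ l.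
Proof.
elim: m => [|m IHm].
  rewrite add0n !expr0 !mul1r; elim: l => [|l IHl].
    by rewrite /homog big_ord1 !expr0 mulr1 coef1 scale1r.
  by rewrite !exprS homog_lin ?IHl // size_linX.
by rewrite addSn !exprS -!mulrA homog_lin ?IHm // size_linXX.
Qed.

Lemma sym_mx1 t : sym_mx t 1%:M = 1%:M.
Proof.
apply/matrixP=> i j; rewrite !mxE /= scale0r addr0 scale1r polyC0 add0r.
by rewrite polyC1 expr1n mul1r coefXn.
Qed.

Lemma sym_mxM t (g h : 'M[E]_2) : sym_mx t (g *m h) = sym_mx t g *m sym_mx t h.
Proof.
have E2 (x y : 'I_2) : (g *m h) x y = g x 0 * h 0 y + g x 1 * h 1 y.
  by rewrite mxE !big_ord_recl big_ord0 addr0 /=; congr (_ * _ + g _ _ * h _ _);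
    apply: val_inj.
apply/matrixP=> i j; rewrite mxE [RHS]mxE.
pose u := lin (g 0 0) (g 1 0); pose v := lin (g 0 1) (g 1 1).
have linE (y : 'I_2) :
    ((g *m h) 0 y)%:P + (g *m h) 1 y *: 'X = h 0 y *: u + h 1 y *: v.
  by rewrite !E2 /u /v /lin !rmorphD !rmorphM /= -!mul_polyC !rmorphD !rmorphM /=; ring.
rewrite !linE -homog_linXX subnK ?leq_ord // coef_sum.
apply: eq_bigr => l _; rewrite !mxE coefZ mulrC /=.
by [].
Qed.

End SymmetricPowers.

Section GL2Representations.

Variables (p f : nat) (k : finFieldType) (E : fieldType) (iota : {rmorphism k -> E}).
Hypotheses (p_pr : prime p) (card_k : #|k| = (p ^ f)%N).

(* The i-th Frobenius twist of the standard representation, over E. *)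
Definition twist_mx (i : nat) (g : {'GL_2[k]}) : 'M[E]_2 :=
  map_mx (fun x => iota (x ^+ (p ^ i))) (GLval g).

Local Lemma chk : p \in [pchar k]. Proof. exact: card_finPcharP card_k p_pr. Qed.

Local Lemma twist_mxE i g :
  twist_mx i g = map_mx iota (iter i (map_mx (pFrobenius_aut chk)) (GLval g)).
Proof.
apply/matrixP=> x y; rewrite !mxE; congr (iota _).
elim: i => [|i IHi] /=; first by rewrite expr1.
by rewrite mxE -IHi pFrobenius_autE expnSr exprM.
Qed.

Lemma twist_mx1 i : twist_mx i 1%g = 1%:M.
Proof.
rewrite twist_mxE GL_1E -[RHS](map_mx1 iota); congr map_mx.
by elim: i => //= i ->; rewrite map_mx1.
Qed.

Lemma twist_mxM i g h : twist_mx i (g * h)%g = twist_mx i g *m twist_mx i h.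
Proof.
rewrite !twist_mxE -map_mxM GL_MxE; congr map_mx.
by elim: i => //= i ->; rewrite map_mxM.
Qed.

Lemma sym_twist_subproof t i : mx_repr 'GL_2[k] (fun g => sym_mx t (twist_mx i g)).
Proof. by split=> [|g h _ _]; rewrite ?twist_mx1 ?sym_mx1 // twist_mxM sym_mxM. Qed.

(* (Sym^t E^2)^(i) *)
Definition sym_twist_repr t i := MxRepresentation (sym_twist_subproof t i).

Lemma det_pow_subproof s :
  mx_repr 'GL_2[k] (fun g => (iota (\det (GLval g) ^+ s))%:M : 'M[E]_1).
Proof.
split=> [|g h _ _]; first by rewrite det1 expr1n rmorph1.
by rewrite GL_MxE det_mulmx exprMn rmorphM scalar_mxM.
Qed.

Definition det_pow_repr s := MxRepresentation (det_pow_subproof s).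

Definition tensor_repr (V W : representation E 'GL_2[k]) : representation E 'GL_2[k] :=
  Representation (prod_repr V W).

(* Elements of Z/(q-1)Z are represented in {1, ..., q-1}, not in {0, ..., q-2}. *)
Definition zrep (a : 'Z_(p ^ f).-1) : nat := if a == 0 then (p ^ f).-1 else a.

Definition digit (a : 'Z_(p ^ f).-1) (i : 'I_f) : nat := (zrep a %/ p ^ i %% p)%N.

Definition generic (r : 'Z_(p ^ f).-1) : Prop :=
  forall i, (3 <= digit r i <= p - 3)%N.

Definition ppow (I : {set 'I_f}) : nat := (\sum_(i in I) p ^ i)%N.

(* I - 1, with indices read modulo f *)
Definition shift (I : {set 'I_f}) : {set 'I_f} := [set ord_pred i | i in I].

Definition s_digit (J : {set 'I_f}) a i : nat :=
  if i \notin J then 0 else if ord_pred i \in J then digit a i else (digit a i).+1.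

Definition s_exp (J : {set 'I_f}) a : nat := (\sum_i s_digit J a i * p ^ i)%N.

(* The truncated subtractions are exact when 1 <= digit a i <= p - 2, hence at
   every a = r - 2 p^I with r generic. *)
Definition t_digit (J : {set 'I_f}) a i : nat :=
  match ord_pred i \in J, i \in J with
  | false, false => digit a i
  | true, false => digit a i - 1
  | false, true => p - 2 - digit a i
  | true, true => p - 1 - digit a i
  end.

Definition sigma (J : {set 'I_f}) a : representation E 'GL_2[k] :=
  tensor_repr (Representation (det_pow_repr (s_exp J a)))
    (foldr tensor_repr (Representation (det_pow_repr 0))
       [seq Representation (sym_twist_repr (t_digit J a i) i) | i <- enum 'I_f]).

(* Pairs theta = (J, I). *)
Definition Theta (th : {set 'I_f} * {set 'I_f}) : Prop :=
  th.1 :&: shift th.2 = set0.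

Definition Theta_le (th' th : {set 'I_f} * {set 'I_f}) : Prop :=
  th'.2 \subset th.2 /\ th'.1 \subset th.1 :|: shift (th.2 :\: th'.2).

Definition theta_wt (r : 'Z_(p ^ f).-1) (th : {set 'I_f} * {set 'I_f}) :=
  r - (2 * ppow th.2)%:R.

Definition sigma_theta r th : representation E 'GL_2[k] :=
  tensor_repr (Representation (det_pow_repr (ppow th.2)))
    (sigma th.1 (theta_wt r th)).

(* A stands for O/m^2, with reduction map red onto k. *)
Variables (A : finComUnitRingType) (red : {rmorphism A -> k}).

Lemma GL_red_subproof (g : {'GL_2[A]}) : map_mx red (GLval g) \is a GRing.unit.
Proof.
have := GL_unitmx g; rewrite -[_ \is a _]/(_ \in unitmx) !unitmxE det_map_mx.
exact: rmorph_unit.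
Qed.

Definition GL_red (g : {'GL_2[A]}) : {'GL_2[k]} := FinRing.Unit (GL_red_subproof g).

Lemma inflate_subproof n (V : mx_representation E 'GL_2[k] n) :
  mx_repr 'GL_2[A] (fun g => V (GL_red g)).
Proof.
split=> [|g h _ _].
  by rewrite -(repr_mx1 V); congr (V _); apply: val_inj; rewrite /= map_mx1.
by rewrite -repr_mxM ?inE //; congr (V _); apply: val_inj; rewrite /= map_mxM.
Qed.

Definition inflate n (V : mx_representation E 'GL_2[k] n) :=
  MxRepresentation (inflate_subproof V).

(* sigma_theta as a row module over GL_2(O/m^2) *)
Definition sigma_mod r th : representation E 'GL_2[A] :=
  Representation (left_module (inflate (sigma_theta r th))).

Definition B2 : {set {'GL_2[A]}} := [set b : {'GL_2[A]} | (b : 'M_2) 1 0 == 0].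

Local Lemma mul_row1 (b c : {'GL_2[A]}) (j : 'I_2) : b \in B2 ->
  (GLval (b * c)%g : 'M_2) 1 j = (b : 'M_2) 1 1 * (c : 'M_2) 1 j.
Proof.
rewrite inE GL_MxE mxE => /eqP b10.
rewrite big_ord_recl big_ord_recl big_ord0 addr0.
have -> : lift ord0 ord0 = 1 :> 'I_2 by apply: val_inj.
have -> : ord0 = 0 :> 'I_2 by apply: val_inj.
by rewrite b10 mul0r add0r.
Qed.

Lemma B2_group_set : group_set B2.
Proof.
apply/group_setP; split=> [|b c Bb Bc]; first by rewrite inE GL_1E !mxE.
by rewrite inE mul_row1 //; move: Bc; rewrite inE => /eqP->; rewrite mulr0.
Qed.
Canonical B2_group := Group B2_group_set.

Definition chi (r : 'Z_(p ^ f).-1) (b : {'GL_2[A]}) : E :=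
  iota (red ((b : 'M_2) 1 1) ^+ zrep r).

(* phi belongs to V_{2,r} = Ind_{B_2}^{G_2} chi_r *)
Definition in_Ind r (phi : {'GL_2[A]} -> E) : Prop :=
  forall b h, b \in B2 -> phi (b * h)%g = chi r b * phi h.

(* g (x) v *)
Definition ind_tensor r (g : {'GL_2[A]}) (v : E) : {'GL_2[A]} -> E :=
  fun h => if (h * g)%g \in B2 then chi r (h * g)%g * v else 0.

Definition lambda_mx (l : A) : 'M[A]_2 :=
  \matrix_(i, j) if i == 0 then (if j == 0 then l else 1) else (j == 0)%:R.

Lemma lambda_mx_unit l : lambda_mx l \is a GRing.unit.
Proof.
rewrite -[_ \is a _]/(_ \in unitmx).
have /mulmx1_unit[] // : lambda_mx l *m (\matrix_(i, j)
    if i == 0 then (j != 0)%:R else if j == 0 then 1 else - l) = 1%:M.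
apply/matrixP=> i j; rewrite !mxE !big_ord_recl big_ord0 !mxE /= addr0.
by case: i => [[|[|//]] ?]; case: j => [[|[|//]] ?] /=; ring.
Qed.

Definition lambda_GL (l : A) : {'GL_2[A]} := FinRing.Unit (lambda_mx_unit l).

(* tau l is the class of the Teichmuller lift of l, and varpi that of the
   uniformizer; (l0, l1) enumerates O/m^2 through tau l0 + tau l1 * varpi. *)
Variables (tau : k -> A) (varpi : A).

Definition f_elt r (j0 j1 : nat) : {'GL_2[A]} -> E :=
  fun h => \sum_(l : k * k)
    ind_tensor r (lambda_GL (tau l.1 + tau l.2 * varpi)) (iota (l.1 ^+ j0 * l.2 ^+ j1)) h.

(* M_theta: the submodule generated by f_(s_J(r - 2 p^I), p^I), as a subspace
   of all functions on GL_2(O/m^2); it lies in V_{2,r} by M_theta_Ind. *)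
Definition M_theta r th : 'M[E]_(gcard 'GL_2[A]) :=
  cyclic_mx (regular_repr E 'GL_2[A])
    (fun_row 'GL_2[A] (f_elt r (s_exp th.1 (theta_wt r th)) (ppow th.2))).

Lemma M_theta_Ind r th (phi : {'GL_2[A]} -> E) :
  (fun_row 'GL_2[A] phi <= M_theta r th)%MS -> in_Ind r phi.
Proof.
case/cyclic_mxP=> _ /envelop_mxP[a ->]; rewrite mulmx_sumr => def_phi.
set u := f_elt _ _ _ in def_phi.
have phiE h : phi h = \sum_(x in ('GL_2[A])%g) a x * u (h * x^-1)%g.
  have := congr1 (fun v : 'rV_(gcard ('GL_2[A])%G) => v 0 (gring_index 'GL_2[A] h)) def_phi.
  rewrite /= mxE gring_indexK ?inE // => ->; rewrite summxE.
  apply: eq_bigr => x Gx; rewrite -scalemxAr fun_row_translate // !mxE.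
  by rewrite gring_indexK ?inE.
have chiM b c : b \in B2 -> chi r (b * c)%g = chi r b * chi r c.
  by move=> Bb; rewrite /chi mul_row1 // rmorphM exprMn rmorphM.
have u_Ind : in_Ind r u.
  move=> b h Bb; rewrite /u /f_elt mulr_sumr; apply: eq_bigr => l _.
  rewrite /ind_tensor -mulgA groupMl //; case: ifP => _; last by rewrite mulr0.
  by rewrite chiM // mulrA.
move=> b h Bb; rewrite !phiE mulr_sumr; apply: eq_bigr => x _.
by rewrite -mulgA u_Ind // mulrCA.
Qed.

End GL2Representations.

(* Main.v *)
Require Import Defs.
From HB Require Import structures.
From mathcomp Require Import all_boot all_order all_algebra.
From mathcomp Require Import all_fingroup all_solvable all_field all_character.
From mathcomp Require Import ring zify.
From Stdlib Require Import Classical.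

Set Implicit Arguments.
Unset Strict Implicit.
Unset Printing Implicit Defensive.

Import Order.TTheory GRing.Theory Num.Theory.
Local Open Scope ring_scope.

(* An element of V_{2,r} is a function of the bottom row v = (c, d). Writing
   x = [x'] + [x''] varpi, put c_i = c'^(p^i), d_i = d'^(p^i) and
   D_i = (c' d'' - d' c'')^(p^i). For theta = (J, I) let
   W_theta be spanned by the functions prod_i c_i^(e_i) d_i^(m_i)
   prod_(i in I) D_i with e_i + m_i = n_i, where
   n_i = r_i - 2[i in I] - [i - 1 in J] + p[i in J]; the generator of M_theta
   is, up to sign, one of them. By the formula for the sum of Teichmuller lifts
   (this is where F is unramified: p is a uniformizer),
   D_i(v g) = det(g)^(p^i) D_i(v) + R_i(v) with R_i homogeneous of degree 1 in
   (c_i, d_i) and p in (c_(i-1), d_(i-1)); together with c_i^p = c_(i+1) this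
   gives exactly the relation on the theta's, so that N_S, the sum of W_theta
   for theta in S, is a submodule when S is closed downwards. Each stratum is an
   explicit tensor product of twisted symmetric powers, and these are pairwise
   nonisomorphic.

   The submodule N(down theta) has cosocle sigma_theta if a submodule X meeting
   it outside the lower strata contains all of it. By induction on
   2 #|I| + #|J| it suffices to reach each cover theta' of theta, modulo the
   strata not above theta'. This is done by letting [[1, u], [0, 1]] act on one
   well-chosen element and extracting the coefficient of one power of u; that
   the result is not in the lower strata is detected by a linear functional,
   the coefficient of a monomial on the chart c = 1. *)

(** The obstacle in reaching a cover theta' is that X contains a leading monomial of theta only up
    to an unknown combination of lower monomials. Modulo the strata that are not above theta', this
    combination involves monomials of theta' alone, with coefficients that do not depend on u. The
    power of u is chosen so that they cannot interfere: if J loses j, the power exceeds every degree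
    of theta' at j; if I loses i, the functional asks for the exponent p - 1 at i - 1, which they no
    longer reach. In the second case the new term comes from the carry of D_i, with a power of the
    residue class of p / varpi as coefficient; it is nonzero as p is a uniformizer.

    The strata that were divided out are removed at the end by comparing constituents: sigma_theta'
    is not among theirs. So the pairwise nonisomorphism of the strata serves the cosocles too, not
    only multiplicity one.

    The functional is a double power sum over k and sees exponents modulo q - 1 only. Comparing them
    needs an order that survives the identification of c_f with c_0; it is obtained by starting the
    base p expansion after an index of J that J' lacks. *)

Section Sections.

Variables (F : fieldType) (gT : finGroupType) (G : {group gT}).
Variables (n : nat) (rG : mx_representation F G n).
Implicit Types A B C D X Y : 'M[F]_n.

(** Hides the proofs that [C] and [D] are submodules, on which the type of [section_repr]
    depends. *)
Definition sec_iso C D m (s : mx_representation F G m) : Prop :=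
  exists (modC : mxmodule rG C) (modD : mxmodule rG D),
    mx_rsim (section_repr modC modD) s.

Lemma sec_iso_uniq C D m (s : mx_representation F G m) m' (s' : mx_representation F G m') :
  sec_iso C D s -> sec_iso C D s' -> mx_rsim s s'.
Proof.
move=> [mC [mD h]] [mC' [mD' h']].
rewrite (bool_irrelevance mC' mC) (bool_irrelevance mD' mD) in h'.
exact: mx_rsim_trans (mx_rsim_sym h) h'.
Qed.

Lemma sec_iso_eqmx C D C' D' m (s : mx_representation F G m) :
  (C :=: C')%MS -> (D :=: D')%MS -> sec_iso C D s -> sec_iso C' D' s.
Proof.
move=> eC eD [mC [mD h]].
have mC' : mxmodule rG C' by rewrite -(eqmx_module rG eC).
have mD' : mxmodule rG D' by rewrite -(eqmx_module rG eD).
by exists mC', mD'; apply: mx_rsim_trans h; apply: section_eqmx; apply: eqmx_sym.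
Qed.

Lemma sec_iso_max C D m (s : mx_representation F G m) :
  (C <= D)%MS -> mx_irreducible s -> sec_iso C D s -> max_submod rG C D.
Proof.
move=> sCD irs [mC [mD h]]; apply/(max_submodP mC mD sCD).
exact: mx_rsim_irr (mx_rsim_sym h) irs.
Qed.

Lemma max_submod_add C D X : max_submod rG C D -> mxmodule rG C ->
  mxmodule rG X -> (X <= D)%MS -> ~~ (X <= C)%MS -> (X + C :=: D)%MS.
Proof.
move=> [ltCD maxC] mC mX sXD nXC; have sCD := ltmxW ltCD.
have sXCD: (X + C <= D)%MS by rewrite addsmx_sub sXD.
apply/eqmxP; rewrite sXCD /=; apply: contraT => nD.
case: (maxC (X + C)%MS); split; first exact: addsmx_module.
  rewrite ltmxE addsmxSr /=; apply: contra nXC => h.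
  by apply: submx_trans h; apply: addsmxSl.
by rewrite ltmxE sXCD.
Qed.

(** Since [C] is maximal in [D], the sum of [D :&: Y] and [C] is [D]; the second isomorphism theorem
    compares the quotients. *)
Lemma sec_iso_cap C D Y m (s : mx_representation F G m) :
  (C <= D)%MS -> mx_irreducible s -> sec_iso C D s -> mxmodule rG Y ->
  ~~ (D :&: Y <= C)%MS -> sec_iso (C :&: Y)%MS (D :&: Y)%MS s.
Proof.
move=> sCD irs iso mY nDY; have [mC [mD h]] := iso.
have mDY := capmx_module mD mY.
have eD := max_submod_add (sec_iso_max sCD irs iso) mC mDY (capmxSl _ _) nDY.
pose mI := capmx_module mDY mC; pose mA := addsmx_module mDY mC.
have h2 := mx_second_rsim mDY mC.
apply: (@sec_iso_eqmx ((D :&: Y) :&: C)%MS (D :&: Y)%MS) => //.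
  apply/eqmxP; rewrite !sub_capmx capmxSr capmxSl capmxSr (submx_trans (capmxSl C Y)) //=.
  by rewrite (submx_trans (capmxSl _ _)) // capmxSr.
exists mI, mDY; apply: mx_rsim_trans h2 _.
by apply: mx_rsim_trans h; apply: section_eqmx.
Qed.

End Sections.

(** * Submodules of stratified modules *)

Section Stratification.

Variables (F : fieldType) (gT : finGroupType) (G : {group gT}).
Variables (n : nat) (rG : mx_representation F G n).
Variables (T : finType) (Th : {set T}) (le : rel T) (rk : T -> nat).
Variables (N : {set T} -> 'M[F]_n) (s : T -> representation F G).

Definition dclosed (S : {set T}) :=
  S \subset Th /\ forall x y, x \in S -> y \in Th -> le y x -> y \in S.
Definition down t := [set x in Th | le x t].
Definition sdown t := down t :\ t.
(** For t' in [Th], the largest down-closed subset of [sdown t] without t'. If the rank of t' is one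
    less than that of t, only t' is missing. *)
Definition avoid t t' := [set x in sdown t | ~~ le t' x].

Implicit Types A B C D X Y : 'M[F]_n.

Hypothesis le_refl : forall t, le t t.
Hypothesis le_tr : forall x y z, le x y -> le y z -> le x z.
Hypothesis le_rk : forall x y, x \in Th -> y \in Th -> le x y -> x != y ->
  (rk x < rk y)%N.
Hypothesis N0 : N set0 = 0.
Hypothesis N_mono : forall S S' : {set T}, S \subset S' -> (N S <= N S')%MS.
Hypothesis N_gen : forall (S : {set T}) (X : 'M[F]_n), S \subset Th ->
  (forall x, x \in S -> (N (down x) <= X)%MS) -> (N S <= X)%MS.
Hypothesis N_mod : forall S, dclosed S -> mxmodule rG (N S).
Hypothesis s_irr : forall t, t \in Th -> mx_irreducible (s t).
Hypothesis s_inj : forall t t', t \in Th -> t' \in Th -> mx_rsim (s t) (s t') -> t = t'.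
Hypothesis strat : forall S t, dclosed S -> t \in Th -> t \notin S ->
  dclosed (t |: S) -> sec_iso rG (N S) (N (t |: S)) (s t).
Hypothesis cover : forall t x, t \in Th -> x \in sdown t ->
  exists2 t', t' \in sdown t & rk t = (rk t').+1 /\ le x t'.
(* The extension of s t by s t', for t' just below t, does not split. *)
Hypothesis cover_step : forall t t' (Z : 'M[F]_n), t \in Th -> t' \in sdown t -> rk t = (rk t').+1 ->
  mxmodule rG Z -> (N (avoid t t') <= Z)%MS -> (N (down t) <= Z + N (sdown t))%MS ->
  ~~ (N (down t') :&: Z <= N (sdown t'))%MS.

Lemma dclosed_down t : dclosed (down t).
Proof.
split=> [|x y]; first by apply/subsetP=> x; rewrite inE => /andP[].
by rewrite !inE => /andP[_ xt] -> /= yx; apply: le_tr yx xt.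
Qed.

Lemma sdown_in t x : x \in sdown t -> [/\ x \in Th, le x t & x != t].
Proof. by rewrite !inE => /and3P[]. Qed.

Lemma down_sub t S : dclosed S -> t \in S -> down t \subset S.
Proof.
by move=> [_ clS] tS; apply/subsetP=> x; rewrite inE => /andP[xT xt]; apply: clS xT xt.
Qed.

Lemma dclosed_rem S t : dclosed S ->
  (forall x, x \in S -> le t x -> x = t) -> dclosed (S :\ t).
Proof.
move=> [sS clS] mt; split=> [|x y]; first by apply: subset_trans sS; apply: subsetDl.
rewrite !inE => /andP[nxt xS] yT yx; rewrite (clS x) // andbT.
by apply: contraNneq nxt => yt; rewrite (mt x) // -yt.
Qed.

Lemma dclosed_sdown t : t \in Th -> dclosed (sdown t).
Proof.
move=> tT; apply: dclosed_rem (dclosed_down t) _ => x; rewrite inE => /andP[xT xt] tx.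
apply/eqP; apply: contraT => nxt.
have ltx := le_rk xT tT xt nxt; have : (rk t < rk x)%N by apply: le_rk => //; rewrite eq_sym.
by rewrite ltnNge ltnW.
Qed.

Lemma sdown_rk t x : t \in Th -> x \in sdown t -> (rk x < rk t)%N.
Proof. by move=> tT /sdown_in[xT xt nxt]; apply: le_rk. Qed.

Lemma down_U t : t \in Th -> down t = t |: sdown t.
Proof. by move=> tT; rewrite setD1K // inE tT le_refl. Qed.

Lemma dclosed_avoid t t' : t \in Th -> dclosed (avoid t t').
Proof.
move=> tT; have [sS clS] := dclosed_sdown tT; split=> [|x y].
  by apply: subset_trans sS; apply/subsetP=> x; rewrite inE => /andP[].
rewrite !inE => /andP[xS nx] yT yx.
have := clS x y; rewrite !inE => /(_ xS yT yx)-> /=.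
by apply: contra nx => h; apply: le_tr h yx.
Qed.

Lemma strat_down t : t \in Th -> sec_iso rG (N (sdown t)) (N (down t)) (s t).
Proof.
move=> tT; rewrite (down_U tT); apply: strat => //; first exact: dclosed_sdown.
  by rewrite !inE eqxx.
by rewrite -down_U //; apply: dclosed_down.
Qed.

Lemma max_down t : t \in Th -> max_submod rG (N (sdown t)) (N (down t)).
Proof.
move=> tT; apply: sec_iso_max (s_irr tT) (strat_down tT).
by apply: N_mono; apply: subsetDl.
Qed.

(** An element of [S :\: S'] of maximal rank is maximal in S, because what lies above it cannot be
    in the down-closed S'. *)
Lemma dclosed_top S S' : dclosed S -> dclosed S' -> S' \proper S ->
  exists2 t, t \in S :\: S' & dclosed (S :\ t) /\ S' \subset S :\ t.
Proof.
move=> dS dS' /properP[sSS [y yS nyS]].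
have yD : y \in S :\: S' by rewrite inE nyS.
have [t tD maxt] := arg_maxnP rk yD; exists t => //.
have /setDP[tS ntS] : t \in S :\: S' := tD.
have [sS clS] := dS; have [sS' clS'] := dS'.
split; last first.
  by rewrite subsetD1 sSS.
apply: dclosed_rem => // x xS tx; apply/eqP; apply: contraT => nxt.
have tT := subsetP sS _ tS; have xT := subsetP sS _ xS.
have ltr : (rk t < rk x)%N by apply: le_rk => //; rewrite eq_sym.
have [xS'|nxS'] := boolP (x \in S'); first by rewrite (clS' x) in ntS.
have xD : x \in S :\: S' by rewrite inE nxS'.
by have := maxt x xD; rewrite /= leqNgt ltr.
Qed.

(** Intersected with [D], the stratum of t becomes a simple section with top [D]; its bottom lies in
    [C], and equals [C] by maximality. *)
Lemma stratum_hit S t C D m (r : mx_representation F G m) :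
  dclosed S -> t \in Th -> t \notin S -> dclosed (t |: S) ->
  (C <= D)%MS -> mx_irreducible r -> sec_iso rG C D r ->
  (D <= N (t |: S))%MS -> (D :&: N S <= C)%MS -> mx_rsim r (s t).
Proof.
move=> dS tT ntS dtS sCD irr iso sDN sDC; have [mC [mD _]] := iso.
have sAB : (N S <= N (t |: S))%MS by apply: N_mono; apply: subsetUr.
have [ltCD maxC] := sec_iso_max sCD irr iso.
have nDA : ~~ (N (t |: S) :&: D <= N S)%MS.
  apply: contraL (ltmxW ltCD) => h; move/andP: ltCD => [_ nDC]; case/negP: nDC.
  by apply: submx_trans sDC; rewrite sub_capmx submx_refl (submx_trans _ h) // sub_capmx sDN submx_refl.
have iso2 := sec_iso_cap sAB (s_irr tT) (strat dS tT ntS dtS) mD nDA.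
have eD : (N (t |: S) :&: D :=: D)%MS by apply/eqmxP; rewrite capmxSr sub_capmx sDN submx_refl.
have iso3 := sec_iso_eqmx (eqmx_refl _) eD iso2.
have [lt3 max3] := sec_iso_max (capmxSr _ _) (s_irr tT) iso3.
have eC : (N S :&: D :=: C)%MS.
  have sAC : (N S :&: D <= C)%MS by rewrite capmxC.
  apply/eqmxP; rewrite sAC /=; apply: contraT => nCA.
  by case: (max3 C); split=> //; rewrite ltmxE sAC.
by apply: sec_iso_uniq iso (sec_iso_eqmx eC (eqmx_refl _) iso3).
Qed.

(** Strip a maximal element off S: either its stratum carries the section, or the section survives
    intersection with the rest and the induction goes on. *)
Lemma constituent_in S S' C D m (r : mx_representation F G m) :
  dclosed S -> dclosed S' -> S' \subset S ->
  (C <= D)%MS -> mx_irreducible r -> sec_iso rG C D r ->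
  (D <= N S)%MS -> (D :&: N S' <= C)%MS ->
  exists2 t, t \in S :\: S' & mx_rsim r (s t).
Proof.
move Dk : #|S :\: S'| => k; elim: k S S' C D Dk => [|k IHk] S S' C D Dk dS dS' sSS sCD irr iso sDN sDC.
  have eS : S = S'.
    by apply/eqP; rewrite eqEsubset sSS andbT -setD_eq0 -cards_eq0 Dk.
  have [/andP[_ /negP nh] _] := sec_iso_max sCD irr iso; case: nh.
  by apply: submx_trans sDC; rewrite sub_capmx submx_refl -eS.
have pSS : S' \proper S.
  by rewrite properEneq sSS andbT; apply: contra_eqN Dk => /eqP->; rewrite setDv cards0.
have [t tD [dSt sSt]] := dclosed_top dS dS' pSS.
have /setDP[tS ntS'] : t \in S :\: S' := tD.
have tT : t \in Th by case: dS => /subsetP->.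
have eS : t |: (S :\ t) = S by rewrite setD1K.
have [mC [mD _]] := iso.
have [sDSt|nDSt] := boolP (D :&: N (S :\ t) <= C)%MS.
  exists t => //; apply: (stratum_hit (S := S :\ t)) iso _ _ => //; rewrite ?eS //.
  by rewrite !inE eqxx.
have mN := N_mod dSt.
have iso2 := sec_iso_cap sCD irr iso mN nDSt.
have [||||t' t'D rs] := IHk (S :\ t) S' _ _ _ dSt dS' sSt _ irr iso2.
- have -> : (S :\ t) :\: S' = (S :\: S') :\ t by apply/setP=> x; rewrite !inE andbCA.
  by have := cardsD1 t (S :\: S'); rewrite tD Dk => -[].
- by rewrite capmxS.
- exact: capmxSr.
- rewrite sub_capmx (submx_trans _ sDC) ?capmxS ?capmxSl //=.
  by rewrite (submx_trans (capmxSl _ _)) // capmxSr.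
by exists t' => //; move: t'D; rewrite !inE => /andP[-> /andP[]].
Qed.

Lemma constituent_sub S C D x : dclosed S -> x \in Th -> (C <= D)%MS ->
  sec_iso rG C D (s x) -> (D <= N S)%MS -> x \in S.
Proof.
move=> dS xT sCD iso sDN.
have d0 : dclosed set0 by split=> [|y z]; rewrite ?sub0set // inE.
have [|y yD rs] := constituent_in dS d0 (sub0set _) sCD (s_irr xT) iso sDN.
  by rewrite N0 capmx0 sub0mx.
move: yD; rewrite setD0 => yS; rewrite (s_inj xT _ rs) //.
by case: dS => /subsetP->.
Qed.

(** The heart of the cosocle statement. For each t' just below t the induction hypothesis is used
    twice: for the submodule enlarged by [N (avoid t t')], where [cover_step] applies, and then for
    the submodule itself. *)
Lemma submodule_down t X : t \in Th -> mxmodule rG X ->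
  ~~ (N (down t) :&: X <= N (sdown t))%MS -> (N (down t) <= X)%MS.
Proof.
move Dk : (rk t) => k; elim/ltn_ind: k t X Dk => k IHk t X Dk tT mX nX.
have maxt := max_down tT.
have mNt := N_mod (dclosed_down t); have mNs := N_mod (dclosed_sdown tT).
pose X' := (N (down t) :&: X)%MS.
have mX' : mxmodule rG X' by apply: capmx_module.
have eN := max_submod_add maxt mNs mX' (capmxSl _ _) nX.
suffices sNX : (N (sdown t) <= X')%MS.
  by rewrite -eN addsmx_sub capmxSr (submx_trans sNX (capmxSr _ _)).
suffices cov t' : t' \in sdown t -> rk t = (rk t').+1 -> (N (down t') <= X')%MS.
  apply: N_gen => [|x xS]; first by case: (dclosed_sdown tT).
  have [t' t'S [rk' xt']] := cover tT xS.
  apply: submx_trans (cov t' t'S rk'); apply: N_mono.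
  by apply: down_sub; [apply: dclosed_down | rewrite inE xt' andbT; case/sdown_in: xS].
move=> t'S rk'; have [t'T t't nt't] := sdown_in t'S.
have mY := N_mod (dclosed_avoid t' tT).
pose Y := N (avoid t t').
have mZ : mxmodule rG (X' + Y)%MS by apply: addsmx_module.
have lt' : (rk t' < k)%N by rewrite -Dk sdown_rk.
have sNZ : (N (down t') <= X' + Y)%MS.
  apply: (IHk _ lt') => //; apply: cover_step rk' mZ _ _ => //; first exact: addsmxSr.
  by rewrite -eN addsmxS // addsmxSl.
(* Otherwise [D] / [C] is a copy of s t' inside a quotient of [X' + Y] by a submodule containing
   [X'], hence a constituent of [Y]; but t' is not in [avoid t t']. *)
apply: (IHk _ lt') => //; apply/negP => nX'.
pose C := (N (sdown t') + X')%MS; pose D := (N (down t') + X')%MS.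
have sNs : (N (sdown t') <= N (down t'))%MS by apply: N_mono; apply: subsetDl.
have mC : mxmodule rG C by apply: addsmx_module mX'; apply/N_mod/dclosed_sdown.
have mD : mxmodule rG D by apply: addsmx_module mX'; apply/N_mod/dclosed_down.
have sCD : (C <= D)%MS by rewrite addsmxS.
have mNd := N_mod (dclosed_down t').
have isoDC : sec_iso rG C D (s t').
  have eI : (N (down t') :&: C :=: N (sdown t'))%MS.
    apply/eqmxP/andP; split; last by rewrite sub_capmx sNs addsmxSl.
    apply/rV_subP=> v; rewrite sub_capmx => /andP[vN /sub_addsmxP[[a b] /= ev]].
    rewrite ev addmx_sub ?submxMl //; apply: submx_trans nX'.
    rewrite sub_capmx submxMl andbT.
    have -> : b *m X' = v - a *m N (sdown t') by rewrite ev addrC addKr.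
    by rewrite addmx_sub // -mulNmx (submx_trans _ sNs) ?submxMl.
  have eS : (N (down t') + C :=: D)%MS.
    apply/eqmxP/andP; split; first by rewrite addsmx_sub sCD addsmxSl.
    by rewrite addsmx_sub addsmxSl (submx_trans (addsmxSr _ X') (addsmxSr _ C)).
  pose mI := capmx_module mNd mC; pose mA := addsmx_module mNd mC.
  have h2 := mx_second_rsim mNd mC.
  have [m1 [m2 h]] := strat_down t'T.
  exists mC, mD; apply: mx_rsim_trans h.
  apply: mx_rsim_trans (mx_rsim_trans (mx_rsim_sym h2) _).
    by apply: section_eqmx => //; apply: eqmx_sym.
  exact: section_eqmx.
have sDZ : (D <= X' + Y)%MS by rewrite addsmx_sub sNZ addsmxSl.
have nDY : ~~ (D :&: Y <= C)%MS.
  apply/negP => sDYC.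
  have sDC : (D <= C)%MS.
    apply/rV_subP=> v vD; have /sub_addsmxP[[a b] /= ev] := submx_trans vD sDZ.
    have aC : (a *m X' <= C)%MS by rewrite (submx_trans (submxMl _ _)) // addsmxSr.
    rewrite ev addmx_sub //; apply: submx_trans sDYC; rewrite sub_capmx submxMl andbT.
    have -> : b *m Y = v - a *m X' by rewrite ev addrC addKr.
    by rewrite addmx_sub // -mulNmx (submx_trans (submxMl _ _)) // addsmxSr.
  by have [/andP[_ /negP nh] _] := sec_iso_max sCD (s_irr t'T) isoDC; case: nh.
have := constituent_sub (dclosed_avoid t' tT) t'T _ (sec_iso_cap sCD (s_irr t'T) isoDC mY nDY).
by rewrite capmxSr capmxS // => /(_ isT isT); rewrite inE le_refl andbF.
Qed.

Lemma series_strat S : dclosed S -> forall x0 : T,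
  exists U (compU : mx_composition_series rG U) (ts : seq T),
  [/\ size ts = size U, uniq ts, ts =i S, last 0 U = N S &
   forall i, (i < size U)%N -> mx_rsim (series_repr i compU) (s (nth x0 ts i))].
Proof.
move=> dS x0; move Dk : #|S| => k; elim: k S Dk dS => [|k IHk] S Dk dS.
  have comp0 : mx_composition_series rG [::] by split.
  exists [::], comp0, [::]; have -> := cards0_eq Dk; split=> //=.
  by move=> x; rewrite !inE.
have d0 : dclosed set0 by split=> [|x y]; rewrite ?sub0set // inE.
have pS : set0 \proper S by rewrite proper0 -card_gt0 Dk.
have [t tD [dSt _]] := dclosed_top dS d0 pS.
have tS : t \in S by move: tD; rewrite inE => /andP[].
have tT : t \in Th by case: dS => /subsetP->.
have [|U [compU [ts [sz un mem lst ser]]]] := IHk (S :\ t) _ dSt.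
  by have := cardsD1 t S; rewrite tS Dk => -[].
have iso : sec_iso rG (N (S :\ t)) (N S) (s t).
  by have := @strat (S :\ t) t dSt tT; rewrite !inE eqxx setD1K //; apply.
have maxS : max_submod rG (N (S :\ t)) (N S).
  by apply: sec_iso_max (s_irr tT) iso; apply: N_mono; apply: subsetDl.
have compUS : mx_composition_series rG (rcons U (N S)).
  by apply/mx_series_rcons; split=> //; [apply: N_mod | rewrite lst].
exists (rcons U (N S)), compUS, (rcons ts t); split.
- by rewrite !size_rcons sz.
- by rewrite rcons_uniq un mem !inE eqxx.
- by move=> x; rewrite mem_rcons inE mem !inE; case: eqP => [->|].
- by rewrite last_rcons.
move=> i; rewrite size_rcons ltnS leq_eqVlt => /orP[/eqP->|lti].
  have [m1 [m2 h]] := iso; rewrite nth_rcons sz ltnn eqxx.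
  apply: mx_rsim_trans h; apply: section_eqmx.
    by rewrite -rcons_cons nth_rcons /= leqnn -last_nth lst.
  by rewrite nth_rcons ltnn eqxx.
rewrite nth_rcons sz lti; apply: mx_rsim_trans (ser i lti).
by apply: section_eqmx; rewrite -?rcons_cons nth_rcons ?leqW /= ?lti // ltnS ltnW.
Qed.

Lemma JH_strat S : dclosed S -> S != set0 ->
  multiplicity_free rG (N S) /\ JH_set_eq rG (N S) (fun x => x \in S) s.
Proof.
move=> dS /set0Pn[x0 x0S].
have [U [compU [ts [sz un mem lst ser]]]] := series_strat dS x0.
have sT : forall x, x \in S -> x \in Th by case: dS => /subsetP.
have tsT i : (i < size U)%N -> nth x0 ts i \in Th.
  by move=> lti; apply: sT; rewrite -mem mem_nth ?sz.
split.
  move=> V compV lV i j ltiV ltjV rij.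
  have [szVU [q hq]] := mx_JordanHolder compV compU (eq_ind_r (fun X => (last 0 V :=: X)%MS) lV lst).
  have hi := hq (Ordinal ltiV); have hj := hq (Ordinal ltjV).
  have lti := ltn_ord (q (Ordinal ltiV)); have ltj := ltn_ord (q (Ordinal ltjV)).
  rewrite [X in (_ < X)%N]szVU in lti; rewrite [X in (_ < X)%N]szVU in ltj.
  have r1 := mx_rsim_trans hi (ser _ lti); have r2 := mx_rsim_trans hj (ser _ ltj).
  have e := s_inj (tsT _ lti) (tsT _ ltj) (mx_rsim_trans (mx_rsim_sym r1) (mx_rsim_trans rij r2)).
  have /eqP := e; rewrite nth_uniq ?sz // => /eqP/ord_inj/perm_inj e'.
  by have := congr1 val e'.
split=> [t tS|m r [V [compV [lV [i lti ri]]]]].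
  exists U, compU; split; first by rewrite lst.
  have its : (index t ts < size ts)%N by rewrite index_mem mem.
  exists (index t ts); first by rewrite -sz.
  by have := ser (index t ts); rewrite -sz nth_index ?mem //; apply.
have [szVU [q hq]] := mx_JordanHolder compV compU (eq_ind_r (fun X => (last 0 V :=: X)%MS) lV lst).
have ltj := ltn_ord (q (Ordinal lti)); rewrite [X in (_ < X)%N]szVU in ltj.
exists (nth x0 ts (q (Ordinal lti))); first by rewrite -mem mem_nth ?sz.
exact: mx_rsim_trans (mx_rsim_sym ri) (mx_rsim_trans (hq (Ordinal lti)) (ser _ ltj)).
Qed.

(** By [submodule_down], a proper submodule lies in [N (sdown t)], which is therefore the only
    maximal one. *)
Lemma cosocle_down t : t \in Th -> has_cosocle rG (N (down t)) (s t).
Proof.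
move=> tT; have [mR [mM iso]] := strat_down tT.
exists (N (sdown t)), mR, mM; split=> // W.
have maxt := max_down tT; have [ltt maxtt] := maxt.
split=> [sW|[sWM sWK]]; last exact: sWK.
split=> [|K mK [ltK maxK]]; first exact: submx_trans sW (ltmxW ltt).
have sKN : (K <= N (sdown t))%MS.
  apply/idPn => nK; case/andP: ltK => sK /negP[]; apply: submodule_down => //.
  by apply: contra nK; apply: submx_trans; rewrite sub_capmx sK submx_refl.
apply: submx_trans sW _; apply: contraT => nNK.
by case: (maxK (N (sdown t))); split=> //; rewrite ltmxE sKN.
Qed.

Lemma max_submod_exists A B : mxmodule rG A -> mxmodule rG B -> (A < B)%MS ->
  exists2 K, mxmodule rG K & (A <= K)%MS /\ max_submod rG K B.
Proof.
move Dk : (\rank B - \rank A)%N => k; elim/ltn_ind: k A Dk => k IHk A Dk mA mB ltAB.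
(* Over an arbitrary field, maximality is a proposition without a decision procedure; the recursion
   is on the dimension of B / A. *)
have [maxA|nmax] := classic (max_submod rG A B); first by exists A.
have [W [mW ltAW ltWB]] : exists W : 'M[F]_n, [/\ mxmodule rG W, (A < W)%MS & (W < B)%MS].
  have [//|nW] := classic (exists W : 'M[F]_n, [/\ mxmodule rG W, (A < W)%MS & (W < B)%MS]).
  by case: nmax; split=> // W hW; apply: nW; exists W.
have rA := ltAW; have rW := ltWB; rewrite !ltmxErank in rA rW.
case/andP: rA => sAW rA; case/andP: rW => sWB rW.
have [|K mK [sWK maxK]] := IHk (\rank B - \rank W)%N _ W erefl mW mB ltWB.
  by rewrite -Dk ltn_sub2l // (ltn_trans rA).
by exists K => //; split=> //; apply: submx_trans sWK.
Qed.

(** The simple quotient of X can only come from the stratum of t, so X meets [N (down t)] outside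
    the lower strata and contains it. A maximal submodule of X above [N (down t)] would contain the
    radical as well, hence all of X. *)
Lemma cosocle_unique S t X : dclosed S -> t \in S -> mxmodule rG X -> (X <= N S)%MS ->
  has_cosocle rG X (s t) -> (X :=: N (down t))%MS.
Proof.
move=> dS tS mX sXN [R [mR [mX' [radR rs]]]].
have tT : t \in Th by case: dS => /subsetP->.
have dd := dclosed_down t; have ds := dclosed_sdown tT.
have iso : sec_iso rG R X (s t) by exists mR, mX'.
have sRX : (R <= X)%MS by case: (radR R) => [/(_ (submx_refl _))[]].
have irr := s_irr tT.
have h1 : ~~ (X :&: N (down t) <= R)%MS.
  apply/negP=> h; have [y yD ry] := constituent_in dS dd (down_sub dS tS) sRX irr iso sXN h.
  have yT : y \in Th by move: yD; rewrite inE => /andP[_]; case: dS => /subsetP sub _ /sub.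
  by move: yD; rewrite -(s_inj tT yT ry) !inE tT le_refl.
have h2 : (X :&: N (sdown t) <= R)%MS.
  apply/idPn=> h.
  have := constituent_sub ds tT _ (sec_iso_cap sRX irr iso (N_mod ds) h).
  by rewrite capmxSr capmxS // => /(_ isT isT); rewrite !inE eqxx.
have sNX : (N (down t) <= X)%MS.
  apply: submodule_down => //; apply: contra h1 => h.
  by apply: submx_trans h2; rewrite sub_capmx capmxSl (submx_trans _ h) // sub_capmx capmxSr capmxSl.
have nNR : ~~ (N (down t) <= R)%MS.
  by apply: contra h1; apply: submx_trans; apply: capmxSr.
apply/eqmxP; rewrite sNX andbT; apply: contraT => nXN.
have [|K mK [sNK maxK]] := max_submod_exists (N_mod dd) mX; first by rewrite ltmxE sNX.
have sRK : (R <= K)%MS by case: (radR R) => [/(_ (submx_refl _))[_ h] _]; apply: h.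
have maxR := sec_iso_max sRX irr iso.
have e := max_submod_add maxR mR (N_mod dd) sNX nNR.
have [/andP[_ /negP nh] _] := maxK; case: nh.
by rewrite -e addsmx_sub sNK.
Qed.

End Stratification.

(** * The ring of length two *)

Section LocalRing.

Variables (p : nat) (k : finFieldType) (A : finComUnitRingType).
Variables (red : {rmorphism A -> k}) (tau : k -> A) (pi : A) (ub : k).
Hypotheses (p_pr : prime p) (p_odd : odd p) (chk : p \in [pchar k]).
Hypotheses (tauK : cancel tau red) (tauM : {morph tau : x y / x * y}).
Hypotheses (pi2 : pi * pi = 0) (redpi : red pi = 0).
Hypothesis kerred : forall a, red a = 0 -> exists b, a = pi * b.
Hypothesis annpi : forall a, pi * a = 0 -> red a = 0.
Hypothesis p_pi : p%:R = pi * tau ub.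

Lemma pi_red a b : red a = red b -> pi * a = pi * b.
Proof.
move=> e; have /kerred[c ec] : red (a - b) = 0 by rewrite rmorphB e subrr.
by apply/eqP; rewrite -subr_eq0 -mulrBr ec mulrA pi2 mul0r.
Qed.

Lemma red_unit a : red a != 0 -> a \is a GRing.unit.
Proof.
move=> a0; have /kerred[b eb] : red (a * tau (red a)^-1 - 1) = 0.
  by rewrite rmorphB rmorphM tauK rmorph1 divff ?subrr.
apply/unitrP; exists (tau (red a)^-1 * (1 - pi * b)).
have e : a * (tau (red a)^-1 * (1 - pi * b)) = 1.
  have -> : a * (tau (red a)^-1 * (1 - pi * b)) = (1 + (a * tau (red a)^-1 - 1)) * (1 - pi * b) by ring.
  have -> : (1 + (a * tau (red a)^-1 - 1)) * (1 - pi * b) = 1 - (pi * pi) * b * b by rewrite eb; ring.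
  by rewrite pi2 !mul0r subr0.
by rewrite e mulrC e.
Qed.

Lemma unit_red a : (a \is a GRing.unit) = (red a != 0).
Proof.
apply/idP/idP; last exact: red_unit.
by move=> /(rmorph_unit red); rewrite unitfE.
Qed.

Lemma tau1 : tau 1 = 1.
Proof.
have u : tau 1 \is a GRing.unit by rewrite unit_red tauK oner_neq0.
by apply: (mulrI u); rewrite -tauM !mulr1.
Qed.

Lemma tauX x n : tau (x ^+ n) = tau x ^+ n.
Proof. by elim: n => [|n IHn]; rewrite ?tau1 // !exprS tauM IHn. Qed.

Lemma two_neq0 : 2%:R != 0 :> k.
Proof.
have p2 : (p > 2)%N by case: p p_odd p_pr => [|[|[|]]].
apply/negP; rewrite -(dvdn_pcharf chk) => /dvdn_leq => /(_ isT).
by rewrite leqNgt p2.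
Qed.

(** The square of [tau (-1)] is 1, and [tau (-1) - 1] reduces to -2, a unit as p is odd. *)
Lemma tauN x : tau (- x) = - tau x.
Proof.
have e1 : (tau (-1) - 1) * (tau (-1) + 1) = 0.
  have -> : (tau (-1) - 1) * (tau (-1) + 1) = tau (-1) * tau (-1) - 1 by ring.
  by rewrite -tauM mulrNN mulr1 tau1 subrr.
have u : tau (-1) - 1 \is a GRing.unit.
  by rewrite unit_red rmorphB tauK rmorph1 -opprD oppr_eq0 -(natrD _ 1 1) two_neq0.
have e : tau (-1) = -1.
  by apply/eqP; rewrite -addr_eq0; apply/eqP/(mulrI u); rewrite e1 mulr0.
by rewrite -mulN1r tauM e mulN1r.
Qed.

(** The second Teichmuller coordinate; by [coE] the default value is never taken. *)
Definition co (a : A) : k := odflt 0 [pick x | a == tau (red a) + pi * tau x].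

Lemma coE a : a = tau (red a) + pi * tau (co a).
Proof.
rewrite /co; case: pickP => [x /eqP //|no]; exfalso.
have /kerred[b eb] : red (a - tau (red a)) = 0 by rewrite rmorphB tauK subrr.
have /eqP[] := no (red b); rewrite -(@pi_red b) ?tauK // -eb.
by rewrite addrC subrK.
Qed.

Lemma co_inj x y : pi * tau x = pi * tau y -> x = y.
Proof.
move=> e; apply/eqP; rewrite -subr_eq0 -[x]tauK -[y]tauK -rmorphB; apply/eqP/annpi.
by rewrite mulrBr e subrr.
Qed.

Lemma red_tp x y : red (tau x + pi * y) = x.
Proof. by rewrite rmorphD tauK rmorphM redpi mul0r addr0. Qed.

Lemma co_tp x y : co (tau x + pi * y) = red y.
Proof.
apply: co_inj; have := coE (tau x + pi * y); rewrite red_tp => /addrI <-.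
by apply: pi_red; rewrite tauK.
Qed.

Lemma co_tau x : co (tau x) = 0.
Proof. by have := co_tp x 0; rewrite mulr0 addr0 rmorph0. Qed.

(* The carry in the addition of Teichmuller lifts. *)
Definition Sw x y := co (tau x + tau y).

Lemma coD a b : co (a + b) = co a + co b + Sw (red a) (red b).
Proof.
have e : a + b = tau (red (a + b)) + pi * (tau (co a) + tau (co b) + tau (Sw (red a) (red b))).
  have e1 : tau (red a) + tau (red b) = tau (red (a + b)) + pi * tau (Sw (red a) (red b)).
    by rewrite {1}[tau _ + tau _]coE !rmorphD /= !tauK.
  by rewrite {1}(coE a) {1}(coE b) addrACA e1; ring.
by rewrite e co_tp !rmorphD !tauK.
Qed.

(** Teichmuller lifts are multiplicative, so [co] obeys the Leibniz rule; only its additivity fails,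
    by the carry. *)
Lemma coM a b : co (a * b) = co a * red b + red a * co b.
Proof.
have e : a * b = tau (red (a * b)) + pi * (tau (co a) * b + tau (red a) * tau (co b)).
  rewrite [RHS](_ : _ = tau (red a) * tau (red b) + (pi * tau (co a)) * b + tau (red a) * (pi * tau (co b))).
    rewrite -addrA [X in _ + X]addrC addrA -mulrDr -coE.
    by rewrite {1}(coE a) mulrDl.
  by rewrite rmorphM tauM; ring.
by rewrite e co_tp rmorphD !rmorphM !tauK.
Qed.

(** A p-th power has no second coordinate, because p is a multiple of pi and pi^2 = 0. So (tau x +
    tau y)^p is the lift of (x + y)^p, and the binomial formula compares it with the lifts of x^p
    and y^p; the middle coefficients are multiples of p = pi * tau ub. *)
Lemma Sw_formula x y : Sw (x ^+ p) (y ^+ p) =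
  - (ub * \sum_(j < p | (j : nat) != 0%N) ('C(p, j) %/ p)%:R * (x ^+ (p - j) * y ^+ j)).
Proof.
have p0 : (0 < p)%N by apply: prime_gt0.
have e1 : (tau x + tau y) ^+ p = tau ((x + y) ^+ p).
  rewrite (coE (tau x + tau y)) rmorphD !tauK exprDn.
  rewrite big_ord_recl /= subn0 expr0 mulr1 bin0 mulr1n -tauX.
  rewrite big1 ?addr0 // => i _; rewrite /bump /= add1n.
  have [lt|ge] := ltnP 0 i.
    by rewrite exprMn (_ : pi ^+ i.+1 = 0) ?mul0r ?mulr0 ?mul0rn // -(prednK lt) !exprS mulrA pi2 mul0r.
  have -> : (i : nat) = 0%N by apply/eqP; rewrite -leqn0.
  (* The linear term in pi has the coefficient p, which supplies the second factor pi. *)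
  rewrite bin1 -mulr_natr p_pi expr1.
  have aux X Z : X * (pi * Z) * (pi * tau ub) = (pi * pi) * (X * Z * tau ub) by ring.
  by rewrite aux pi2 mul0r.
have e2 : (tau x + tau y) ^+ p = tau (x ^+ p) + tau (y ^+ p) +
   pi * (tau ub * \sum_(j < p | (j : nat) != 0%N) ('C(p, j) %/ p)%:R * (tau x ^+ (p - j) * tau y ^+ j)).
  rewrite exprDn big_ord_recr /= subnn expr0 mul1r binn mulr1n -tauX.
  rewrite mulr_sumr mulr_sumr (bigD1 (Ordinal p0)) //= subn0 expr0 mulr1 bin0 mulr1n -tauX.
  rewrite addrAC; congr (_ + _); apply: eq_big => [j|j nj].
    by rewrite -val_eqE.
  rewrite mulrA -p_pi mulrA -natrM mulnC divnK ?mulr_natl // prime_dvd_bin //.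
  by rewrite lt0n -val_eqE /= in nj *; rewrite nj ltn_ord.
have e3 : tau (x ^+ p) + tau (y ^+ p) = tau ((x + y) ^+ p) + pi *
   - (tau ub * \sum_(j < p | (j : nat) != 0%N) ('C(p, j) %/ p)%:R * (tau x ^+ (p - j) * tau y ^+ j)).
  by rewrite -e1 e2 mulrN addrK.
rewrite /Sw e3 co_tp rmorphN rmorphM tauK rmorph_sum; congr (- (_ * _)).
by apply: eq_bigr => j _; rewrite !rmorphM !rmorphXn !tauK rmorph_nat.
Qed.

End LocalRing.

Lemma det22 (R : comPzRingType) (g : 'M[R]_2) :
  \det g = g 0 0 * g 1 1 - g 0 1 * g 1 0.
Proof.
rewrite (expand_det_row _ 0) !big_ord_recl big_ord0 addr0 /cofactor !det_mx11 !mxE /=.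
have -> : lift ord0 ord0 = 1 :> 'I_2 by apply: val_inj.
have -> : lift (1 : 'I_2) ord0 = 0 :> 'I_2 by apply: val_inj.
have -> : ord0 = 0 :> 'I_2 by apply: val_inj.
by rewrite /= expr0 expr1 mul1r mulN1r mulrN.
Qed.

Lemma mulmx22 (R : pzSemiRingType) (g h : 'M[R]_2) x y :
  (g *m h) x y = g x 0 * h 0 y + g x 1 * h 1 y.
Proof.
by rewrite mxE !big_ord_recl big_ord0 addr0 /=; congr (_ * _ + g _ _ * h _ _); apply: val_inj.
Qed.

(** * Multihomogeneous functions of the bottom row and the group action on them *)

Section Functions.

Variables (p f : nat) (k : finFieldType) (E : fieldType) (iota : {rmorphism k -> E}).
Variables (A : finComUnitRingType).
Variables (red : {rmorphism A -> k}) (tau : k -> A) (pi : A) (ub : k).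
Hypotheses (p_pr : prime p) (card_k : #|k| = (p ^ f)%N) (chk : p \in [pchar k]).
Hypotheses (tauK : cancel tau red) (tauM : {morph tau : x y / x * y}).
Hypotheses (pi2 : pi * pi = 0) (redpi : red pi = 0).
Hypothesis kerred : forall a, red a = 0 -> exists b, a = pi * b.
Hypothesis annpi : forall a, pi * a = 0 -> red a = 0.
Hypothesis p_pi : p%:R = pi * tau ub.

Local Notation co := (co red tau pi).
Local Notation Sw := (Sw red tau pi).
Local Notation fn := (A * A -> E).

Definition fr (x : k) (i : 'I_f) : E := iota x ^+ (p ^ i).

Lemma chE : p \in [pchar E].
Proof. by rewrite (fmorph_pchar iota). Qed.

Lemma frD i : {morph fr^~ i : x y / x + y}.
Proof.
move=> x y; rewrite /fr rmorphD exprDn_pchar // (eq_pnat _ (pcharf_eq chE)).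
by rewrite pnatX pnat_id.
Qed.

Lemma frM i : {morph fr^~ i : x y / x * y}.
Proof. by move=> x y; rewrite /fr rmorphM exprMn. Qed.

Lemma fr0 i : fr 0 i = 0.
Proof. by rewrite /fr rmorph0 expr0n expn_eq0; case: p p_pr. Qed.

Lemma fr1 i : fr 1 i = 1.
Proof. by rewrite /fr rmorph1 expr1n. Qed.

Lemma frN x i : fr (- x) i = - fr x i.
Proof. by apply/eqP; rewrite -addr_eq0 -frD addNr fr0. Qed.

Lemma frB x y i : fr (x - y) i = fr x i - fr y i.
Proof. by rewrite frD frN. Qed.

Lemma fr_eq0 x i : (fr x i == 0) = (x == 0).
Proof. by rewrite /fr expf_eq0 fmorph_eq0 expn_gt0 prime_gt0. Qed.

Lemma fr_sum (I : Type) (s : seq I) (P : pred I) (F : I -> k) i :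
  fr (\sum_(j <- s | P j) F j) i = \sum_(j <- s | P j) fr (F j) i.
Proof. by elim/big_rec2: _ => [|j x y _ <-]; rewrite ?fr0 // frD. Qed.

Lemma fr_nat n i : fr n%:R i = n%:R.
Proof. by elim: n => [|n IHn]; rewrite ?fr0 // -addn1 !natrD frD IHn fr1. Qed.

Lemma frX x n i : fr (x ^+ n) i = fr x i ^+ n.
Proof. by rewrite /fr rmorphXn exprAC. Qed.

Lemma expf_q (x : k) : x ^+ (p ^ f) = x.
Proof. by rewrite -card_k expf_card. Qed.

Lemma fr_ordS x i : fr x (ordS i) = fr x i ^+ p.
Proof.
rewrite /fr /= -exprM -expnSr.
have [lt|ge] := ltnP i.+1 f; first by rewrite modn_small.
have e : i.+1 = f by apply/eqP; rewrite eqn_leq ge ltn_ord.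
by rewrite e modnn expn0 expr1 -rmorphXn expf_q.
Qed.

Lemma fr_ord_pred x i : fr x (ord_pred i) ^+ p = fr x i.
Proof. by rewrite -fr_ordS ord_predK. Qed.

(** The inverse of Frobenius, which brings arbitrary arguments to the shape required by
    [Sw_formula]. *)
Definition rootp (x : k) := x ^+ (p ^ f.-1).

Lemma f_gt0 : (0 < f)%N.
Proof.
rewrite lt0n; apply/eqP=> f0; have := card_finNzRing_gt1 k.
by rewrite card_k f0.
Qed.

Lemma rootpK x : rootp x ^+ p = x.
Proof. by rewrite /rootp -exprM -expnSr prednK ?f_gt0 // expf_q. Qed.

Lemma fr_rootp x i : fr (rootp x) i = fr x (ord_pred i).
Proof.
by rewrite -{1}[i]ord_predK fr_ordS -frX rootpK.
Qed.

Definition cx (v : A * A) i := fr (red v.1) i.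
Definition dx (v : A * A) i := fr (red v.2) i.
(* On the bottom row of h with h (lambda 1; 1 0) in B_2, this is
   - (red v.1)^2 lambda_1. *)
Definition detv (v : A * A) : k := red v.1 * co v.2 - red v.2 * co v.1.
Definition DD (v : A * A) i := fr (detv v) i.
Definition vact (v : A * A) (g : 'M[A]_2) : A * A :=
  (v.1 * g 0 0 + v.2 * g 1 0, v.1 * g 0 1 + v.2 * g 1 1).

Definition mon0 (e m : 'I_f -> nat) : fn := fun v => \prod_i (cx v i ^+ e i * dx v i ^+ m i).

(** [mhom] is the intersection of all such predicates that contain the monomials: a span that comes
    with its induction principle. The last clause stands for functional extensionality. *)
Definition lin_closed (Q : fn -> Prop) :=
  [/\ Q (fun _ => 0), forall F G, Q F -> Q G -> Q (fun v => F v + G v),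
      forall a F, Q F -> Q (fun v => a * F v)
    & forall F G, F =1 G -> Q F -> Q G].

(* Multihomogeneous polynomials in the pairs (cx _ i, dx _ i), of degree n i in
   the i-th pair, as functions; since fr x (ordS i) = fr x i ^+ p, a function
   can have several multidegrees. *)
Variant mhom (n : 'I_f -> nat) (F : fn) : Prop := MHom of
  forall Q, lin_closed Q -> (forall e m, (forall i, e i + m i = n i)%N -> Q (mon0 e m)) -> Q F.

Lemma hom_mon0 e m n : (forall i, e i + m i = n i)%N -> mhom n (mon0 e m).
Proof. by move=> en; split=> Q _; apply. Qed.

Lemma hom_ext n n' F G : n =1 n' -> F =1 G -> mhom n F -> mhom n' G.
Proof.
move=> en eF [hF]; split=> Q Ql Qm; have [_ _ _ Qe] := Ql.
by apply: Qe eF _; apply: hF => // e m em; apply: Qm => i; rewrite em en.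
Qed.

Lemma hom0 n : mhom n (fun _ => 0).
Proof. by split=> Q []. Qed.

Lemma homD n F G : mhom n F -> mhom n G -> mhom n (fun v => F v + G v).
Proof. by move=> [hF] [hG]; split=> Q Ql Qm; have [_ QD _ _] := Ql; exact: QD (hF Q Ql Qm) (hG Q Ql Qm). Qed.

Lemma homZ n a F : mhom n F -> mhom n (fun v => a * F v).
Proof. by move=> [hF]; split=> Q Ql Qm; have [_ _ QZ _] := Ql; exact: QZ (hF Q Ql Qm). Qed.

Lemma homN n F : mhom n F -> mhom n (fun v => - F v).
Proof. by move=> /(homZ (-1)); apply: hom_ext => // v; rewrite mulN1r. Qed.

Lemma homB n F G : mhom n F -> mhom n G -> mhom n (fun v => F v - G v).
Proof. by move=> hF hG; apply: homD => //; apply: homN. Qed.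

Lemma hom_sum n (I : Type) (s : seq I) (P : pred I) (F : I -> fn) :
  (forall i, P i -> mhom n (F i)) -> mhom n (fun v => \sum_(i <- s | P i) F i v).
Proof.
move=> hF; elim: s => [|i s IHs].
  by apply: hom_ext (hom0 n) => // v; rewrite big_nil.
case Pi : (P i); last by apply: hom_ext IHs => // v; rewrite big_cons Pi.
by apply: hom_ext (homD (hF i Pi) IHs) => // v; rewrite big_cons Pi.
Qed.

Lemma mon0M e m e' m' v : mon0 e m v * mon0 e' m' v =
  mon0 (fun i => e i + e' i)%N (fun i => m i + m' i)%N v.
Proof. by rewrite /mon0 -big_split; apply: eq_bigr => i _; rewrite /= mulrACA -!exprD. Qed.

Lemma homM n n' F G : mhom n F -> mhom n' G -> mhom (fun i => n i + n' i)%N (fun v => F v * G v).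
Proof.
move=> [hF] [hG]; split=> Q Ql Qm; have [Q0 QD QZ Qe] := Ql.
apply: (hF (fun F => Q (fun v => F v * G v))) => [|e m em].
  split=> [|F1 F2 h1 h2|a F1 h1|F1 F2 e12 h1].
  - by apply: Qe Q0 => v; rewrite mul0r.
  - by apply: Qe (QD _ _ h1 h2) => v; rewrite mulrDl.
  - by apply: Qe (QZ a _ h1) => v; rewrite mulrA.
  - by apply: Qe h1 => v; rewrite e12.
apply: (hG (fun G => Q (fun v => mon0 e m v * G v))) => [|e' m' em'].
  split=> [|F1 F2 h1 h2|a F1 h1|F1 F2 e12 h1].
  - by apply: Qe Q0 => v; rewrite mulr0.
  - by apply: Qe (QD _ _ h1 h2) => v; rewrite mulrDr.
  - by apply: Qe (QZ a _ h1) => v; rewrite mulrCA.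
  - by apply: Qe h1 => v; rewrite e12.
apply: (Qe (mon0 (fun i => e i + e' i)%N (fun i => m i + m' i)%N)).
  by move=> v; rewrite mon0M.
by apply: Qm => i; rewrite addnACA em em'.
Qed.

Lemma hom1 : mhom (fun _ => 0%N) (fun _ => 1).
Proof.
apply: (hom_ext (n := fun _ => 0%N) (F := mon0 (fun _ => 0%N) (fun _ => 0%N))) => //.
  by move=> v; rewrite /mon0 big1 // => i _; rewrite !expr0 mulr1.
exact: hom_mon0.
Qed.

Lemma homX n F j : mhom n F -> mhom (fun i => n i * j)%N (fun v => F v ^+ j).
Proof.
move=> hF; elim: j => [|j IHj].
  by apply: hom_ext hom1 => [i|v]; rewrite ?muln0 ?expr0.
by apply: hom_ext (homM hF IHj) => [i|v]; rewrite ?mulnS ?exprS.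
Qed.

Lemma hom_prod (I : Type) (s : seq I) (P : pred I) (n : I -> 'I_f -> nat) (F : I -> fn) :
  (forall i, P i -> mhom (n i) (F i)) ->
  mhom (fun j => \sum_(i <- s | P i) n i j)%N (fun v => \prod_(i <- s | P i) F i v).
Proof.
move=> hF; elim: s => [|i s IHs].
  by apply: hom_ext hom1 => [j|v]; rewrite big_nil.
case Pi : (P i); last by apply: hom_ext IHs => [j|v]; rewrite big_cons Pi.
by apply: hom_ext (homM (hF i Pi) IHs) => [j|v]; rewrite big_cons Pi.
Qed.

Definition eps (i j : 'I_f) : nat := (j == i).

Lemma hom_cx i : mhom (eps i) (cx^~ i).
Proof.
apply: (hom_ext (n := eps i) (F := mon0 (eps i) (fun _ => 0%N))) => //.
  move=> v; rewrite /mon0 (bigD1 i) //= big1 /eps ?eqxx ?expr1 ?expr0 ?mulr1 //.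
  by move=> j /negPf->; rewrite !expr0 mulr1.
by apply: hom_mon0 => j; rewrite addn0.
Qed.

Lemma hom_dx i : mhom (eps i) (dx^~ i).
Proof.
apply: (hom_ext (n := eps i) (F := mon0 (fun _ => 0%N) (eps i))) => //.
  move=> v; rewrite /mon0 (bigD1 i) //= big1 /eps ?eqxx ?expr1 ?expr0 ?mul1r ?mulr1 //.
  by move=> j /negPf->; rewrite !expr0 mulr1.
by apply: hom_mon0 => j; rewrite add0n.
Qed.

Lemma hom_cxp i : mhom (fun j => p * eps (ord_pred i) j)%N (cx^~ i).
Proof.
apply: hom_ext (homX p (hom_cx (ord_pred i))) => [j|v]; first by rewrite mulnC.
exact: fr_ord_pred.
Qed.

Lemma hom_dxp i : mhom (fun j => p * eps (ord_pred i) j)%N (dx^~ i).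
Proof.
apply: hom_ext (homX p (hom_dx (ord_pred i))) => [j|v]; first by rewrite mulnC.
exact: fr_ord_pred.
Qed.

Lemma cx_act v g i : cx (vact v g) i = fr (red (g 0 0)) i * cx v i + fr (red (g 1 0)) i * dx v i.
Proof. by rewrite /cx /dx /vact /= rmorphD !rmorphM frD !frM mulrC [X in _ + X]mulrC. Qed.

Lemma dx_act v g i : dx (vact v g) i = fr (red (g 0 1)) i * cx v i + fr (red (g 1 1)) i * dx v i.
Proof. by rewrite /cx /dx /vact /= rmorphD !rmorphM frD !frM mulrC [X in _ + X]mulrC. Qed.

Lemma hom_cx_act g i : mhom (eps i) (fun v => cx (vact v g) i).
Proof.
apply: hom_ext (homD (homZ (fr (red (g 0 0)) i) (hom_cx i)) (homZ (fr (red (g 1 0)) i) (hom_dx i))) => // v.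
by rewrite cx_act.
Qed.

Lemma hom_dx_act g i : mhom (eps i) (fun v => dx (vact v g) i).
Proof.
apply: hom_ext (homD (homZ (fr (red (g 0 1)) i) (hom_cx i)) (homZ (fr (red (g 1 1)) i) (hom_dx i))) => // v.
by rewrite dx_act.
Qed.

Lemma sum_eps (n : 'I_f -> nat) j : (\sum_i n i * eps i j = n j)%N.
Proof.
rewrite (bigD1 j) //= /eps eqxx muln1 big1 ?addn0 // => i /negPf ij.
by rewrite eq_sym ij muln0.
Qed.

Lemma hom_act n F g : mhom n F -> mhom n (fun v => F (vact v g)).
Proof.
move=> [hF]; apply: (hF (fun F => mhom n (fun v => F (vact v g)))) => [|e m em].
  split=> [|F1 F2|a F1|F1 F2 e12].
  - exact: hom0.
  - exact: homD.
  - exact: homZ.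
  - by apply: hom_ext => // v; rewrite e12.
have h i : mhom (fun j => n i * eps i j)%N (fun v => cx (vact v g) i ^+ e i * dx (vact v g) i ^+ m i).
  apply: hom_ext (homM (homX (e i) (hom_cx_act g i)) (homX (m i) (hom_dx_act g i))) => // j.
  by rewrite -mulnDr em mulnC.
apply: hom_ext (hom_prod (index_enum _) (P := xpredT) (fun i _ => h i)) => // j.
exact: sum_eps.
Qed.

Lemma fr_Sw x y i : fr (Sw x y) i = - (fr ub i * \sum_(j < p | (j : nat) != 0%N)
   ('C(p, j) %/ p)%:R * (fr x (ord_pred i) ^+ (p - j) * fr y (ord_pred i) ^+ j)).
Proof.
rewrite -{1}[x]rootpK -{1}[y]rootpK (Sw_formula p_pr tauK tauM pi2 redpi kerred annpi p_pi).
rewrite frN frM fr_sum; congr (- (_ * _)); apply: eq_bigr => j _.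
by rewrite !frM fr_nat (frX _ (p - j)) (frX _ j) !fr_rootp.
Qed.

Lemma hom_Sw i (a b : k) : mhom (fun j => p * eps (ord_pred i) j)%N
  (fun v => fr (Sw (red v.1 * a) (red v.2 * b)) i).
Proof.
pose G v := - (fr ub i * \sum_(j < p | (j : nat) != 0%N)
   (('C(p, j) %/ p)%:R * (fr a (ord_pred i) ^+ (p - j) * fr b (ord_pred i) ^+ j)) *
    (cx v (ord_pred i) ^+ (p - j) * dx v (ord_pred i) ^+ j)).
apply: (hom_ext (F := G)) => // [v|].
  rewrite fr_Sw /G; congr (- (_ * _)); apply: eq_bigr => j _.
  by rewrite !frM !exprMn /cx /dx; ring.
apply/homN/homZ/hom_sum => j j0; apply: homZ.
apply: hom_ext (homM (homX (p - j) (hom_cx _)) (homX j (hom_dx _))) => // l.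
rewrite -mulnDr (_ : (p - j + j)%N = p); first exact: mulnC.
by apply: subnK; apply: ltnW; apply: ltn_ord.
Qed.

Definition RR g i v := DD (vact v g) i - fr (red (\det g)) i * DD v i.

(** Apply [coD] and [coM] to the coordinates of [vact v g]. The terms where [co] falls on [v] add up
    to the determinant times [DD]. The others, [Q0] and [Q1], have degree p at i - 1: the carry by
    [hom_Sw], those where [co] falls on [g] because c_i = c_(i-1)^p. The remaining coordinate gives
    the degree 1 at i. *)
Lemma hom_RR g i : mhom (fun j => eps i j + p * eps (ord_pred i) j)%N (RR g i).
Proof.
pose Q1 v := cx v i * fr (co (g 0 1)) i + dx v i * fr (co (g 1 1)) i
   + fr (Sw (red v.1 * red (g 0 1)) (red v.2 * red (g 1 1))) i.
pose Q0 v := cx v i * fr (co (g 0 0)) i + dx v i * fr (co (g 1 0)) i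
   + fr (Sw (red v.1 * red (g 0 0)) (red v.2 * red (g 1 0))) i.
have hQ a b c d : mhom (fun j => p * eps (ord_pred i) j)%N (fun v => cx v i * fr a i + dx v i * fr b i
   + fr (Sw (red v.1 * c) (red v.2 * d)) i).
  apply: homD (hom_Sw i c d); apply: hom_ext (homD (homZ (fr a i) (hom_cxp i)) (homZ (fr b i) (hom_dxp i))) => // v.
  by rewrite mulrC; congr (_ + _); rewrite mulrC.
apply: (hom_ext (F := fun v => cx (vact v g) i * Q1 v - dx (vact v g) i * Q0 v)) => // [v|]; last first.
  by apply: homB; apply: homM; rewrite ?/Q0 ?/Q1; [exact: hom_cx_act | exact: hQ | exact: hom_dx_act | exact: hQ].
rewrite /RR /DD -frM -frB /Q1 /Q0 /cx /dx -!frM -!frD -!frM -frB; congr fr.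
rewrite /detv /vact /= det22.
rewrite !(coD tauK pi2 redpi kerred annpi) !(coM tauK tauM pi2 redpi kerred annpi) !rmorphD !rmorphN !rmorphM /=.
by ring.
Qed.

Lemma DD_act v g i : DD (vact v g) i = fr (red (\det g)) i * DD v i + RR g i v.
Proof. by rewrite /RR addrC subrK. Qed.

End Functions.

(** * The poset of pairs and the degrees *)

Section Poset.

Variable f : nat.
Local Notation TT := ({set 'I_f} * {set 'I_f})%type.
Implicit Types (I J D : {set 'I_f}) (t : TT).

Lemma in_shift I j : (j \in shift I) = (ordS j \in I).
Proof.
apply/imsetP/idP=> [[i iI ->]|h]; first by rewrite ord_predK.
by exists (ordS j); rewrite ?ordSK.
Qed.

Definition ThetaS : {set TT} := [set t : TT | t.1 :&: shift t.2 == set0].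

Lemma ThetaP t : reflect (Theta t) (t \in ThetaS).
Proof. by rewrite inE; apply: eqP. Qed.

Lemma ThetaSP t : reflect (forall i, i \in t.2 -> ord_pred i \notin t.1) (t \in ThetaS).
Proof.
rewrite inE; apply: (iffP eqP) => [e i iI|h].
  apply/negP=> iJ; have := in_set0 (ord_pred i).
  by rewrite -e inE iJ in_shift ord_predK iI.
apply/setP=> i; rewrite !inE in_shift; apply/negP=> /andP[iJ iI].
by have := h _ iI; rewrite ordSK iJ.
Qed.

Definition tle : rel TT := fun t' t =>
  (t'.2 \subset t.2) && (t'.1 \subset t.1 :|: shift (t.2 :\: t'.2)).

Lemma tleP t' t : reflect (Theta_le t' t) (tle t' t).
Proof. exact: andP. Qed.

Lemma tle_refl t : tle t t.
Proof. by rewrite /tle subxx subsetUl. Qed.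

Lemma tle_trans x y z : tle x y -> tle y z -> tle x z.
Proof.
case/andP=> [s1 s2] /andP[s3 s4]; rewrite /tle (subset_trans s1 s3) /=.
apply/subsetP=> i /(subsetP s2); rewrite !inE !in_shift !inE => /orP[/(subsetP s4)|/andP[n1 h1]].
  rewrite !inE !in_shift !inE => /orP[->//|/andP[n2 ->]]; rewrite andbT.
  by rewrite (contra _ n2) ?orbT // => h; apply: (subsetP s1).
by rewrite n1 (subsetP s3 _ h1) orbT.
Qed.

(** The factor 2 is needed because an index that leaves I may bring its predecessor into J; such a
    move then lowers the rank by exactly one. *)
Definition trk t := (2 * #|t.2| + #|t.1|)%N.

Lemma card_shift I : #|shift I| = #|I|.
Proof. by rewrite /shift card_imset //; apply: can_inj (@ord_predK f). Qed.

Lemma tle_rk x y : tle x y -> x != y -> (trk x < trk y)%N.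
Proof.
case: x y => [J' I'] [J I] /andP[/= sI sJ] ne.
have cI : (#|I| = #|I'| + #|I :\: I'|)%N by rewrite cardsDS // subnKC // subset_leq_card.
have cJ : (#|J'| <= #|J| + #|I :\: I'|)%N.
  apply: leq_trans (subset_leq_card sJ) _; apply: leq_trans (leq_card_setU _ _) _.
  by rewrite card_shift.
rewrite /trk /= cI; have [e0|e1] := posnP #|I :\: I'|; last first.
  by move: #|I :\: I'| #|J'| #|J| #|I'| cJ e1 => a b c d; lia.
have eI : I = I'.
  by apply/eqP; rewrite eqEsubset sI -setD_eq0 -cards_eq0 e0 eqxx.
have : J' \proper J.
  rewrite properEneq; move: sJ; rewrite eI setDv.
  have -> : shift (set0 : {set 'I_f}) = set0 by apply/setP=> i; rewrite in_shift !inE.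
  rewrite setU0 => ->; rewrite andbT; apply: contraNneq ne => ->.
  by rewrite eI.
by move/proper_card; rewrite e0 addn0 ltn_add2l.
Qed.

(** Where a translate goes when D_i is replaced by its remainder for every i in [D]. *)
Definition tD t D : TT := (t.1 :|: shift D, t.2 :\: D).

Lemma tD_Theta t D : t \in ThetaS -> D \subset t.2 -> tD t D \in ThetaS.
Proof.
move=> /ThetaSP h sD; apply/ThetaSP=> i /=; rewrite !inE in_shift ord_predK => /andP[nD iI].
by rewrite negb_or h.
Qed.

Lemma tD_le t D : D \subset t.2 -> tle (tD t D) t.
Proof.
move=> sD; rewrite /tle /= subsetDl setUS //; apply/subsetP=> i; rewrite !in_shift !inE => h.
by rewrite h (subsetP sD).
Qed.

(** Where a monomial goes when the carry c_j^p = c_(j+1), or the same for d, is performed. *)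
Definition tJ t j : TT := (t.1 :\ j, t.2).

Lemma tJ_Theta t j : t \in ThetaS -> tJ t j \in ThetaS.
Proof. by move=> /ThetaSP h; apply/ThetaSP=> i /h; rewrite /= !inE negb_and orbC => ->. Qed.

Lemma tJ_le t j : tle (tJ t j) t.
Proof. by rewrite /tle /= subxx (subset_trans (subsetDl _ _)) ?subsetUl. Qed.

Lemma tJ_rk t j : j \in t.1 -> trk t = (trk (tJ t j)).+1.
Proof. by move=> jJ; rewrite /trk /= (cardsD1 j t.1) jJ add1n addnS. Qed.

Lemma tD1_rk t i : t \in ThetaS -> i \in t.2 -> trk t = (trk (tD t [set i])).+1.
Proof.
move=> /ThetaSP h iI; rewrite /trk /= (cardsD1 i t.2) iI.
have -> : t.1 :|: shift [set i] = ord_pred i |: t.1.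
  apply/setP=> j; rewrite !inE in_shift inE orbC; congr (_ || _).
  by rewrite (can2_eq (@ordSK f) (@ord_predK f)).
by rewrite cardsU1 (h _ iI) /=; move: #|_ :\ _| #|t.1| => a b; lia.
Qed.

Lemma tle_cover x t : x \in ThetaS -> tle x t -> x != t ->
  (exists2 j, j \in t.1 & tle x (tJ t j)) \/ (exists2 i, i \in t.2 & tle x (tD t [set i])).
Proof.
move=> xT /andP[sI sJ] ne; have [eI|nI] := eqVneq x.2 t.2.
  have pJ : x.1 \proper t.1.
    rewrite properEneq; move: sJ; rewrite eI setDv.
    have -> : shift (set0 : {set 'I_f}) = set0 by apply/setP=> i; rewrite in_shift !inE.
    rewrite setU0 => ->; rewrite andbT; apply: contraNneq ne => eJ.
    by rewrite [x]surjective_pairing [t]surjective_pairing eI eJ.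
  left; have /properP[_ [j jt nj]] := pJ; exists j => //.
  rewrite /tle /= eI subxx /= (subset_trans _ (subsetUl _ _)) // subsetD1 nj andbT.
  exact: proper_sub.
right; have pI : x.2 \proper t.2 by rewrite properEneq nI.
have /properP[_ [i it ni]] := pI; exists i => //; rewrite /tle /= subsetD1 sI ni /=.
apply/subsetP=> j /(subsetP sJ); rewrite !inE !in_shift !inE.
by case: (j \in t.1) => //= /andP[-> ->]; rewrite andbT orbN.
Qed.

End Poset.

(** * Multidegrees of the strata and their bounds for generic r *)

Section Degrees.

Variables (p f : nat) (rd : 'I_f -> nat).
Hypothesis rd_gen : forall i, (3 <= rd i <= p - 3)%N.
Local Notation TT := ({set 'I_f} * {set 'I_f})%type.
Implicit Types (t : TT).

(* The digits of r - 2 p^I, and the digits s_J and t_J attached to them. In nd,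
   a factor c_(i+1) is traded for c_i^p at each i in J. *)
Definition ad t i := (rd i - 2 * (i \in t.2))%N.
Definition nd t i := (ad t i - (ord_pred i \in t.1) + p * (i \in t.1))%N.
Definition sd t i : nat :=
  if i \notin t.1 then 0 else if ord_pred i \in t.1 then ad t i else (ad t i).+1.
Definition td t i : nat :=
  match ord_pred i \in t.1, i \in t.1 with
  | false, false => ad t i
  | true, false => ad t i - 1
  | false, true => p - 2 - ad t i
  | true, true => p - 1 - ad t i
  end.

Lemma ad_lt t i : (ad t i < p)%N.
Proof. by have := rd_gen i; rewrite /ad; lia. Qed.

Lemma nd_in t i : i \in t.1 -> [/\ nd t i = sd t i + (p - 1), td t i + sd t i = p - 1,
   ad t i <= sd t i <= (ad t i).+1, 1 <= ad t i <= p - 3 & 1 <= td t i]%N.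
Proof.
move=> iJ; have := rd_gen i; rewrite /nd /sd /td /ad iJ /=.
by case: (ord_pred i \in t.1); case: (i \in t.2); split; lia.
Qed.

Lemma nd_out t i : i \notin t.1 -> [/\ sd t i = 0, nd t i = td t i, td t i <= p - 3,
   1 <= ad t i <= p - 3 & td t i <= ad t i <= (td t i).+1]%N.
Proof.
move=> iJ; have := rd_gen i; rewrite /nd /sd /td /ad (negPf iJ) /=.
by case: (ord_pred i \in t.1); case: (i \in t.2); split; lia.
Qed.

Lemma nd_lt t i : (nd t i < 2 * p)%N.
Proof. by have := rd_gen i; rewrite /nd /ad; case: (i \in t.1); lia. Qed.

Lemma st_le t i : (sd t i + td t i <= nd t i)%N.
Proof.
have [/nd_in[]|/nd_out[]] := boolP (i \in t.1); lia.
Qed.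

Lemma st_lt t i : (sd t i + td t i < p)%N.
Proof.
have := rd_gen i; have [/nd_in[]|/nd_out[]] := boolP (i \in t.1); lia.
Qed.

(** The additive form avoids truncated subtraction and covers f = 1, where [ordS j] is j. *)
Lemma nd_tJ t j i : j \in t.1 ->
  (nd (tJ t j) i + p * (i == j) = nd t i + (i == ordS j))%N.
Proof.
move=> jJ; have := rd_gen i; rewrite /nd /ad /= !inE.
rewrite (can2_eq (@ord_predK f) (@ordSK f)).
have b1 : i == j -> i \in t.1 by move/eqP->.
have b2 : i == ordS j -> ord_pred i \in t.1 by move/eqP->; rewrite ordSK.
move: (i == j) (i == ordS j) (i \in t.1) (ord_pred i \in t.1) (i \in t.2) b1 b2.
by move=> [] [] [] [] [] // b1 b2; try (by have := b1 isT); try (by have := b2 isT); move=> /=; lia.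
Qed.

(** When i leaves I, its degree grows by 2 and loses 1 again as i - 1 enters J, where p is added.
    This is the degree of the remainder in [hom_RR]. *)
Lemma nd_tD t (D : {set 'I_f}) i : t \in ThetaS f -> D \subset t.2 ->
  nd (tD t D) i = (nd t i + (i \in D) + p * (ordS i \in D))%N.
Proof.
move=> /ThetaSP h sD; have := rd_gen i; rewrite /nd /ad /= !inE !in_shift ord_predK.
have h1 : i \in D -> i \in t.2 := subsetP sD i.
have h2 : i \in D -> ord_pred i \notin t.1 by move/h1/h.
have h3 : ordS i \in D -> i \notin t.1 by move=> /(subsetP sD)/h; rewrite ordSK.
move: (i \in D) (ordS i \in D) (i \in t.1) (ord_pred i \in t.1) (i \in t.2) h1 h2 h3.
move=> [] [] [] [] [] // h1 h2 h3; try (by have := h1 isT); try (by have := h2 isT);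
  try (by have := h3 isT); by move=> /=; lia.
Qed.

End Degrees.

(** * Expansions in base p *)

Section Digits.

Variables (p : nat).
Hypothesis p_gt1 : (1 < p)%N.

Lemma digits_ltn f (a : nat -> nat) : (forall i, i < f -> a i < p)%N ->
  (\sum_(i < f) a i * p ^ i < p ^ f)%N.
Proof.
elim: f => [|f IHf] h; first by rewrite big_ord0 expn0.
rewrite big_ord_recr /=.
have h1 : (\sum_(i < f) a i * p ^ i < p ^ f)%N by apply: IHf => i lti; apply: h; apply: ltnW.
have h2 : (a f < p)%N by apply: h.
rewrite (@leq_trans ((a f).+1 * p ^ f)) //; first by rewrite mulSn ltn_add2r.
by rewrite expnS leq_mul2r h2 orbT.
Qed.

Lemma digitsE f (a : nat -> nat) j : (forall i, i < f -> a i < p)%N -> (j < f)%N ->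
  ((\sum_(i < f) a i * p ^ i) %/ p ^ j %% p = a j)%N.
Proof.
move=> h ltj; have p0 : (0 < p)%N by apply: ltnW.
have pj : (0 < p ^ j)%N by rewrite expn_gt0 p0.
have e : (\sum_(i < f) a i * p ^ i = (\sum_(i < j) a i * p ^ i) +
   (a j + p * \sum_(j.+1 <= i < f) a i * p ^ (i - j.+1)) * p ^ j)%N.
  rewrite -(big_mkord xpredT (fun i => a i * p ^ i)%N) (big_cat_nat (n := j)) ?(ltnW ltj) //=.
  rewrite big_mkord; congr addn; rewrite big_ltn // mulnDl; congr addn.
  rewrite mulnAC -expnS big_distrr /=.
  by apply: eq_big_nat => i /andP[ge _]; rewrite mulnCA -expnD subnKC.
rewrite e divnDMl // divn_small ?add0n; last first.
  by apply: digits_ltn => i lti; apply: h; apply: ltn_trans ltj.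
by rewrite mulnC addnC modnMDl modn_small // h.
Qed.

Variables (f : nat).

Definition num (a : 'I_f -> nat) := (\sum_i a i * p ^ i)%N.

Let ext (a : 'I_f -> nat) (n : nat) := oapp a 0%N (insub n).

Let extE a (i : 'I_f) : ext a i = a i.
Proof. by rewrite /ext valK. Qed.

Let ext_lt a : (forall i, a i < p)%N -> forall i, (i < f)%N -> (ext a i < p)%N.
Proof. by move=> h i lti; rewrite /ext insubT; apply: h. Qed.

Let num_ext a : num a = (\sum_(i < f) ext a i * p ^ i)%N.
Proof. by apply: eq_bigr => i _; rewrite extE. Qed.

Lemma num_lt a : (forall i, a i < p)%N -> (num a < p ^ f)%N.
Proof. by move=> h; rewrite num_ext digits_ltn //; apply: ext_lt. Qed.

Lemma numE a (j : 'I_f) : (forall i, a i < p)%N -> (num a %/ p ^ j %% p)%N = a j.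
Proof. by move=> h; rewrite num_ext digitsE // ?extE //; apply: ext_lt. Qed.

Lemma num_inj a b : (forall i, a i < p)%N -> (forall i, b i < p)%N -> num a = num b -> a =1 b.
Proof. by move=> ha hb e i; rewrite -(numE i ha) e numE. Qed.

Lemma num_eq0 a : (num a == 0%N) = [forall i, a i == 0%N].
Proof.
rewrite sum_nat_eq0; apply: eq_forallb => i /=.
by rewrite muln_eq0 expn_eq0 orbC; case: p p_gt1.
Qed.

Lemma num_top : (num (fun _ => p.-1) = (p ^ f).-1)%N.
Proof. by rewrite /num predn_exp big_distrr. Qed.

Lemma num_eq_top a : (forall i, a i < p)%N -> num a = (p ^ f).-1 -> forall i, a i = p.-1.
Proof.
move=> h e i; apply: (@num_inj a (fun _ => p.-1)) => //; last by rewrite num_top.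
by move=> j; rewrite prednK // ltnW.
Qed.

End Digits.

(** * Extraction of coefficients and power sums over k *)

Section PowerSums.

Variables (p f : nat) (k : finFieldType) (E : fieldType) (iota : {rmorphism k -> E}).
Hypotheses (p_pr : prime p) (card_k : #|k| = (p ^ f)%N).
Local Notation fr := (fr p iota).
Local Notation q := (p ^ f)%N.

Lemma prod_fr x (m : 'I_f -> nat) : \prod_i fr x i ^+ m i = iota x ^+ num p m.
Proof. by rewrite /num -prodrXr; apply: eq_bigr => i _; rewrite /fr mulnC exprM. Qed.

(* The exponents num p phi of u are distinct and less than #|k|. *)
Lemma extract m n (Z : 'M[E]_(m, n)) (w : {ffun 'I_f -> 'I_p} -> 'rV[E]_n) :
  (forall u : k, ((\sum_(phi : {ffun 'I_f -> 'I_p}) (\prod_i fr u i ^+ phi i) *: w phi)%R <= Z)%MS) ->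
  forall phi, (w phi <= Z)%MS.
Proof.
move=> h phi; rewrite submxE; apply/eqP/rowP=> c; rewrite [RHS]mxE.
have p1 := prime_gt1 p_pr.
(* One coordinate of the sum modulo [Z], as a polynomial in u: its degree is less than q and it
   vanishes on all of k. *)
pose Q : {poly E} := \sum_(phi : {ffun 'I_f -> 'I_p}) (w phi *m cokermx Z) 0 c *: 'X^(num p (fun i => phi i : nat)).
have lt_num (ps : {ffun 'I_f -> 'I_p}) : (num p (fun i => ps i : nat) < q)%N by apply: num_lt.
have szQ : (size Q <= q)%N.
  apply: (leq_trans (size_sum _ _ _)); apply/bigmax_leqP => i _.
  by apply: leq_trans (size_scale_leq _ _) _; rewrite size_polyXn.
have rQ u : root Q (iota u).
  rewrite /root /Q horner_sum; have := h u; rewrite submxE mulmx_suml => /eqP/rowP/(_ c).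
  rewrite summxE mxE => e; rewrite -[X in _ == X]e; apply/eqP/eq_bigr => ps _.
  by rewrite hornerZ hornerXn -scalemxAl [in RHS]mxE prod_fr mulrC.
have Q0 : Q = 0.
  apply: (roots_geq_poly_eq0 (rs := [seq iota u | u <- enum k])).
  - by apply/allP=> _ /mapP[u _ ->].
  - by rewrite map_inj_uniq ?enum_uniq //; apply: fmorph_inj.
  - by rewrite size_map -cardE card_k.
have := congr1 (fun P : {poly E} => P`_(num p (fun i => phi i : nat))) Q0.
rewrite coef0 coef_sum (bigD1 phi) //= coefZ coefXn eqxx mulr1 big1 ?addr0 // => ps ne.
rewrite coefZ coefXn; case: eqP => [e|_]; last by rewrite mulr0.
case/eqP: ne; apply/ffunP=> i; apply: val_inj.
by apply/esym; apply: (num_inj p1 _ _ e).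
Qed.

Lemma pow_card_pred (x : k) : x != 0 -> x ^+ q.-1 = 1.
Proof.
move=> x0; apply: (mulfI x0); rewrite -exprS prednK ?mulr1; last first.
  by rewrite -card_k; apply/card_gt0P; exists x.
by rewrite -card_k expf_card.
Qed.

Lemma sum_pow n : \sum_(x : k) x ^+ n = if (0 < n)%N && (q.-1 %| n)%N then -1 else 0.
Proof.
have q1 : (1 < q)%N by rewrite -card_k card_finNzRing_gt1.
have [->|n0] := posnP n.
  under eq_bigr do rewrite expr0; rewrite sumr_const card_k.
  have := card_finPcharP card_k p_pr => chk; rewrite natrX.
  have f0 : f != 0%N by apply: contraTneq q1 => ->.
  by rewrite pcharf0 // expr0n (negPf f0).
rewrite /=; case: ifP => [/dvdnP[c ec]|nd].
  rewrite (bigD1 0) //= expr0n eqn0Ngt n0 /= add0r.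
  rewrite (eq_bigr (fun _ => 1)); last first.
    by move=> x x0; rewrite ec mulnC exprM pow_card_pred ?expr1n.
  rewrite sumr_const cardC1 card_k; apply/eqP; rewrite -addr_eq0 -[X in _ + X]/(1%:R) -natrD addn1 prednK ?(ltnW q1) //.
  have chk := card_finPcharP card_k p_pr.
  have f0 : f != 0%N by apply: contraTneq q1 => ->.
  by rewrite natrX pcharf0 // expr0n (negPf f0).
(* Otherwise X^(n mod (q - 1)) - 1 would have q - 1 roots. The substitution of g x for x then shows
   that the sum is 0. *)
have [g g0 gn] : exists2 g : k, g != 0 & g ^+ n != 1.
  apply/exists_inP; apply: contraFT nd; rewrite negb_exists_in => /forall_inP hall.
  have q10 : (0 < q.-1)%N by rewrite -ltnS prednK // ltnW.
  apply: contraT; rewrite /dvdn -lt0n => n'0; set n' := (n %% q.-1)%N in n'0.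
  have hn' (x : k) : x != 0 -> x ^+ n' = 1.
    move=> x0; have /negPn/eqP <- := hall x x0.
    by rewrite [in RHS](divn_eq n q.-1) exprD mulnC exprM pow_card_pred // expr1n mul1r.
  have P0 : 'X^n' - 1%:P != 0 :> {poly k}.
    by rewrite -size_poly_eq0 size_XnsubC.
  have hr : all (root ('X^n' - 1%:P)) (enum (predC1 (0 : k))).
    by apply/allP=> x; rewrite mem_enum !inE => x0; rewrite /root !hornerE hn' ?subrr.
  have := max_poly_roots P0 hr (enum_uniq _).
  by rewrite size_XnsubC // -cardE cardC1 card_k ltnS leqNgt ltn_mod q10.
have e : \sum_(x : k) x ^+ n = g ^+ n * \sum_(x : k) x ^+ n.
  rewrite {1}(reindex_inj (mulfI g0)) /= mulr_sumr; apply: eq_bigr => x _; exact: exprMn.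
have : (g ^+ n - 1) * \sum_(x : k) x ^+ n = 0 by rewrite mulrBl mul1r -e subrr.
by move/eqP; rewrite mulf_eq0 subr_eq0 (negPf gn) => /eqP.
Qed.

End PowerSums.

Lemma sub_ge_top (a b Q : nat) : (a <= Q)%N -> (b < a)%N -> (Q <= a - b)%N -> b = 0%N /\ a = Q.
Proof. by lia. Qed.

(** * Exponents modulo q - 1, read cyclically *)

Section Rotation.

Variables (p f : nat) (j : 'I_f).
Hypothesis p_gt1 : (1 < p)%N.

(** Reading starts at j + 1, which makes j the most significant digit. *)
Definition rotidx n : 'I_f := iter n (@ordS f) (ordS j).

Lemma val_rotidx n : rotidx n = ((j + n.+1) %% f)%N :> nat.
Proof.
elim: n => [|n IHn]; first by rewrite /= addn1.
by rewrite /rotidx iterS /= -/(rotidx n) IHn -addn1 modnDml !addnS addn0.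
Qed.

Lemma rotidx_pred n : ord_pred (rotidx n.+1) = rotidx n.
Proof. by rewrite /rotidx iterS ordSK. Qed.

Lemma rotidx_last : ord_pred (rotidx f) = j.
Proof.
rewrite -[RHS]ordSK; congr ord_pred; apply: val_inj.
by rewrite /= val_rotidx addnS -addSn modnDr.
Qed.

Lemma rotidx_inj : injective (fun n : 'I_f => rotidx n).
Proof.
move=> a b e; have := congr1 val e; rewrite /= !val_rotidx => /eqP.
rewrite !addnS -!addSn eqn_modDl !modn_small // => /eqP; exact: val_inj.
Qed.

Definition rotnum (a : 'I_f -> nat) := (\sum_(n < f) a (rotidx n) * p ^ n)%N.

Lemma pow_rotidx n : p ^ rotidx n = p ^ j.+1 * p ^ n %[mod (p ^ f).-1].
Proof.
have q1 : p ^ f = 1 %[mod (p ^ f).-1].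
  have q0 : (0 < p ^ f)%N by rewrite expn_gt0 ltnW.
  by rewrite -{1}(prednK q0) -addn1 modnDl.
have qc c : (p ^ f) ^ c = 1 %[mod (p ^ f).-1].
  by rewrite -modnXm q1 modnXm exp1n.
rewrite val_rotidx -expnD addSnnS [in RHS](divn_eq (j + n.+1) f) [in RHS]expnD.
by rewrite [(_ %/ f * f)%N]mulnC expnM -modnMml qc modnMml mul1n.
Qed.

Lemma num_rotnum a : num p a = p ^ j.+1 * rotnum a %[mod (p ^ f).-1].
Proof.
rewrite /num (reindex_inj rotidx_inj) /rotnum big_distrr /= -modn_summ -[RHS]modn_summ.
congr (_ %% _)%N; apply: eq_bigr => n _.
by rewrite mulnCA -modnMmr pow_rotidx modnMmr.
Qed.

Lemma rotidx_surj i : exists n : 'I_f, rotidx n = i.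
Proof. by have [g _ gK] := injF_bij rotidx_inj; exists (g i). Qed.

Lemma rotnum_inj a b : (forall i, a i < p)%N -> (forall i, b i < p)%N ->
  rotnum a = rotnum b -> a =1 b.
Proof.
move=> ha hb e i; have [n <-] := rotidx_surj i.
exact: (num_inj p_gt1 (a := fun n : 'I_f => a (rotidx n)) (b := fun n : 'I_f => b (rotidx n))).
Qed.

Lemma rotnum_lt a : (forall i, a i < p)%N -> (rotnum a < p ^ f)%N.
Proof. by move=> ha; exact: (num_lt (a := fun n : 'I_f => a (rotidx n)) (fun i => ha _)). Qed.

Lemma rotnum_top : (rotnum (fun _ => p.-1) = (p ^ f).-1)%N.
Proof. exact: num_top. Qed.

Lemma rotnum_le a b : (forall i, a i <= b i)%N -> (rotnum a <= rotnum b)%N.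
Proof. by move=> h; apply: leq_sum => i _; rewrite leq_mul2r h orbT. Qed.

Lemma rotnum_eq0 a : rotnum a = 0%N -> forall i, a i = 0%N.
Proof.
move=> /eqP; have -> := num_eq0 p_gt1 (fun n : 'I_f => a (rotidx n)).
by move=> /forallP h i; have [n <-] := rotidx_surj i; apply/eqP/h.
Qed.

Lemma coprime_pq : coprime (p ^ f).-1 (p ^ j.+1).
Proof.
rewrite coprime_pexpr //.
have f0 : (0 < f)%N := leq_ltn_trans (leq0n j) (ltn_ord j).
by rewrite -(coprime_pexpr _ _ f0) coprime_sym coprimenP // expn_gt0 ltnW.
Qed.

Lemma num_rot_eqmod a b : (num p a == num p b %[mod (p ^ f).-1])%N ->
  (rotnum b <= rotnum a)%N -> ((p ^ f).-1 %| rotnum a - rotnum b)%N.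
Proof.
rewrite !num_rotnum => e le.
rewrite -(Gauss_dvdr _ coprime_pq) mulnBr -eqn_mod_dvd ?leq_mul2l ?le ?orbT //.
Qed.

Variables (rd : 'I_f -> nat).
Hypothesis rd_gen : forall i, (3 <= rd i <= p - 3)%N.
Local Notation TT := ({set 'I_f} * {set 'I_f})%type.
Implicit Type t : TT.

(** The p at an index of J is a carry that cancels the -1 at the next one; in [h] the last term is
    the carry pending after n digits. None leaves the top digit, as j is not in J. *)
Lemma rotnum_nd t : j \notin t.1 -> rotnum (nd p rd t) = rotnum (ad rd t).
Proof.
move=> nj.
have h n : (\sum_(h < n) nd p rd t (rotidx h) * p ^ h =
  \sum_(h < n) ad rd t (rotidx h) * p ^ h + p ^ n * (ord_pred (rotidx n) \in t.1))%N.
  elim: n => [|n IHn]; first by rewrite !big_ord0 /rotidx /= ordSK (negPf nj).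
  rewrite !big_ord_recr /= IHn rotidx_pred expnS.
  have : (ad rd t (rotidx n) >= 1)%N.
    by have := rd_gen (rotidx n); rewrite /ad; case: (_ \in _); lia.
  rewrite /nd; move: (ad _ _ _) (_ \in t.1) (_ \in t.1) (p ^ n)%N (\sum_(_ < _) _)%N.
  move=> a b c P S a1; rewrite addnAC -!addnA; congr (S + _)%N.
  by rewrite addnC; case: b; case: c; rewrite /= ?muln0 ?muln1 ?addn0 ?subn0;
    rewrite ?mulnDl ?mulnBl; nia.
by rewrite /rotnum h rotidx_last (negPf nj) muln0 addn0.
Qed.

(** The last term of [h] is a debt of p^n, made at an index outside J, where nothing is known of m,
    and repaid at the next index if it is in J, where [sd] is [ad + 1]. No debt is left at the end,
    as j is in J. *)
Lemma rotnum_lower t m : j \in t.1 -> (forall i, i \in t.1 -> sd rd t i <= m i)%N ->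
  (rotnum (ad rd t) <= rotnum m)%N.
Proof.
move=> jJ hm.
have h n : (\sum_(h < n) ad rd t (rotidx h) * p ^ h <=
  \sum_(h < n) m (rotidx h) * p ^ h + p ^ n * (ord_pred (rotidx n) \notin t.1))%N.
  elim: n => [|n IHn]; first by rewrite !big_ord0.
  rewrite !big_ord_recr /= rotidx_pred.
  have [iJ|niJ] := boolP (rotidx n \in t.1); last first.
    rewrite muln1 (leq_trans _ (leq_addl _ _)) // expnS.
    have hS : (\sum_(h < n) ad rd t (rotidx h) * p ^ h < p ^ n)%N.
      by apply: (digits_ltn (a := fun h => ad rd t (rotidx h))) => h _; apply: ad_lt rd_gen _ _.
    have hA : (ad rd t (rotidx n) < p)%N := ad_lt rd_gen t _.
    by apply: leq_trans (leq_add (ltnW hS) (leqnn _)) _; rewrite -mulSn leq_mul2r hA orbT.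
  have := hm _ iJ; rewrite /sd iJ /= muln0 addn0 => hs.
  apply: leq_trans (leq_add IHn (leqnn _)) _; rewrite -addnA leq_add2l.
  rewrite mulnC -mulnDl leq_mul2r; apply/orP; right.
  by move: hs; case: (_ \in t.1) => /=; lia.
have := h f; rewrite rotidx_last jJ muln0 addn0; exact.
Qed.

(* The monomials of W_(J',I) have, up to q - 1, other d-exponents than the top
   monomials of W_(J,I), unless J is contained in J'. Read cyclically from an
   index j in J \ J', the exponent is at most that of ad for J', at least that
   of ad for J. *)
Lemma separate t t' m m' : t.2 = t'.2 -> j \in t.1 -> j \notin t'.1 ->
  (forall i, m i < p)%N -> (forall i, i \in t.1 -> sd rd t i <= m i)%N ->
  ~ (m =1 ad rd t) -> (forall i, m' i <= nd p rd t' i)%N ->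
  ~~ ((0 < (p ^ f).-1 - num p m + num p m')%N && ((p ^ f).-1 %| (p ^ f).-1 - num p m + num p m')%N).
Proof.
move=> eI jJ nj mp hm nem hm'; apply/negP=> /andP[pos dv].
have p0 : (0 < p)%N by apply: ltnW.
have lem : (num p m <= (p ^ f).-1)%N.
  by rewrite -ltnS prednK ?expn_gt0 ?p0 // num_lt.
have e1 : (num p m' == num p m %[mod (p ^ f).-1])%N.
  rewrite -(eqn_modDl ((p ^ f).-1 - num p m)) subnK // modnn.
  by move: dv; rewrite /dvdn.
have eA : ad rd t' =1 ad rd t by move=> i; rewrite /ad eI.
have l1 : (rotnum m' <= rotnum (ad rd t))%N.
  apply: leq_trans (rotnum_le hm') _; rewrite rotnum_nd //.
  by apply: rotnum_le => i; rewrite eA.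
have adp i : (ad rd t i < p)%N := ad_lt rd_gen t i.
have l2 : (rotnum (ad rd t) < rotnum m)%N.
  rewrite ltn_neqAle rotnum_lower // andbT; apply/negP=> /eqP e.
  by apply: nem => i; rewrite (rotnum_inj adp mp e).
have l3 := leq_ltn_trans l1 l2.
have := num_rot_eqmod (a := m) (b := m'); rewrite eq_sym e1 => /(_ isT (ltnW l3)) dv2.
have le2 : (rotnum m <= (p ^ f).-1)%N by rewrite -ltnS prednK ?expn_gt0 ?p0 // rotnum_lt.
have le3 : ((p ^ f).-1 <= rotnum m - rotnum m')%N by apply: dvdn_leq dv2; rewrite subn_gt0.
(* Two different numbers in [0, q - 1] that are congruent modulo q - 1 are q - 1 and 0; but for
   these the exponent in question is 0, against [pos]. *)
have [z tp'] := sub_ge_top le2 l3 le3.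
have tp : rotnum m = rotnum (fun _ => p.-1) by rewrite rotnum_top.
have mt : m =1 fun _ => p.-1 by apply: rotnum_inj tp => // i; rewrite prednK.
have e2 : num p m = (p ^ f).-1 by rewrite -num_top //; apply: eq_bigr => i _; rewrite mt.
have e3 : num p m' = 0%N by rewrite /num big1 // => i _; rewrite (rotnum_eq0 z).
by move: pos; rewrite e2 e3 subnn.
Qed.

End Rotation.

(** * The submodules spanned by monomials *)

Section Modules.

Variables (p f : nat) (k : finFieldType) (E : fieldType) (iota : {rmorphism k -> E}).
Variables (A : finComUnitRingType).
Variables (red : {rmorphism A -> k}) (tau : k -> A) (pi : A) (ub : k).
Hypotheses (p_pr : prime p) (card_k : #|k| = (p ^ f)%N) (chk : p \in [pchar k]).
Hypotheses (tauK : cancel tau red) (tauM : {morph tau : x y / x * y}).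
Hypotheses (pi2 : pi * pi = 0) (redpi : red pi = 0).
Hypothesis kerred : forall a, red a = 0 -> exists b, a = pi * b.
Hypothesis annpi : forall a, pi * a = 0 -> red a = 0.
Hypothesis p_pi : p%:R = pi * tau ub.
Variable (rd : 'I_f -> nat).
Hypothesis rd_gen : forall i, (3 <= rd i <= p - 3)%N.

Local Notation TT := ({set 'I_f} * {set 'I_f})%type.
Local Notation fn := (A * A -> E).
Local Notation fr := (fr p iota).
Local Notation DD := (DD p iota red tau pi).
Local Notation mon0 := (mon0 p iota red).
Local Notation mhom := (mhom p iota red).
Local Notation RR := (RR p iota red tau pi).
Local Notation nd := (nd p rd).
Local Notation V := (regular_repr E 'GL_2[A]).
Local Notation N0 := (gcard 'GL_2[A]).
Local Notation cx := (cx p iota red).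
Local Notation dx := (dx p iota red).
Local Notation ad := (ad rd).
Local Notation sd := (sd rd).
Local Notation td := (td p rd).
Local Notation sdn := (sdown (ThetaS f) (@tle f)).
Implicit Types (F : fn) (I J D : {set 'I_f}) (t : TT).

Definition rowF F : 'rV[E]_N0 :=
  fun_row 'GL_2[A] (fun h => F ((GLval h) 1 0, (GLval h) 1 1)).

Lemma rowF_ext F F' : F =1 F' -> rowF F = rowF F'.
Proof. by move=> e; apply/rowP=> i; rewrite !mxE e. Qed.

Lemma rowF0 : rowF (fun _ => 0) = 0.
Proof. by apply/rowP=> i; rewrite !mxE. Qed.

Lemma rowFD F F' : rowF (fun v => F v + F' v) = rowF F + rowF F'.
Proof. by apply/rowP=> i; rewrite !mxE. Qed.

Lemma rowFZ a F : rowF (fun v => a * F v) = a *: rowF F.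
Proof. by apply/rowP=> i; rewrite !mxE. Qed.

Lemma rowF_sum (I : Type) (s : seq I) (P : pred I) (F : I -> fn) :
  rowF (fun v => \sum_(i <- s | P i) F i v) = \sum_(i <- s | P i) rowF (F i).
Proof. by apply/rowP=> i; rewrite !mxE summxE; apply: eq_bigr => j _; rewrite !mxE. Qed.

Lemma rowF_act F x : rowF F *m V x^-1%g = rowF (fun v => F (vact v (GLval x))).
Proof.
rewrite /rowF fun_row_translate ?inE // invgK; apply/rowP=> i; rewrite mxE [RHS]mxE.
by rewrite GL_MxE !mulmx22.
Qed.

Definition Dp I (v : A * A) : E := \prod_(i in I) DD v i.
Definition mon (e m : 'I_f -> nat) I (v : A * A) : E := mon0 e m v * Dp I v.

(** The bound [2 * p] only makes the index type finite; it is not a restriction, by [nd_lt]. *)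
Definition WW t : 'M[E]_N0 :=
  (\sum_(x : {ffun 'I_f -> 'I_(2 * p)} | [forall i, x i <= nd t i]%N)
     <<rowF (mon (fun i => nd t i - x i)%N (fun i => x i : nat) t.2)>>)%MS.
Definition NN (S : {set TT}) : 'M[E]_N0 := (\sum_(t in S) WW t)%MS.

Lemma mon0_ext (e m e' m' : 'I_f -> nat) : e =1 e' -> m =1 m' -> mon0 e m =1 mon0 e' m'.
Proof. by move=> ee em v; apply: eq_bigr => i _; rewrite ee em. Qed.

Lemma mon_ext e m e' m' I : e =1 e' -> m =1 m' -> rowF (mon e m I) = rowF (mon e' m' I).
Proof. by move=> ee em; apply: rowF_ext => v; rewrite /mon (mon0_ext ee em). Qed.

Lemma mon_WW t e m : (forall i, e i + m i = nd t i)%N -> (rowF (mon e m t.2) <= WW t)%MS.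
Proof.
move=> em; have lt i : (m i < 2 * p)%N by have := nd_lt rd_gen t i; rewrite -em; lia.
pose x := [ffun i => Ordinal (lt i)].
have Px : [forall i, x i <= nd t i]%N by apply/forallP=> i; rewrite ffunE /= -em leq_addl.
apply: submx_trans (sumsmx_sup x Px (submx_refl _)); rewrite genmxE.
by rewrite (@mon_ext e m (fun i => nd t i - x i)%N (fun i => x i : nat)) // => i;
  rewrite ffunE //= -em addnK.
Qed.

Lemma hom_WW t F : mhom (nd t) F -> (rowF (fun v => (F v * Dp t.2 v)%R) <= WW t)%MS.
Proof.
case=> hF; apply: (hF (fun F => rowF (fun v => (F v * Dp t.2 v)%R) <= WW t)%MS); last exact: mon_WW.
split=> [|F1 F2 h1 h2|a F1 h1|F1 F2 e h1].
- by rewrite (@rowF_ext _ (fun _ => 0)) ?rowF0 ?sub0mx // => v; rewrite mul0r.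
- rewrite (@rowF_ext _ (fun v => F1 v * Dp t.2 v + F2 v * Dp t.2 v)).
    by rewrite rowFD addmx_sub.
  by move=> v; rewrite mulrDl.
- rewrite (@rowF_ext _ (fun v => a * (F1 v * Dp t.2 v))) ?rowFZ ?scalemx_sub //.
  by move=> v; rewrite mulrA.
- by rewrite (@rowF_ext _ (fun v => F1 v * Dp t.2 v)) // => v; rewrite e.
Qed.

Lemma WW_le t (X : 'M[E]_N0) :
  (forall m, (forall i, m i <= nd t i)%N -> (rowF (mon (fun i => nd t i - m i)%N m t.2) <= X)%MS) ->
  (WW t <= X)%MS.
Proof.
by move=> h; apply/sumsmx_subP => x /forallP Px; rewrite genmxE; apply: h.
Qed.

Lemma WW_NN t (S : {set TT}) : t \in S -> (WW t <= NN S)%MS.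
Proof. by move=> tS; apply: (sumsmx_sup t). Qed.

Lemma NN_le (S : {set TT}) (X : 'M[E]_N0) : (forall t, t \in S -> (WW t <= X)%MS) -> (NN S <= X)%MS.
Proof. by move=> h; apply/sumsmx_subP. Qed.

Lemma NN_mono (S S' : {set TT}) : S \subset S' -> (NN S <= NN S')%MS.
Proof. by move=> sS; apply: NN_le => t tS; apply/WW_NN/(subsetP sS). Qed.

Lemma NN_set0 : NN set0 = 0.
Proof. by rewrite /NN big_set0. Qed.

(* Expanding each D_i(v g) = det(g)_i D_i(v) + RR g i v, with D the set of
   indices where the second term is chosen. *)
Definition Tm F I g D (v : A * A) : E := F (vact v g) *
  \prod_i (if i \in D then (if i \in I then RR g i v else 0)
           else (if i \in I then fr (red (\det g)) i * DD v i else 1)).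

Lemma act_expand F I g v : F (vact v g) * Dp I (vact v g) = \sum_D Tm F I g D v.
Proof.
rewrite -mulr_sumr -bigA_distr; congr (_ * _).
rewrite /Dp big_mkcond /=; apply: eq_bigr => i _; case: ifP => _; last by rewrite add0r.
by rewrite DD_act addrC.
Qed.

Lemma Tm0 F I g D : ~~ (D \subset I) -> Tm F I g D =1 (fun _ => 0).
Proof.
case/subsetPn=> i iD niI v; rewrite /Tm (bigD1 i) //= iD (negPf niI) !(mul0r, mulr0).
by [].
Qed.

Lemma TmE F I g D v : D \subset I -> Tm F I g D v =
  (\prod_(i in I :\: D) fr (red (\det g)) i) *
  ((F (vact v g) * \prod_(i in D) RR g i v) * Dp (I :\: D) v).
Proof.
move=> sD; rewrite /Tm /Dp -[(F _ * _) * _]mulrA [RHS]mulrCA; congr (_ * _).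
rewrite [X in X * _]big_mkcond [X in _ * (X * _)]big_mkcond [X in _ * (_ * X)]big_mkcond /=.
rewrite -!big_split /=; apply: eq_bigr => i _; rewrite inE; case: (boolP (i \in D)) => [iD|_] /=.
  by rewrite (subsetP sD _ iD) mulr1 mul1r.
by case: (i \in I); rewrite ?mul1r.
Qed.

Lemma Tm_WW t F g D : t \in ThetaS f -> D \subset t.2 -> mhom (nd t) F ->
  (rowF (Tm F t.2 g D) <= WW (tD t D))%MS.
Proof.
move=> tT sD hF; rewrite (rowF_ext (fun v => TmE F g v sD)) rowFZ scalemx_sub //.
apply: (hom_WW (t := tD t D)).
have hR : mhom (fun j => \sum_(i in D) (eps i j + p * eps (ord_pred i) j))%N
   (fun v => \prod_(i in D) RR g i v).
  by apply: hom_prod => i _; apply: (hom_RR iota p_pr card_k chk tauK tauM pi2 redpi kerred annpi p_pi).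
apply: hom_ext (homM (hom_act p_pr chk g hF) hR) => // j.
rewrite (nd_tD rd_gen) // -addnA big_split /=; congr (_ + (_ + _))%N.
  rewrite big_mkcond (bigD1 j) //= /eps eqxx big1 ?addn0; first by case: (j \in D).
  by move=> i /negPf ij; rewrite eq_sym ij if_same.
rewrite -big_distrr /=; congr (p * _)%N.
rewrite big_mkcond (bigD1 (ordS j)) //= /eps ordSK eqxx big1 ?addn0; first by case: (_ \in D).
move=> i ij; rewrite eq_sym (can2_eq (@ord_predK f) (@ordSK f)) (negPf ij) if_same //.
Qed.

Lemma stable_NN S t F g : dclosed (ThetaS f) (@tle f) S -> t \in S -> mhom (nd t) F ->
  (rowF (fun v => (F (vact v g) * Dp t.2 (vact v g))%R) <= NN S)%MS.
Proof.
move=> [sS clS] tS hF; have tT := subsetP sS _ tS.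
rewrite (rowF_ext (act_expand F t.2 g)) rowF_sum summx_sub // => D _.
have [sD|nD] := boolP (D \subset t.2); last first.
  by rewrite (rowF_ext (Tm0 F g nD)) rowF0 sub0mx.
apply: submx_trans (Tm_WW g tT sD hF) (WW_NN _); apply: clS tS _ _.
  exact: tD_Theta.
exact: tD_le.
Qed.

Lemma NN_module S : dclosed (ThetaS f) (@tle f) S -> mxmodule V (NN S).
Proof.
move=> dS; apply/mxmoduleP=> x _; rewrite sumsmxMr; apply/sumsmx_subP=> t tS.
rewrite /WW sumsmxMr; apply/sumsmx_subP=> m /forallP mP.
rewrite (eqmxMr _ (genmxE _)) -[x]invgK rowF_act; apply: (stable_NN _ dS tS).
by apply: hom_mon0 => i; rewrite subnK.
Qed.

Local Notation q := (p ^ f)%N.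

Lemma p_ge6 : (6 <= p)%N.
Proof.
have f0 := f_gt0 card_k.
by have := rd_gen (Ordinal f0); lia.
Qed.

Lemma ppow_num I : ppow p I = num p (fun i => i \in I : nat).
Proof.
rewrite /ppow /num big_mkcond; apply: eq_bigr => i _.
by case: (i \in I); rewrite ?mul1n ?mul0n.
Qed.

Lemma ind_lt I i : ((i \in I : nat) < p)%N.
Proof. by have := p_ge6; case: (i \in I); lia. Qed.

Lemma ppow_lt I : (ppow p I < q.-1)%N.
Proof.
have p6 := p_ge6; have f0 := f_gt0 card_k; have p1 : (1 < p)%N by apply: leq_trans p6.
have h : (ppow p I <= q.-1)%N.
  by rewrite -ltnS prednK ?expn_gt0 ?(ltnW p1) // ppow_num num_lt //; apply: ind_lt.
rewrite ltn_neqAle h andbT ppow_num; apply/negP=> /eqP e.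
have := num_eq_top p1 (@ind_lt I) e (Ordinal f0).
by case: (_ \in I); have := p6; lia.
Qed.

Definition row1_mx (x : A) : 'M[A]_2 :=
  \matrix_(i, j) if i == 0 then (j == 1)%:R else if j == 0 then 1 else x.

Lemma hx_subproof (x : A) : row1_mx x \is a GRing.unit.
Proof.
rewrite -[_ \is a _]/(_ \in unitmx) unitmxE det22 !mxE /= mul0r sub0r mul1r.
by rewrite unitrN unitr1.
Qed.

Definition hx x : {'GL_2[A]} := FinRing.Unit (hx_subproof x).

(* Extracts the coefficient of x_0^M x_1^(p^I) in F(1, [x_0] + [x_1] pi). *)
Definition Lcol (M : nat) I : 'cV[E]_N0 :=
  \sum_(x : k * k) iota (x.1 ^+ (q.-1 - M) * x.2 ^+ (q.-1 - ppow p I)) *: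
    delta_mx (gring_index 'GL_2[A] (hx (tau x.1 + pi * tau x.2))) 0.

Lemma rowF_Lcol F M I : (rowF F *m Lcol M I) 0 0 =
  \sum_(x : k * k) iota (x.1 ^+ (q.-1 - M) * x.2 ^+ (q.-1 - ppow p I)) *
     F (1, tau x.1 + pi * tau x.2).
Proof.
rewrite mulmx_sumr summxE; apply: eq_bigr => x _.
rewrite -scalemxAr mxE -colE !mxE; congr (_ * _).
by rewrite gring_indexK ?inE //= !mxE.
Qed.

Lemma mon_chart e m I (x : k * k) : mon e m I (1, tau x.1 + pi * tau x.2) =
  iota (x.1 ^+ num p m * x.2 ^+ ppow p I).
Proof.
rewrite /mon rmorphM; congr (_ * _).
  rewrite rmorphXn -prod_fr /mon0; apply: eq_bigr => i _.
  by rewrite /cx /dx /= rmorph1 fr1 expr1n mul1r (red_tp tauK redpi).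
rewrite /Dp /ppow rmorphXn -prodrXr; apply: eq_bigr => i _.
rewrite /DD /detv /= rmorph1 mul1r (co_tp tauK pi2 redpi kerred annpi) (red_tp tauK redpi).
have -> : co red tau pi 1 = 0.
  by rewrite -[1](tau1 tauK tauM pi2 kerred) (co_tau tauK pi2 redpi kerred annpi).
by rewrite mulr0 subr0 tauK.
Qed.

Lemma Lcol_mon e m I M I' : (rowF (mon e m I) *m Lcol M I') 0 0 =
  iota (\sum_(x : k) x ^+ (q.-1 - M + num p m)) * iota (\sum_(x : k) x ^+ (q.-1 - ppow p I' + ppow p I)).
Proof.
rewrite rowF_Lcol -rmorphM big_distrlr /= pair_big rmorph_sum; apply: eq_bigr => x _.
by rewrite mon_chart -rmorphM /= mulrACA -!exprD.
Qed.

Lemma Lcol_neq0 e m I : (num p m <= q.-1)%N -> (rowF (mon e m I) *m Lcol (num p m) I) 0 0 = 1.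
Proof.
move=> le; have q1 : (1 < q)%N by rewrite -card_k card_finNzRing_gt1.
have le2 := ltnW (ppow_lt I).
rewrite Lcol_mon !subnK // (sum_pow p_pr card_k) dvdnn andbT -ltnS prednK ?(ltnW q1) // q1.
by rewrite !rmorphN1 mulrNN mulr1.
Qed.

Lemma Lcol_eq0 e m I M : ~~ ((0 < q.-1 - M + num p m)%N && (q.-1 %| q.-1 - M + num p m)%N) ->
  (rowF (mon e m I) *m Lcol M I) 0 0 = 0.
Proof. by move=> h; rewrite Lcol_mon (sum_pow p_pr card_k) (negPf h) rmorph0 mul0r. Qed.

(** The numbers p^I are below q - 1 and have the indicator of I as digits, so they are distinct
    modulo q - 1. *)
Lemma Lcol_eq0_I e m I I' M : I != I' -> (rowF (mon e m I) *m Lcol M I') 0 0 = 0.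
Proof.
move=> neI; rewrite Lcol_mon [X in _ * iota X](sum_pow p_pr card_k); case: ifP => [/andP[_ dv]|]; last by rewrite rmorph0 mulr0.
have p6 := p_ge6; have p1 : (1 < p)%N by apply: leq_trans p6.
have l1 := ppow_lt I; have l2 := ppow_lt I'.
case/eqP: neI; have e1 : ppow p I = ppow p I'.
  have : (ppow p I == ppow p I' %[mod q.-1])%N.
    by rewrite -(eqn_modDl (q.-1 - ppow p I')) subnK ?modnn // ltnW.
  by rewrite !modn_small // => /eqP.
rewrite !ppow_num in e1; have e2 := num_inj p1 (@ind_lt I) (@ind_lt I') e1.
by apply/setP=> i; have := e2 i; case: (_ \in _); case: (_ \in _).
Qed.

Lemma tle_same t t' : t.2 = t'.2 -> ~~ tle t t' -> exists2 j, j \in t.1 & j \notin t'.1.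
Proof.
move=> eI; rewrite /tle eI subxx /= => /subsetPn[j jJ]; rewrite inE negb_or => /andP[nj _].
by exists j.
Qed.

(** The exclusion of [ad t] is asked for nonempty J only: if J is empty, every stratum with the same
    I is above t. *)
Lemma WW_Lcol0 t t' m : ~~ tle t t' -> (forall i, m i < p)%N ->
  (forall i, i \in t.1 -> sd t i <= m i)%N -> (forall j, j \in t.1 -> ~ (m =1 ad t)) -> WW t' *m Lcol (num p m) t.2 = 0.
Proof.
move=> nle mp hm nem; have p6 := p_ge6; have p1 : (1 < p)%N by apply: leq_trans p6.
apply/sub_kermxP; apply: WW_le => m' hm'; apply/sub_kermxP/matrixP=> a b; rewrite !ord1 [RHS]mxE.
have [eI|nI] := eqVneq t'.2 t.2; last exact: Lcol_eq0_I.
have [j jJ nj] := tle_same (esym eI) nle.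
rewrite eI; apply: Lcol_eq0; exact: (separate p1 rd_gen (esym eI) jJ nj mp hm (nem j jJ) hm').
Qed.

Lemma NN_Lcol0 (S : {set TT}) t m : (forall t', t' \in S -> ~~ tle t t') -> (forall i, m i < p)%N ->
  (forall i, i \in t.1 -> sd t i <= m i)%N -> (forall j, j \in t.1 -> ~ (m =1 ad t)) -> NN S *m Lcol (num p m) t.2 = 0.
Proof.
move=> nle mp hm nem; apply/sub_kermxP; apply: NN_le => t' t'S.
by apply/sub_kermxP; apply: WW_Lcol0 => //; apply: nle.
Qed.

(* Modulo the lower strata these are, up to the scalars cB, the monomials
   X^(td - l) Y^l of the tensor product of symmetric powers. *)
Definition fmon t (l : 'I_f -> nat) :=
  mon (fun i => nd t i - sd t i - l i)%N (fun i => sd t i + l i)%N t.2.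

Lemma fmon_WW t l : (forall i, l i <= td t i)%N -> (rowF (fmon t l) <= WW t)%MS.
Proof.
move=> hl; apply: mon_WW => // i; have := st_le rd_gen t i; have := hl i; lia.
Qed.

Lemma tJ_sdown t j : t \in ThetaS f -> j \in t.1 -> tJ t j \in sdn t.
Proof.
move=> tT jJ; rewrite in_setD1 in_set tJ_le tJ_Theta // !andbT.
apply/negP=> /eqP e; have := congr1 (fun x : TT => j \in x.1) e.
by rewrite /= !inE eqxx jJ.
Qed.

(* x_j^p = x_{j+1}: a monomial with an exponent at least p at some j in J is
   not a top monomial. *)
Lemma hom_carry t j F (X : 'I_f -> fn) : j \in t.1 -> (forall i v, X i v ^+ p = X (ordS i) v) ->
  (forall i, mhom (eps i) (X i)) ->
  mhom (fun i => nd t i - p * (i == j))%N F -> (p <= nd t j)%N ->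
  mhom (nd (tJ t j)) (fun v => F v * X j v ^+ p).
Proof.
move=> jJ hX hX' hF lep; apply: hom_ext (homM hF (hX' (ordS j))) => [i|v]; last by rewrite hX.
have := nd_tJ rd_gen i jJ; rewrite /eps.
case: (i =P j) => [->|_] /=; rewrite ?muln1 ?muln0 ?subn0; lia.
Qed.

Lemma cxX_mon0 v (j : 'I_f) c : cx v j ^+ c = mon0 (fun i => c * eps j i)%N (fun _ => 0%N) v.
Proof.
rewrite /mon0 (bigD1 j) //= big1 /eps ?eqxx ?muln1 ?expr0 ?mulr1 //.
by move=> i /negPf->; rewrite muln0 !expr0 mulr1.
Qed.

Lemma dxX_mon0 v (j : 'I_f) c : dx v j ^+ c = mon0 (fun _ => 0%N) (fun i => c * eps j i)%N v.
Proof.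
rewrite /mon0 (bigD1 j) //= big1 /eps ?eqxx ?muln1 ?expr0 ?mulr1 ?mul1r //.
by move=> i /negPf->; rewrite muln0 !expr0 mulr1.
Qed.

Lemma mon_carry_WW t e m j : j \in t.1 -> (forall i, e i + m i = nd t i)%N ->
  (p <= e j)%N || (p <= m j)%N -> (rowF (mon e m t.2) <= WW (tJ t j))%MS.
Proof.
move=> jJ em he.
have lep : (p <= nd t j)%N by rewrite -em; case/orP: he => h; lia.
have [hpe|hpm] := orP he.
  pose e1 i := (e i - p * (i == j))%N.
  have eE : mon e m t.2 =1 fun v => (mon0 e1 m v * cx v j ^+ p) * Dp t.2 v.
    move=> v; rewrite /mon cxX_mon0 mon0M; congr (_ * _); apply: mon0_ext => i; last by rewrite addn0.
    by rewrite /e1 /eps subnK //; case: (i =P j) => [->|_]; rewrite ?muln1 ?muln0.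
  rewrite (rowF_ext eE); apply: (hom_WW (t := tJ t j)).
  apply: (hom_carry (X := fun i v => cx v i)) lep => //.
  - by move=> i v; rewrite /cx (fr_ordS iota card_k).
  - exact: hom_cx.
  - apply: hom_mon0 => i; rewrite -em /e1; case: (i =P j) => [->|_] /=; rewrite ?muln1 ?muln0 ?subn0 //; lia.
pose m1 i := (m i - p * (i == j))%N.
have eE : mon e m t.2 =1 fun v => (mon0 e m1 v * dx v j ^+ p) * Dp t.2 v.
  move=> v; rewrite /mon dxX_mon0 mon0M; congr (_ * _); apply: mon0_ext => i; first by rewrite addn0.
  by rewrite /m1 /eps subnK //; case: (i =P j) => [->|_]; rewrite ?muln1 ?muln0.
rewrite (rowF_ext eE); apply: (hom_WW (t := tJ t j)).
apply: (hom_carry (X := fun i v => dx v i)) lep => //.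
- by move=> i v; rewrite /dx (fr_ordS iota card_k).
- exact: hom_dx.
- apply: hom_mon0 => i; rewrite -em /m1; case: (i =P j) => [->|_] /=; rewrite ?muln1 ?muln0 ?subn0 //; lia.
Qed.

Lemma mon_carry t e m j : t \in ThetaS f -> j \in t.1 -> (forall i, e i + m i = nd t i)%N ->
  (p <= e j)%N || (p <= m j)%N -> (rowF (mon e m t.2) <= NN (sdn t))%MS.
Proof.
move=> tT jJ em he; apply: submx_trans (mon_carry_WW jJ em he) _.
exact/WW_NN/tJ_sdown.
Qed.

(** On J one has nd = sd + (p - 1) and sd + td = p - 1. So e < p amounts to sd <= m, and m < p to m
    <= sd + td. *)
Lemma mon_top t e m : (forall i, e i + m i = nd t i)%N ->
  (forall j, j \in t.1 -> e j < p /\ m j < p)%N ->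
  exists2 l : {ffun 'I_f -> 'I_p}, (forall i, l i <= td t i)%N &
    rowF (mon e m t.2) = rowF (fmon t (fun i => l i)).
Proof.
move=> em h.
have hl i : (sd t i <= m i)%N /\ (m i - sd t i <= td t i)%N.
  have [iJ|niJ] := boolP (i \in t.1).
    by have [l1 l2] := h i iJ; have := em i; have [] := nd_in rd_gen iJ; lia.
  by have := em i; have [] := nd_out rd_gen niJ; lia.
have lt i : (m i - sd t i < p)%N.
  by have := st_lt rd_gen t i; have := hl i; lia.
exists [ffun i => Ordinal (lt i)] => [i|]; first by rewrite ffunE; case: (hl i).
apply: mon_ext => i; rewrite ffunE /=; have := em i; have := hl i; lia.
Qed.

Definition topS t : 'M[E]_N0 :=
  (\sum_(l : {ffun 'I_f -> 'I_p} | [forall i, l i <= td t i]%N) <<rowF (fmon t (fun i => l i))>>)%MS.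

Lemma WW_top t : t \in ThetaS f -> (WW t <= topS t + NN (sdn t))%MS.
Proof.
move=> tT; apply: WW_le => m hm.
have em i : (nd t i - m i + m i = nd t i)%N by rewrite subnK.
have [/existsP[j /andP[jJ hj]]|/existsPn nj] := boolP [exists j, (j \in t.1) && ((p <= nd t j - m j) || (p <= m j))%N].
  by apply: submx_trans (addsmxSr _ _); apply: (mon_carry tT jJ em).
have [j jJ|l hl ->] := mon_top em; first by have := nj j; rewrite jJ /= negb_or -!ltnNge => /andP.
apply: submx_trans (addsmxSl _ _); apply: (sumsmx_sup l); first exact/forallP.
by rewrite genmxE.
Qed.

End Modules.

(** * Tensor products of symmetric powers *)

Section TensorIndex.

Variable F : fieldType.

Lemma tix_subproof m n (i : 'I_m) (j : 'I_n) : (i * n + j < m * n)%N.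
Proof.
have h : (i.+1 * n <= m * n)%N by rewrite leq_mul2r ltn_ord orbT.
by apply: leq_trans h; rewrite mulSn addnC ltn_add2r.
Qed.

(** The row-major position of a pair, which is the order built into [tprod]. *)
Definition tix m n (i : 'I_m) (j : 'I_n) : 'I_(m * n) := Ordinal (tix_subproof i j).

Lemma tix_surj m n (l : 'I_(m * n)) : exists i j, l = @tix m n i j.
Proof.
have n0 : (0 < n)%N by case: n l => // l; have := ltn_ord l; rewrite [X in (_ < X)%N]muln0.
have li : (l %/ n < m)%N by rewrite ltn_divLR.
have lj : (l %% n < n)%N by rewrite ltn_mod.
by exists (Ordinal li), (Ordinal lj); apply: val_inj => /=; rewrite -divn_eq.
Qed.

Lemma tix_inj m n (i i' : 'I_m) (j j' : 'I_n) : tix i j = tix i' j' -> i = i' /\ j = j'.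
Proof.
move=> e; have /= e2 := congr1 val e.
have n0 : (0 < n)%N by apply: leq_ltn_trans (ltn_ord j).
split; apply: val_inj.
  by have := congr1 (divn^~ n) e2; rewrite !divnMDl // !divn_small // !addn0.
by have := congr1 (modn^~ n) e2; rewrite !modnMDl !modn_small.
Qed.

Lemma trow_tix n1 m2 n2 (a : 'rV[F]_n1) (B : 'M[F]_(m2, n2)) i (j1 : 'I_n1) (j2 : 'I_n2) :
  trow a B i (tix j1 j2) = a 0 j1 * B i j2.
Proof.
elim: n1 a j1 => [|n1 IHn] a j1; first by case: j1.
rewrite /= mxE; case: splitP => l /= el.
  have j10 : (j1 : nat) = 0%N.
    by case: (j1 : nat) el (ltn_ord l) => // j' <-; rewrite mulSn -addnA ltnNge leq_addr.
  rewrite !mxE; congr (a _ _ * B _ _); apply: val_inj => /=.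
    by rewrite j10.
  by rewrite -el j10.
have [j1' ej1] : exists j1' : 'I_n1, (j1 : nat) = j1'.+1.
  case: j1 el => [[|j1'] lt1] /= el.
    by have := ltn_ord j2; rewrite -[(j2 : nat)]add0n el ltnNge leq_addr.
  by exists (Ordinal (lt1 : (j1' < n1)%N)).
have -> : l = tix j1' j2.
  by apply: val_inj => /=; apply: (@addnI n2); rewrite -el ej1 mulSn addnA.
rewrite IHn mxE; congr (a _ _ * _).
by apply: val_inj; rewrite /= ej1 add1n.
Qed.

Lemma tprod_tix m1 n1 (A : 'M[F]_(m1, n1)) m2 n2 (B : 'M[F]_(m2, n2)) i1 i2 j1 j2 :
  tprod A B (tix i1 i2) (tix j1 j2) = A i1 j1 * B i2 j2.
Proof.
elim: m1 A i1 => [|m1 IHm] A i1; first by case: i1.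
rewrite /= mxE; case: splitP => l /= el.
  have i10 : (i1 : nat) = 0%N.
    by case: (i1 : nat) el (ltn_ord l) => // i' <-; rewrite mulSn -addnA ltnNge leq_addr.
  rewrite trow_tix mxE; congr (A _ _ * B _ _); apply: val_inj => //=.
  by rewrite -el i10.
have [i1' ei1] : exists i1' : 'I_m1, (i1 : nat) = i1'.+1.
  case: i1 el => [[|i1'] lt1] /= el.
    by have := ltn_ord i2; rewrite -[(i2 : nat)]add0n el ltnNge leq_addr.
  by exists (Ordinal (lt1 : (i1' < m1)%N)).
have -> : l = tix i1' i2.
  by apply: val_inj => /=; apply: (@addnI m2); rewrite -el ei1 mulSn addnA.
rewrite IHm mxE; congr (A _ _ * _).
by apply: val_inj; rewrite /= ei1 add1n.
Qed.

End TensorIndex.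

Section Model.

Variables (p f : nat) (k : finFieldType) (E : fieldType) (iota : {rmorphism k -> E}).
Hypotheses (p_pr : prime p) (card_k : #|k| = (p ^ f)%N).

Definition symc (t : nat) (g : 'M[E]_2) (i j : nat) : E :=
  (((g 0 0)%:P + g 1 0 *: 'X) ^+ (t - j) * ((g 0 1)%:P + g 1 1 *: 'X) ^+ j)`_i.

Variable t : 'I_f -> nat.
Hypothesis t_lt : forall i, (t i < p)%N.

(* The matrix coefficients of P are det^e times those of a tensor product of
   twisted symmetric powers, in a basis indexed by the multi-indices below t. *)
Definition modeled (P : representation E 'GL_2[k]) (s : seq 'I_f) (e : nat) : Prop :=
  exists ix : 'I_(rdegree P) -> {ffun 'I_f -> 'I_p},
  [/\ injective ix,
      forall j i, (ix j i <= t i)%N /\ (i \notin s -> ix j i = 0%N :> nat),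
      forall phi : {ffun 'I_f -> 'I_p}, (forall i, phi i <= t i)%N ->
        (forall i, i \notin s -> phi i = 0%N :> nat) -> exists j, ix j = phi
    & forall g j' j, P g j' j = iota (\det (GLval g) ^+ e) *
        \prod_(i <- s) symc (t i) (twist_mx p iota i g) (ix j' i) (ix j i)].

Lemma modeled_det P s e e' : modeled P s e ->
  modeled (tensor_repr (Representation (det_pow_repr iota e')) P) s (e' + e).
Proof.
case=> ix [inj bd onto co].
have dP : (1 * rdegree P)%N = rdegree P by rewrite mul1n.
have tixE (j : 'I_(1 * rdegree P)) : j = tix (0 : 'I_1) (cast_ord dP j).
  by apply: val_inj; rewrite /= mul0n.
exists (fun j : 'I_(1 * rdegree P) => ix (cast_ord dP j)); split.
- by move=> a b /inj/cast_ord_inj.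
- by move=> j i; apply: bd.
- move=> phi h1 h2; have [j ej] := onto phi h1 h2.
  by exists (cast_ord (esym dP) j); rewrite cast_ordKV.
move=> g j' j; rewrite [in LHS](tixE j') [in LHS](tixE j) /= tprod_tix mxE eqxx mulr1n.
by rewrite co mulrA exprD rmorphM.
Qed.

Lemma modeled_nil : modeled (Representation (det_pow_repr iota 0)) [::] 0.
Proof.
have p0 : (0 < p)%N by apply: prime_gt0.
exists (fun _ => [ffun _ => Ordinal p0]); split.
- by move=> /= a b _; rewrite !ord1.
- by move=> j i; rewrite ffunE.
- move=> phi _ h; exists 0; apply/ffunP=> i; apply: val_inj; rewrite ffunE /=.
  by rewrite h.
by move=> g j' j /=; rewrite big_nil mulr1 mxE !ord1 eqxx.
Qed.

Lemma modeled_cons P i s : i \notin s -> modeled P s 0 ->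
  modeled (tensor_repr (Representation (sym_twist_repr iota p_pr card_k (t i) i)) P) (i :: s) 0.
Proof.
move=> nis [ix [inj bd onto co]].
have lt1 (a : 'I_(t i).+1) : (a < p)%N by apply: leq_trans (ltn_ord a) (t_lt i).
pose up (a : 'I_(t i).+1) (b : 'I_(rdegree P)) : {ffun 'I_f -> 'I_p} :=
  [ffun l => if l == i then Ordinal (lt1 a) else ix b l].
have inj_up a b a' b' : up a b = up a' b' -> a = a' /\ b = b'.
  move=> e; split.
    by apply: val_inj; have := congr1 (fun h : {ffun 'I_f -> 'I_p} => (h i : nat)) e; rewrite !ffunE eqxx.
  apply: inj; apply/ffunP=> l; have [->|nl] := eqVneq l i.
    by apply: val_inj; rewrite /= (proj2 (bd b i) nis) (proj2 (bd b' i) nis).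
  by have := congr1 (fun h : {ffun 'I_f -> 'I_p} => h l) e; rewrite !ffunE (negPf nl).
have [d1 d2] : exists d1 : 'I_((t i).+1 * rdegree P) -> 'I_(t i).+1,
  exists d2 : 'I_((t i).+1 * rdegree P) -> 'I_(rdegree P), forall j, j = tix (d1 j) (d2 j).
  have h (j : 'I_((t i).+1 * rdegree P)) : exists x : 'I_(t i).+1 * 'I_(rdegree P), j == tix x.1 x.2.
    by have [a [b ->]] := tix_surj j; exists (a, b).
  by exists (fun j => (xchoose (h j)).1), (fun j => (xchoose (h j)).2) => j; apply/eqP/(xchooseP (h j)).
case: d2 => d2 dE.
have d12 a b : d1 (tix a b) = a /\ d2 (tix a b) = b by have [<- <-] := tix_inj (dE (tix a b)).
exists (fun j : 'I_((t i).+1 * rdegree P) => up (d1 j) (d2 j)); split.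
- by move=> a b /= /inj_up[e1 e2]; rewrite (dE a) (dE b) e1 e2.
- move=> j l; rewrite ffunE inE negb_or; case: (l =P i) => [->|nl] /=; last by apply: bd.
  by split=> //; rewrite -ltnS.
- move=> phi h1 h2; pose phi' : {ffun 'I_f -> 'I_p} := [ffun l => if l == i then Ordinal (prime_gt0 p_pr) else phi l].
  have [||b eb] := onto phi'.
  + by move=> l; rewrite ffunE; case: eqP.
  + move=> l nl; rewrite ffunE; case: eqP => // /eqP ne; apply: h2.
    by rewrite inE negb_or ne.
  have la : (phi i < (t i).+1)%N by rewrite ltnS.
  exists (tix (Ordinal la) b); have [-> ->] := d12 (Ordinal la) b.
  apply/ffunP=> l; rewrite ffunE; case: (l =P i) => [->|/eqP ne]; first exact: val_inj.
  by rewrite eb ffunE (negPf ne).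
move=> g j' j; rewrite [in LHS](dE j') [in LHS](dE j) /= tprod_tix mxE co big_cons !ffunE eqxx.
rewrite expr0 rmorph1 !mul1r; congr (_ * _); rewrite big_seq [in RHS]big_seq; apply: eq_bigr => l ls.
have nl : (l == i) = false by apply: contraNF nis => /eqP <-.
by rewrite !ffunE nl.
Qed.

Lemma modeled_foldr s : uniq s ->
  modeled (foldr (@tensor_repr k E) (Representation (det_pow_repr iota 0))
       [seq Representation (sym_twist_repr iota p_pr card_k (t i) i) | i <- s]) s 0.
Proof.
elim: s => [|i s IHs] /=; first by move=> _; apply: modeled_nil.
by case/andP=> nis us; apply: modeled_cons => //; apply: IHs.
Qed.

End Model.

(** * Unipotent and diagonal elements, and their symmetric powers *)

Section Elements.

Variable A : finComUnitRingType.

Definition up_mx (a : A) : 'M[A]_2 :=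
  \matrix_(i, j) if i == 0 then (if j == 0 then 1 else a) else (j == 1)%:R.

Lemma up_mx_unit a : up_mx a \is a GRing.unit.
Proof. by rewrite -[_ \is a _]/(_ \in unitmx) unitmxE det22 !mxE /= mulr0 subr0 mulr1 unitr1. Qed.

Definition UG a : {'GL_2[A]} := FinRing.Unit (up_mx_unit a).

Definition diag2_mx (a : A) : 'M[A]_2 :=
  \matrix_(i, j) if i == 0 then (j == 0)%:R else if j == 0 then 0 else a.

Lemma diag2_mx_unit a : a \is a GRing.unit -> diag2_mx a \is a GRing.unit.
Proof. by move=> ua; rewrite -[_ \is a _]/(_ \in unitmx) unitmxE det22 !mxE /= mulr0 subr0 mul1r. Qed.

Definition TG a (ua : a \is a GRing.unit) : {'GL_2[A]} := FinRing.Unit (diag2_mx_unit ua).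

End Elements.

Section SymCoef.

Variable E : fieldType.
Implicit Type g : 'M[E]_2.

Lemma symc_U t g u i j : g 0 0 = 1 -> g 1 0 = 0 -> g 0 1 = u -> g 1 1 = 1 ->
  symc t g i j = u ^+ (j - i) *+ 'C(j, i).
Proof.
move=> e1 e2 e3 e4; rewrite /symc e1 e2 e3 e4 scale0r addr0 expr1n mul1r scale1r.
rewrite exprDn coef_sum.
have [le|lt] := leqP i j; last first.
  rewrite bin_small // mulr0n big1 // => l _.
  rewrite coefMn -rmorphXn coefCM coefXn; case: eqP => [e|]; last by rewrite mulr0 mul0rn.
  by have := ltn_ord l; rewrite -e ltnS leqNgt lt.
rewrite (bigD1 (Ordinal (le : (i < j.+1)%N))) //= coefMn -rmorphXn coefCM coefXn eqxx mulr1.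
rewrite big1 ?addr0 // => l ne; rewrite coefMn -rmorphXn coefCM coefXn.
case: eqP => [e|]; last by rewrite mulr0 mul0rn.
by case/eqP: ne; apply: val_inj.
Qed.

Lemma symc_w t g i j : g 0 0 = 0 -> g 1 0 = 1 -> g 0 1 = 1 -> g 1 1 = 0 ->
  symc t g i j = (i == t - j)%N%:R.
Proof.
move=> e1 e2 e3 e4; rewrite /symc e1 e2 e3 e4 scale0r addr0 expr1n mulr1 scale1r add0r.
by rewrite coefXn.
Qed.

Lemma symc_T t g (a b : E) i j : g 0 0 = a -> g 1 0 = 0 -> g 0 1 = 0 -> g 1 1 = b ->
  symc t g i j = a ^+ (t - j) * b ^+ j *+ (i == j).
Proof.
move=> e1 e2 e3 e4; rewrite /symc e1 e2 e3 e4 scale0r addr0 add0r exprZn -rmorphXn.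
by rewrite coefCM coefZ coefXn mulrA mulr_natr.
Qed.

End SymCoef.

(** * Irreducibility of the tensor products and their unipotent invariants *)

Section Simple.

Variables (p f : nat) (k : finFieldType) (E : fieldType) (iota : {rmorphism k -> E}).
Variables (A : finComUnitRingType) (red : {rmorphism A -> k}) (tau : k -> A).
Hypotheses (p_pr : prime p) (card_k : #|k| = (p ^ f)%N) (chk : p \in [pchar k]).
Hypothesis tauK : cancel tau red.
Local Notation fr := (fr p iota).
Local Notation fT := {ffun 'I_f -> 'I_p}.

Lemma red_U i a : let g := twist_mx p iota i (GL_red red (UG a)) in
  [/\ g 0 0 = 1, g 1 0 = 0, g 0 1 = iota (red a ^+ (p ^ i)) & g 1 1 = 1].
Proof.
have pi0 : (0 < p ^ i)%N by rewrite expn_gt0 prime_gt0.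
by split; rewrite !mxE /= ?rmorph1 ?rmorph0 ?expr1n ?expr0n ?eqn0Ngt ?pi0 ?rmorph1 ?rmorph0.
Qed.

Lemma det_U a : \det (GLval (GL_red red (UG a))) = 1.
Proof. by rewrite det_map_mx det22 !mxE /= mulr0 subr0 mulr1 rmorph1. Qed.

Lemma red_w i : let g := twist_mx p iota i (GL_red red (lambda_GL (0 : A))) in
  [/\ g 0 0 = 0, g 1 0 = 1, g 0 1 = 1 & g 1 1 = 0].
Proof.
have pi0 : (0 < p ^ i)%N by rewrite expn_gt0 prime_gt0.
by split; rewrite !mxE /= ?rmorph1 ?rmorph0 ?expr1n ?expr0n ?eqn0Ngt ?pi0 ?rmorph1 ?rmorph0.
Qed.

Lemma det_w : \det (GLval (GL_red red (lambda_GL (0 : A)))) = -1.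
Proof. by rewrite det_map_mx det22 !mxE /= mulr0 sub0r mulr1 rmorphN1. Qed.

Lemma red_T i a (ua : a \is a GRing.unit) : let g := twist_mx p iota i (GL_red red (TG ua)) in
  [/\ g 0 0 = 1, g 1 0 = 0, g 0 1 = 0 & g 1 1 = iota (red a ^+ (p ^ i))].
Proof.
have pi0 : (0 < p ^ i)%N by rewrite expn_gt0 prime_gt0.
by split; rewrite !mxE /= ?rmorph1 ?rmorph0 ?expr1n ?expr0n ?eqn0Ngt ?pi0 ?rmorph1 ?rmorph0.
Qed.

Lemma det_T a (ua : a \is a GRing.unit) : \det (GLval (GL_red red (TG ua))) = red a.
Proof. by rewrite det_map_mx det22 !mxE /= mulr0 subr0 mul1r. Qed.

Variables (P : representation E 'GL_2[k]) (t : 'I_f -> nat) (e : nat).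
Hypothesis t_lt : forall i, (t i < p)%N.
Local Notation n := (rdegree P).
Variable ix : 'I_n -> fT.
Hypothesis ix_inj : injective ix.
Hypothesis ix_le : forall j i, (ix j i <= t i)%N.
Hypothesis ix_onto : forall phi : fT, (forall i, phi i <= t i)%N -> exists j, ix j = phi.
Hypothesis ixE : forall g j' j, P g j' j = iota (\det (GLval g) ^+ e) *
  \prod_i symc (t i) (twist_mx p iota i g) (ix j' i) (ix j i).
Local Notation rs := (left_module (inflate red P)).
Local Notation dl j := (delta_mx 0 j : 'rV[E]_n).

Lemma rs_row (v : 'rV[E]_n) x : v *m rs x^-1%g =
  \sum_j \sum_j' (v 0 j * P (GL_red red x) j' j) *: dl j'.
Proof.
rewrite /= invgK; apply/rowP=> j'; rewrite !mxE summxE; apply: eq_bigr => j _.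
rewrite summxE (bigD1 j') //= !mxE !eqxx mulr1 big1 ?addr0 // => j'' ne.
by rewrite !mxE eqxx eq_sym (negPf ne) mulr0.
Qed.

(** The power of u in the matrix coefficient. Truncation is harmless, since [cU j j'] is 0 unless
    [ix j'] is below [ix j]. *)
Definition phi0 (j j' : 'I_n) : fT := [ffun i => Ordinal (leq_ltn_trans (leq_subr (ix j' i) (ix j i)) (ltn_ord (ix j i)))].
Definition cU (j j' : 'I_n) : E := (\prod_i 'C(ix j i, ix j' i))%:R.
Definition wU (v : 'rV[E]_n) (phi : fT) : 'rV[E]_n :=
  \sum_j \sum_j' (v 0 j * cU j j' *+ (phi0 j j' == phi)) *: dl j'.

Lemma P_U a j' j : P (GL_red red (UG a)) j' j = cU j j' * \prod_i fr (red a) i ^+ phi0 j j' i.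
Proof.
rewrite ixE det_U expr1n rmorph1 mul1r /cU natr_prod -big_split /=; apply: eq_bigr => i _.
have [e1 e2 e3 e4] := red_U i a; rewrite (symc_U _ _ _ e1 e2 e3 e4) ffunE /=.
by rewrite /fr rmorphXn mulr_natl.
Qed.

Lemma U_expand v u : v *m rs (UG (tau u))^-1%g = \sum_(phi : fT) (\prod_i fr u i ^+ phi i) *: wU v phi.
Proof.
rewrite rs_row /wU; under [RHS]eq_bigr do rewrite scaler_sumr.
rewrite [RHS]exchange_big /=; apply: eq_bigr => j _; under [RHS]eq_bigr do rewrite scaler_sumr.
rewrite [RHS]exchange_big /=; apply: eq_bigr => j' _.
rewrite (bigD1 (phi0 j j')) //= eqxx mulr1n [X in _ + X]big1 ?addr0 => [|phi ne].
  by rewrite P_U tauK scalerA mulrA [in RHS]mulrC.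
by rewrite eq_sym (negPf ne) mulr0n scale0r scaler0.
Qed.

Lemma extract_U (X : 'M[E]_n) (v : 'rV[E]_n) : mxmodule rs X -> (v <= X)%MS -> forall phi, (wU v phi <= X)%MS.
Proof.
move=> mX vX; apply: (extract (iota := iota) p_pr card_k) => u.
by rewrite -U_expand; apply: mxmodule_trans vX; rewrite ?groupV ?inE.
Qed.

Lemma ix0_ex : exists j, forall i, ix j i = 0%N :> nat.
Proof.
have [|j ej] := ix_onto (phi := [ffun _ => Ordinal (prime_gt0 p_pr)]); first by move=> i; rewrite ffunE.
by exists j => i; rewrite ej ffunE.
Qed.

Lemma bin_neq0 a b : (b <= a)%N -> (a < p)%N -> ('C(a, b))%:R != 0 :> E.
Proof.
move=> ba ap; rewrite -(dvdn_pcharf (chE iota chk)); apply/negP=> dv.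
have : (p %| a`!)%N by rewrite -(bin_fact ba) dvdn_mulr.
elim: a ap {ba dv} => [|a IHa] ap; first by rewrite dvdn1 => /eqP e1; have := prime_gt1 p_pr; rewrite e1.
rewrite factS Euclid_dvdM // => /orP[/(dvdn_leq (ltn0Sn a))|]; first by rewrite leqNgt ap.
by apply: IHa; apply: ltnW.
Qed.

(** Take j of maximal total degree in v. No other index of v lies above [ix j], so u^(ix j) arises
    from j alone, and only on the way to the vector of index 0, which is fixed by the unipotents. *)
Lemma wU_max (v : 'rV[E]_n) j0 : v != 0 -> (forall i, ix j0 i = 0%N :> nat) ->
  exists j, [/\ v 0 j != 0, wU v (ix j) = v 0 j *: dl j0 &
     ((forall i, ix j i = 0%N :> nat) -> v = v 0 j0 *: dl j0)].
Proof.
move=> v0 hj0.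
have [j1 vj1] : exists j, v 0 j != 0.
  apply/existsP; apply: contraNT v0; rewrite negb_exists => /forallP h.
  by apply/eqP/rowP=> j; rewrite mxE; apply/eqP/negPn/h.
pose sz j := (\sum_i ix j i)%N.
have [j vj maxj] := @arg_maxnP _ j1 (fun j => v 0 j != 0) sz vj1.
have big j2 : (forall i, ix j i <= ix j2 i)%N -> v 0 j2 != 0 -> j2 = j.
  move=> le vj2; apply: ix_inj; apply/ffunP=> i; apply: val_inj => /=.
  have := maxj _ vj2; rewrite /sz /= (bigD1 i) //= [X in (_ <= X)%N](bigD1 i) //= => h.
  have h2 : (\sum_(l < f | l != i) ix j l <= \sum_(l < f | l != i) ix j2 l)%N by apply: leq_sum => l _.
  apply/eqP; rewrite eqn_leq le andbT -(leq_add2r (\sum_(l < f | l != i) ix j2 l)).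
  by apply: leq_trans h _; rewrite leq_add2l.
exists j; split=> //.
- rewrite /wU (bigD1 j) //= [X in _ + X]big1 ?addr0 => [|j2 ne]; last first.
    apply: big1 => j' _; case: eqP => [ph|_]; last by rewrite mulr0n scale0r.
    have [->|nz] := eqVneq (v 0 j2) 0; first by rewrite !mul0r mul0rn scale0r.
    case/eqP: ne; apply: big nz => i; rewrite -ph ffunE /=; exact: leq_subr.
  rewrite (bigD1 j0) //= [X in _ + X]big1 ?addr0 => [|j' ne]; last first.
    case: eqP => [ph|_]; last by rewrite mulr0n scale0r.
    have [/forallP le|/forallPn[i gt]] := boolP [forall i, ix j' i <= ix j i]%N.
      case/eqP: ne; apply: ix_inj; apply/ffunP=> i; apply: val_inj; rewrite /= hj0.
      have := congr1 (fun h : fT => h i : nat) ph; rewrite ffunE /=; have := le i; lia.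
    by rewrite /cU (bigD1 i) //= bin_small ?mul0n ?mulr0 ?mul0rn ?scale0r // ltnNge.
  have -> : phi0 j j0 = ix j by apply/ffunP=> i; apply: val_inj; rewrite ffunE /= hj0 subn0.
  by rewrite eqxx mulr1n /cU big1 ?mulr1 // => i _; rewrite hj0 bin0.
move=> h0; apply/rowP=> j2; rewrite !mxE eqxx /=.
have ej : j = j0 by apply: ix_inj; apply/ffunP=> i; apply: val_inj; rewrite /= hj0 h0.
have [->|ne] := eqVneq j2 j0; first by rewrite mulr1.
rewrite mulr0; apply/eqP; apply: contraNT ne => nz; apply/eqP; rewrite -ej; apply: big => // i.
by rewrite h0.
Qed.

(** A nonzero submodule contains the vector of index 0 by [wU_max], hence its image of index t under
    [lambda_GL 0]. The unipotent translates of the latter yield every basis vector, with binomial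
    coefficients that are nonzero because t < p. *)
Lemma modeled_irr : mx_irreducible rs.
Proof.
have [j0 hj0] := ix0_ex; apply/mx_irrP; split=> [|U mU U0].
  by apply: leq_ltn_trans (ltn_ord j0).
have /rowV0Pn[v vU v0] := U0.
have [j [vj wj _]] := wU_max v0 hj0.
have j0U : (dl j0 <= U)%MS.
  by have := extract_U mU vU (ix j); rewrite wj (eqmx_scale _ vj).
have [jt hjt] : exists jt, forall i, ix jt i = t i :> nat.
  have [|j' ej] := ix_onto (phi := [ffun i => Ordinal (t_lt i)]); first by move=> i; rewrite ffunE.
  by exists j' => i; rewrite ej ffunE.
have jtU : (dl jt <= U)%MS.
  have : (dl j0 *m rs (lambda_GL (0 : A))^-1%g <= U)%MS by apply: mxmodule_trans j0U; rewrite ?groupV ?inE.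
  rewrite rs_row (bigD1 j0) //= [X in _ + X]big1 ?addr0 => [|j1 ne]; last first.
    by apply: big1 => j' _; rewrite mxE (negPf ne) andbF mul0r scale0r.
  rewrite (bigD1 jt) //= [X in _ + X]big1 ?addr0 => [|j' ne]; last first.
    rewrite ixE (_ : \prod_i _ = 0) ?mulr0 ?scale0r //.
    have [i ni] : exists i, (ix j' i : nat) != t i.
      apply/existsP; apply: contraNT ne; rewrite negb_exists => /forallP h.
      apply/eqP/ix_inj/ffunP=> i; apply: val_inj; rewrite /= hjt.
      exact/eqP/negPn/h.
    have [e1 e2 e3 e4] := red_w i.
    by rewrite (bigD1 i) //= (symc_w _ _ _ e1 e2 e3 e4) hj0 subn0 (negPf ni) mul0r.
  rewrite ixE !mxE !eqxx mul1r det_w rmorphXn rmorphN1 big1 ?mulr1 => [|i _]; last first.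
    by have [e1 e2 e3 e4] := red_w i; rewrite (symc_w _ _ _ e1 e2 e3 e4) hj0 hjt subn0 eqxx.
  by rewrite (eqmx_scale _ _) // signr_eq0.
rewrite -sub1mx; apply/row_subP=> j'; rewrite rowE mulmx1.
pose phi := phi0 jt j'.
have := extract_U mU jtU phi; rewrite /wU (bigD1 jt) //= [X in _ + X]big1 ?addr0 => [|j1 ne]; last first.
  by apply: big1 => j2 _; rewrite mxE (negPf ne) andbF !mul0r mul0rn scale0r.
rewrite (bigD1 j') //= [X in _ + X]big1 ?addr0 => [|j2 ne]; last first.
  case: eqP => [ph|_]; last by rewrite mulr0n scale0r.
  case/eqP: ne; apply: ix_inj; apply/ffunP=> i; apply: val_inj => /=.
  have := congr1 (fun h : fT => h i : nat) ph; rewrite !ffunE /= hjt.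
  have := ix_le j2 i; have := ix_le j' i; lia.
rewrite eqxx mulr1n !mxE !eqxx mul1r (eqmx_scale _ _) // /cU natr_prod.
by apply/prodf_neq0 => i _; apply: bin_neq0 => //; rewrite hjt.
Qed.

Lemma U_fixed (v : 'rV[E]_n) j0 : (forall i, ix j0 i = 0%N :> nat) ->
  (forall u, v *m rs (UG (tau u))^-1%g = v) -> v = v 0 j0 *: dl j0.
Proof.
move=> hj0 fv; have [->|v0] := eqVneq v 0; first by rewrite mxE scale0r.
have [j [vj wj h]] := wU_max v0 hj0; apply: h.
pose z0 : fT := [ffun _ => Ordinal (prime_gt0 p_pr)].
(* Invariance leaves only the constant coefficient in u, so the index found by [wU_max] must be
   0. *)
have key phi : wU v phi - v *+ (phi == z0) = 0.
  apply/eqP; rewrite -submx0.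
  apply: (extract (iota := iota) p_pr card_k (w := fun phi => wU v phi - v *+ (phi == z0))) => u.
  under eq_bigr do rewrite scalerBr; rewrite sumrB -U_expand fv.
  suffices -> : \sum_(phi : fT) (\prod_i fr u i ^+ phi i) *: (v *+ (phi == z0)) = v.
    by rewrite subrr sub0mx.
  rewrite (bigD1 z0) //= eqxx [X in X *: _]big1 => [|i _]; last by rewrite ffunE expr0.
  by rewrite scale1r big1 ?addr0 // => phi' /negPf->; rewrite mulr0n scaler0.
have := key (ix j); rewrite wj; case: eqP => [e1 _ i|_ /eqP]; first by rewrite e1 ffunE.
rewrite mulr0n subr0 scaler_eq0 (negPf vj) /= => /eqP/matrixP/(_ 0 j0)/eqP.
by rewrite !mxE !eqxx oner_eq0.
Qed.

Lemma U_fix0 u j0 : (forall i, ix j0 i = 0%N :> nat) -> dl j0 *m rs (UG (tau u))^-1%g = dl j0.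
Proof.
move=> hj0; rewrite rs_row (bigD1 j0) //= [X in _ + X]big1 ?addr0 => [|j1 ne]; last first.
  by apply: big1 => j' _; rewrite mxE (negPf ne) andbF mul0r scale0r.
rewrite (bigD1 j0) //= [X in _ + X]big1 ?addr0 => [|j' ne]; last first.
  have [i ni] : exists i, (ix j' i : nat) != 0%N.
    apply/existsP; apply: contraNT ne; rewrite negb_exists => /forallP h.
    apply/eqP/ix_inj/ffunP=> i; apply: val_inj; rewrite /= hj0.
    exact/eqP/negPn/h.
  by rewrite P_U /cU (bigD1 i) //= hj0 bin_small ?mul0n ?mul0r ?mulr0 ?scale0r // lt0n.
rewrite P_U !mxE !eqxx mul1r /cU !big1 ?mul1r ?scale1r // => i _; rewrite ?hj0 ?bin0 //.
by rewrite ffunE /= hj0.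
Qed.

Lemma T_weight a (ua : a \is a GRing.unit) j0 : (forall i, ix j0 i = 0%N :> nat) ->
  dl j0 *m rs (TG ua)^-1%g = iota (red a ^+ e) *: dl j0.
Proof.
move=> hj0; rewrite rs_row (bigD1 j0) //= [X in _ + X]big1 ?addr0 => [|j1 ne]; last first.
  by apply: big1 => j' _; rewrite mxE (negPf ne) andbF mul0r scale0r.
rewrite (bigD1 j0) //= [X in _ + X]big1 ?addr0 => [|j' ne]; last first.
  have [i ni] : exists i, (ix j' i : nat) != 0%N.
    apply/existsP; apply: contraNT ne; rewrite negb_exists => /forallP h.
    apply/eqP/ix_inj/ffunP=> i; apply: val_inj; rewrite /= hj0.
    exact/eqP/negPn/h.
  have [e1 e2 e3 e4] := red_T i ua.
  by rewrite ixE (bigD1 i) //= (symc_T _ _ _ e1 e2 e3 e4) hj0 (negPf ni) mulr0n !(mul0r, mulr0) scale0r.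
rewrite ixE det_T !mxE !eqxx mul1r big1 ?mulr1 // => i _.
have [e1 e2 e3 e4] := red_T i ua.
by rewrite (symc_T _ _ _ e1 e2 e3 e4) hj0 eqxx mulr1n expr1n expr0 mulr1.
Qed.

End Simple.

(** * The strata *)

Section SectionHom.

Variables (F : fieldType) (gT : finGroupType) (G : {group gT}).
Variables (n : nat) (rG : mx_representation F G n).

(** [B] is equivariant modulo [U] only; it induces a nonzero map from a simple module onto W / U. *)
Lemma sec_iso_hom (U W : 'M[F]_n) m (rs : mx_representation F G m) (B : 'M[F]_(m, n)) :
  mxmodule rG U -> mxmodule rG W -> (U <= W)%MS -> mx_irreducible rs ->
  (B <= W)%MS -> (W <= B + U)%MS -> ~~ (B <= U)%MS ->
  (forall x, x \in G -> (rs x *m B - B *m rG x <= U)%MS) -> sec_iso rG U W rs.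
Proof.
move=> mU mW sUW irr sBW sWB nBU eqv; exists mU, mW; apply: mx_rsim_sym.
pose X := <<in_factmod U W>>%MS.
have sBX : (in_factmod U B <= X)%MS by rewrite genmxE in_factmodE [in_factmod U W]in_factmodE submxMr.
pose B' := in_submod X (in_factmod U B).
have hom x : x \in G -> rs x *m B' = B' *m section_repr mU mW x.
  move=> Gx; rewrite /B' /section_repr -in_submodJ // -in_factmodJ //.
  have -> : rs x *m in_submod X (in_factmod U B) = in_submod X (in_factmod U (rs x *m B)).
    by rewrite (in_submodE _ (in_factmod U B)) (in_factmodE U B) (in_submodE _ (in_factmod U _))
      (in_factmodE U (_ *m _)) !mulmxA.
  by congr in_submod; apply/eqP; rewrite -subr_eq0 -linearB in_factmod_eq0 eqv.
have free : row_free B'.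
  rewrite -kermx_eq0; apply: contraNT nBU => nk.
  have mk : mxmodule rs (kermx B').
    apply/mxmoduleP=> x Gx; apply/sub_kermxP.
    by rewrite -mulmxA hom // mulmxA mulmx_ker mul0mx.
  have /mx_irrP[_ full] := irr; have := full _ mk nk.
  rewrite -sub1mx => /sub_kermxP; rewrite mul1mx => e.
  by rewrite -in_factmod_eq0 -(in_submodK sBX) -/B' e linear0.
exists B' => //.
have rB : \rank B' = m by apply/eqP.
rewrite -{1}rB mxrank_in_submod // genmxE; apply/eqP; rewrite eqn_leq.
rewrite mxrankS /=; last by rewrite -(genmxE (in_factmod U W)).
rewrite mxrankS //.
by rewrite -(in_factmod_addsK U B) addsmxC submxMr.
Qed.

(** The vectors sent into [U] form a proper submodule of a simple module, which is 0. *)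
Lemma hom_row_notin (U : 'M[F]_n) m (rs : mx_representation F G m) (B : 'M[F]_(m, n)) :
  mxmodule rG U -> mx_irreducible rs -> ~~ (B <= U)%MS ->
  (forall x, x \in G -> (rs x *m B - B *m rG x <= U)%MS) ->
  forall j, ~~ (row j B <= U)%MS.
Proof.
move=> mU irr nBU eqv j; apply/negP=> rowU.
pose K := kermx (B *m cokermx U).
have KB : (K *m B <= U)%MS by rewrite submxE -mulmxA mulmx_ker.
have mK : mxmodule rs K.
  apply/mxmoduleP=> x Gx; apply/sub_kermxP; rewrite mulmxA; apply/eqP; rewrite -submxE -mulmxA.
  rewrite -[rs x *m B](subrK (B *m rG x)) mulmxDr addmx_sub //.
    by apply: mulmx_sub; apply: eqv.
  by rewrite mulmxA (submx_trans (submxMr _ KB)) //; have /mxmoduleP := mU; apply.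
have K0 : K != 0.
  apply: contraTneq rowU => K0; rewrite submxE -row_mul; apply/negP=> /eqP r0.
  have : ((delta_mx 0 j : 'rV_m) <= K)%MS by apply/sub_kermxP; rewrite -rowE.
  by rewrite K0 submx0 => /eqP/matrixP/(_ 0 j)/eqP; rewrite !mxE !eqxx oner_eq0.
have /mx_irrP[_ full] := irr; have := full _ mK K0.
rewrite -sub1mx => h; case/negP: nBU; apply: submx_trans KB.
by rewrite -[X in (X <= _)%MS]mul1mx submxMr.
Qed.

End SectionHom.

(** After division by C(s + l, s), the unipotents act on d^(s + l) by the coefficients C(l, l') of
    their action on Y^l; this is where [cB] comes from. *)
Lemma bin_trinomial s l l' :
  ('C(s + l, s + l') * 'C(s + l', s) = 'C(s + l, s) * 'C(l, l'))%N.
Proof.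
have [le|lt] := leqP l' l; last first.
  by rewrite (bin_small lt) bin_small ?ltn_add2l // muln0.
have le2 : (s + l' <= s + l)%N by rewrite leq_add2l.
have h1 := bin_fact le2; rewrite subnDl in h1.
have h2 := bin_fact (leq_addr l' s); rewrite addKn in h2.
have h3 := bin_fact (leq_addr l s); rewrite addKn in h3.
have h4 := bin_fact le.
have pos : (0 < s`! * (l'`! * (l - l')`!))%N by rewrite !muln_gt0 !fact_gt0.
apply/eqP; rewrite -(eqn_pmul2r pos); apply/eqP.
transitivity ((s + l)`!)%N; first by rewrite -h1 -h2; ring.
by rewrite -h3 -h4; ring.
Qed.

(** For s + t = p - 1 it compares the scalars [cB] at l and t - l, which [lambda_GL 0] exchanges. *)
Lemma bin_reflect (E : fieldType) p s l : prime p -> p \in [pchar E] -> (s + l <= p.-1)%N ->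
  ('C(p.-1 - l, s))%:R = (-1) ^+ s * ('C(s + l, s))%:R :> E.
Proof.
move=> p_pr chE; have p0 := prime_gt0 p_pr.
elim: s => [|s IHs] le; first by rewrite !bin0 expr0 mul1r.
have s0 : s.+1%:R != 0 :> E.
  rewrite -(dvdn_pcharf chE); apply/negP=> /(dvdn_leq (ltn0Sn s)).
  by rewrite leqNgt -(prednK p0) ltnS (leq_trans _ le) // addSn ltnS leq_addr.
apply: (mulfI s0).
rewrite -natrM mul_bin_left natrM IHs; last by apply: leq_trans le; rewrite addSn.
rewrite [RHS]mulrCA addSn -natrM -mul_bin_diag natrM exprS mulN1r.
have e : (p.-1 - l - s)%:R = - (s + l).+1%:R :> E.
  apply/eqP; rewrite -addr_eq0 -natrD.
  have -> : (p.-1 - l - s + (s + l).+1)%N = p by move: le p0; clear; lia.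
  by rewrite pcharf0.
by rewrite e; ring.
Qed.

Section Generators.

Variables (k : finFieldType) (A : finComUnitRingType) (red : {rmorphism A -> k}).
Hypothesis unit_redP : forall a : A, (a \is a GRing.unit) = (red a != 0).
Local Notation w := (lambda_GL (0 : A)).

Lemma GL_eqP (g h : {'GL_2[A]}) : (forall i j, GLval g i j = GLval h i j) -> g = h.
Proof. by move=> e; apply/val_inj/matrixP. Qed.

Lemma ord2P (Q : 'I_2 -> Prop) : Q 0 -> Q 1 -> forall i, Q i.
Proof.
move=> h0 h1 [[|[|//]] lt].
  by rewrite (_ : Ordinal lt = 0) //; apply: val_inj.
by rewrite (_ : Ordinal lt = 1) //; apply: val_inj.
Qed.

(** If the upper left entry is a unit, the matrix is lower triangular times upper triangular, and
    conjugation by [w] yields the lower factors. If not, the entry below it is a unit, the ring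
    being local, and [w] exchanges the rows. *)
Lemma GL2_gen (H : {'GL_2[A]} -> Prop) :
  (forall g h, H g -> H h -> H (g * h)%g) -> (forall a, H (UG a)) -> H w ->
  (forall a (ua : a \is a GRing.unit), H (TG ua)) -> forall g, H g.
Proof.
move=> HM HU Hw HT.
have main g : GLval g 0 0 \is a GRing.unit -> H g.
  set a := GLval g 0 0; set b := GLval g 0 1; set c := GLval g 1 0; set d := GLval g 1 1 => ua.
  have ud : d - c * a^-1 * b \is a GRing.unit.
    have := GL_unitmx g; rewrite unitmxE det22 -/a -/b -/c -/d => u.
    rewrite -(unitrMr _ ua) [X in X \is a _](_ : _ = a * d - b * c) //.
    have -> : a * (d - c * a^-1 * b) = a * d - b * c * (a / a) by ring.
    by rewrite divrr // mulr1.
  have -> : g = (w * (UG (c * a^-1)%R * (TG ua * w)) * (TG ud * UG (a^-1 * b)%R))%g.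
    apply: GL_eqP; apply: ord2P; apply: ord2P; rewrite !GL_MxE !mulmx22 !mxE /=;
    rewrite ?(mulr0, mul0r, mulr1, mul1r, addr0, add0r) -?/a -?/b -?/c -?/d //.
    - by rewrite mulrA divrr // mul1r.
    - by rewrite mulrVK.
    - by rewrite mulrVK // mulrA addrC subrK.
  by do 4!(apply: (HM) => //).
move=> g; have [ua|na] := boolP (GLval g 0 0 \is a GRing.unit); first exact: main.
have -> : g = (w * (w * g))%g.
  by apply: GL_eqP; apply: ord2P; apply: ord2P; rewrite !GL_MxE !mulmx22 !mxE /=;
    rewrite ?(mulr0, mul0r, mulr1, mul1r, addr0, add0r).
apply: (HM) => //; apply: main; rewrite GL_MxE mulmx22 !mxE /= mul0r mul1r add0r.
move: na; rewrite !unit_redP negbK => /eqP ra.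
have := GL_unitmx g; rewrite unitmxE det22 unit_redP rmorphB !rmorphM ra mul0r sub0r oppr_eq0.
by rewrite mulf_eq0 negb_or => /andP[].
Qed.

End Generators.

(** * Weights that tell the constituents apart *)

Section Distinct.

Variables (p f : nat) (k : finFieldType) (E : fieldType) (iota : {rmorphism k -> E}).
Variables (A : finComUnitRingType) (red : {rmorphism A -> k}) (tau : k -> A).
Hypotheses (p_pr : prime p) (card_k : #|k| = (p ^ f)%N) (chk : p \in [pchar k]).
Hypothesis tauK : cancel tau red.
Hypothesis unit_redP : forall a : A, (a \is a GRing.unit) = (red a != 0).
Local Notation fT := {ffun 'I_f -> 'I_p}.
Local Notation dl j := (delta_mx 0 j).

(* The line fixed by the unipotents [[1, u], [0, 1]] is unique, and diag(1, x)
   acts on it by x^e. *)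
Lemma modeled_weight (P P' : representation E 'GL_2[k]) t t' e e' :
  modeled p iota t P (enum 'I_f) e -> modeled p iota t' P' (enum 'I_f) e' ->
  mx_rsim (left_module (inflate red P)) (left_module (inflate red P')) ->
  forall x : k, x != 0 -> x ^+ e = x ^+ e'.
Proof.
move=> [ix [inj bd onto co]] [ix' [inj' bd' onto' co']] [B _ fB hB] x x0.
have enumE (i : 'I_f) : i \notin enum 'I_f = false by rewrite mem_enum inE.
have onto2 (phi : fT) : (forall i, phi i <= t i)%N -> exists j, ix j = phi.
  by move=> h; apply: onto => // i; rewrite enumE.
have onto2' (phi : fT) : (forall i, phi i <= t' i)%N -> exists j, ix' j = phi.
  by move=> h; apply: onto' => // i; rewrite enumE.
have co2 g j' j : P g j' j = iota (\det (GLval g) ^+ e) *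
    \prod_i symc (t i) (twist_mx p iota i g) (ix j' i) (ix j i).
  by rewrite co big_enum.
have co2' g j' j : P' g j' j = iota (\det (GLval g) ^+ e') *
    \prod_i symc (t' i) (twist_mx p iota i g) (ix' j' i) (ix' j i).
  by rewrite co' big_enum.
have [j0 hj0] := ix0_ex p_pr onto2; have [j0' hj0'] := ix0_ex p_pr onto2'.
pose v : 'rV[E]_(rdegree P') := dl j0 *m B.
have v0 : v != 0.
  apply/eqP=> ev; have : dl j0 *m B = 0 *m B :> 'rV_(rdegree P') by rewrite mul0mx.
  move/(row_free_inj fB)/matrixP/(_ 0 j0)/eqP; by rewrite !mxE !eqxx oner_eq0.
have fix_v u : v *m left_module (inflate red P') (UG (tau u))^-1%g = v.
  by rewrite /v -mulmxA -hB ?inE // mulmxA (U_fix0 red tau p_pr inj co2 u hj0).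
have ev := U_fixed p_pr card_k chk tauK inj' co2' hj0' fix_v.
have ua : tau x \is a GRing.unit by rewrite unit_redP tauK.
have h1 : v *m left_module (inflate red P') (TG ua)^-1%g = iota (x ^+ e) *: v.
  by rewrite /v -mulmxA -hB ?inE // mulmxA (T_weight red p_pr inj co2 ua hj0) tauK scalemxAl.
have h2 : v *m left_module (inflate red P') (TG ua)^-1%g = iota (x ^+ e') *: v.
  by rewrite ev -scalemxAl (T_weight red p_pr inj' co2' ua hj0') tauK !scalerA mulrC.
move: h1; rewrite h2 => /eqP; rewrite -subr_eq0 -scalerBl scaler_eq0 (negPf v0) orbF.
by rewrite subr_eq0 => /eqP/fmorph_inj.
Qed.

(** Multiply by x^(q - 1 - e) and compare the power sums over k. *)
Lemma weight_inj e e' : (e < (p ^ f).-1)%N -> (e' < (p ^ f).-1)%N ->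
  (forall x : k, x != 0 -> x ^+ e = x ^+ e') -> e = e'.
Proof.
move=> lte lte' h; set q1 := (p ^ f).-1.
have d0 : (0 < q1 - e)%N by rewrite subn_gt0.
have e1 : \sum_(x : k) x ^+ (q1 - e + e) = \sum_(x : k) x ^+ (q1 - e + e').
  apply: eq_bigr => x _; have [->|x0] := eqVneq x 0.
    by rewrite !expr0n !addn_eq0 !eqn0Ngt d0.
  by rewrite !exprD h.
move: e1; rewrite subnK ?(ltnW lte) // !(sum_pow p_pr card_k) -/q1 dvdnn (leq_ltn_trans _ lte) //=.
rewrite addn_gt0 d0 /=; case: ifP => [dv _|_ /eqP]; last by rewrite oppr_eq0 oner_eq0.
have : (e' == e %[mod q1])%N.
  by rewrite -(eqn_modDl (q1 - e)) subnK ?(ltnW lte) // modnn.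
by rewrite !modn_small // => /eqP->.
Qed.

Variable rd : 'I_f -> nat.
Hypothesis rd_gen : forall i, (3 <= rd i <= p - 3)%N.
Local Notation TT := ({set 'I_f} * {set 'I_f})%type.

Definition wt (t : TT) := (num p (sd rd t) + ppow p t.2)%N.

Lemma wtE (t : TT) : wt t = num p (fun i => sd rd t i + (i \in t.2))%N.
Proof.
rewrite /wt ppow_num /num -big_split; apply: eq_bigr => i _ /=.
by rewrite mulnDl.
Qed.

Lemma wt_digit (t : TT) i : (sd rd t i + (i \in t.2) <= p - 2)%N.
Proof.
have := rd_gen i; rewrite /sd /ad.
by case: (i \in t.1); case: (ord_pred i \in t.1); case: (i \in t.2) => /=; clear; lia.
Qed.

Lemma wt_digit_p (t : TT) i : (sd rd t i + (i \in t.2) < p)%N.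
Proof. by have := wt_digit t i; have := rd_gen i; clear; lia. Qed.

Lemma wt_lt (t : TT) : (wt t < (p ^ f).-1)%N.
Proof.
have p1 := prime_gt1 p_pr; have f0 := f_gt0 card_k.
rewrite ltn_neqAle; apply/andP; split; last first.
  by rewrite -ltnS prednK ?expn_gt0 ?(ltnW p1) // wtE num_lt //; apply: wt_digit_p.
apply/negP=> /eqP; rewrite wtE => /(num_eq_top p1 (wt_digit_p t))/(_ (Ordinal f0)).
have := wt_digit t (Ordinal f0); have := rd_gen (Ordinal f0); move: p1.
move: (sd _ _ _ + _)%N (rd _) => x y; clear; lia.
Qed.

(** A digit is at most 1 outside J and at least r_i - 1 >= 2 on J, which determines J; for given J,
    the digit depends on whether i is in I. *)
Lemma wt_inj : injective wt.
Proof.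
move=> t t'; rewrite !wtE => e.
have h := num_inj (prime_gt1 p_pr) (wt_digit_p t) (wt_digit_p t') e.
have eJ : t.1 = t'.1.
  apply/setP=> i; have := h i; have := rd_gen i; rewrite /sd /ad.
  by case: (i \in t.1); case: (i \in t'.1); case: (ord_pred i \in t.1); case: (ord_pred i \in t'.1);
    case: (i \in t.2); case: (i \in t'.2) => //=; clear; lia.
have eI : t.2 = t'.2.
  apply/setP=> i; have := h i; have := rd_gen i; rewrite /sd /ad eJ.
  by case: (i \in t'.1); case: (ord_pred i \in t'.1);
    case: (i \in t.2); case: (i \in t'.2) => //=; clear; lia.
by rewrite [t]surjective_pairing [t']surjective_pairing eJ eI.
Qed.

End Distinct.

Section Strata.

Variables (p f : nat) (k : finFieldType) (E : fieldType) (iota : {rmorphism k -> E}).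
Variables (A : finComUnitRingType).
Variables (red : {rmorphism A -> k}) (tau : k -> A) (pi : A) (ub : k).
Hypotheses (p_pr : prime p) (card_k : #|k| = (p ^ f)%N) (chk : p \in [pchar k]).
Hypotheses (tauK : cancel tau red) (tauM : {morph tau : x y / x * y}).
Hypotheses (pi2 : pi * pi = 0) (redpi : red pi = 0).
Hypothesis kerred : forall a, red a = 0 -> exists b, a = pi * b.
Hypothesis annpi : forall a, pi * a = 0 -> red a = 0.
Hypothesis p_pi : p%:R = pi * tau ub.
Variable (rd : 'I_f -> nat).
Hypothesis rd_gen : forall i, (3 <= rd i <= p - 3)%N.

Local Notation TT := ({set 'I_f} * {set 'I_f})%type.
Local Notation fn := (A * A -> E).
Local Notation fr := (fr p iota).
Local Notation cx := (cx p iota red).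
Local Notation dx := (dx p iota red).
Local Notation DD := (DD p iota red tau pi).
Local Notation mon0 := (mon0 p iota red).
Local Notation mhom := (mhom p iota red).
Local Notation RR := (RR p iota red tau pi).
Local Notation nd := (nd p rd).
Local Notation ad := (ad rd).
Local Notation sd := (sd rd).
Local Notation td := (td p rd).
Local Notation V := (regular_repr E 'GL_2[A]).
Local Notation N0 := (gcard 'GL_2[A]).
Local Notation rowF := (@rowF E A).
Local Notation mon := (mon p iota red tau pi).
Local Notation Dp := (Dp p iota red tau pi).
Local Notation WW := (WW p iota red tau pi rd).
Local Notation NN := (NN p iota red tau pi rd).
Local Notation sdn := (sdown (ThetaS f) (@tle f)).
Local Notation dn := (down (ThetaS f) (@tle f)).
Local Notation dcl := (dclosed (ThetaS f) (@tle f)).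
Implicit Types (F : fn) (I J D : {set 'I_f}) (t : TT).
Local Notation q := (p ^ f)%N.
Local Notation fmon := (fmon p iota red tau pi rd).

Section Stratum.

Variable t : TT.
Hypothesis tT : t \in ThetaS f.
Variable S : {set TT}.
Hypothesis dS : dcl S.
Hypothesis ntS : t \notin S.
Hypothesis dtS : dcl (t |: S).

Lemma sdn_sub : sdn t \subset S.
Proof.
apply/subsetP=> x; rewrite in_setD1 in_set => /and3P[nx xT xt].
have [_ cl] := dtS; have := cl t x (setU11 _ _) xT xt.
by rewrite in_setU1 (negPf nx).
Qed.

Lemma NN_sdn : (NN (sdn t) <= NN S)%MS.
Proof. exact/NN_mono/sdn_sub. Qed.

Lemma tD_sdn D : D \subset t.2 -> D != set0 -> tD t D \in sdn t.
Proof.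
move=> sD D0; rewrite in_setD1 in_set tD_Theta // tD_le // !andbT.
apply/negP=> /eqP e; case/set0Pn: D0 => i iD.
have := congr1 (fun x : TT => i \in x.2) e; rewrite /= !inE iD /=.
by rewrite (subsetP sD).
Qed.

(** All terms of the expansion but [D = set0] are in lower strata, so here D_i behaves like the
    character det^(p^i). *)
Lemma mod_main F g : mhom (nd t) F ->
  (rowF (fun v => (F (vact v g) * Dp t.2 (vact v g))%R) -
   (\prod_(i in t.2) fr (red (\det g)) i) *: rowF (fun v => (F (vact v g) * Dp t.2 v)%R) <= NN S)%MS.
Proof.
move=> hF; apply: submx_trans NN_sdn.
rewrite (rowF_ext (act_expand p iota red tau pi F t.2 g)) rowF_sum (bigD1 set0) //=.
have -> : rowF (Tm p iota red tau pi F t.2 g set0) =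
   (\prod_(i in t.2) fr (red (\det g)) i) *: rowF (fun v => (F (vact v g) * Dp t.2 v)%R).
  rewrite -rowFZ; apply: rowF_ext => v; rewrite TmE ?sub0set // setD0.
  by rewrite big_set0 mulr1.
rewrite addrAC subrr add0r summx_sub // => D D0.
have [sD|nD] := boolP (D \subset t.2); last first.
  by rewrite (rowF_ext (Tm0 p iota red tau pi F g nD)) rowF0 sub0mx.
apply: submx_trans (Tm_WW p_pr card_k chk tauK tauM pi2 redpi kerred annpi p_pi rd_gen g tT sD hF) _.
exact/WW_NN/tD_sdn.
Qed.

Variables (P : representation E 'GL_2[k]) (e : nat).
Local Notation n := (rdegree P).
Local Notation fT := {ffun 'I_f -> 'I_p}.
Variable ix : 'I_n -> fT.
Hypothesis ix_inj : injective ix.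
Hypothesis ix_le : forall j i, (ix j i <= td t i)%N.
Hypothesis ix_onto : forall phi : fT, (forall i, phi i <= td t i)%N -> exists j, ix j = phi.
Hypothesis ixE : forall g j' j, P g j' j = iota (\det (GLval g) ^+ e) *
  \prod_i symc (td t i) (twist_mx p iota i g) (ix j' i) (ix j i).
Hypothesis eE : e = (num p (sd t) + ppow p t.2)%N.
Local Notation rs := (left_module (inflate red P)).

Lemma iota_e x : iota (x ^+ e) = (\prod_i fr x i ^+ sd t i) * \prod_(i in t.2) fr x i.
Proof.
rewrite eE exprD rmorphM !rmorphXn prod_fr; congr (_ * _).
by rewrite /ppow -prodrXr.
Qed.

Definition cB (l : 'I_f -> nat) : E := (\prod_i 'C(sd t i + l i, sd t i))%:R.

Lemma cB_neq0 (l : 'I_f -> nat) : (forall i, l i <= td t i)%N -> cB l != 0.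
Proof.
move=> hl; rewrite /cB natr_prod; apply/prodf_neq0 => i _.
apply: (bin_neq0 iota p_pr chk); first exact: leq_addr.
by apply: leq_ltn_trans (st_lt rd_gen t i); rewrite leq_add2l.
Qed.

Definition fhat (l : 'I_f -> nat) : 'rV[E]_N0 := (cB l)^-1 *: rowF (fmon t l).
Definition Bm : 'M[E]_(n, N0) := \matrix_j fhat (fun i => ix j i).

(** The row action of the inverse of x is the left action of x. *)
Definition equiv (x : {'GL_2[A]}) := (rs x^-1%g *m Bm - Bm *m V x^-1%g <= NN S)%MS.

Lemma equivM x y : equiv x -> equiv y -> equiv (x * y)%g.
Proof.
rewrite /equiv invMg => hx hy; rewrite !repr_mxM ?inE ?groupV //.
have -> : rs y^-1%g *m rs x^-1%g *m Bm - Bm *m (V y^-1%g *m V x^-1%g) =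
   rs y^-1%g *m (rs x^-1%g *m Bm - Bm *m V x^-1%g) + (rs y^-1%g *m Bm - Bm *m V y^-1%g) *m V x^-1%g.
  by rewrite mulmxBr mulmxBl !mulmxA addrA subrK.
apply: addmx_sub; first exact: mulmx_sub hx.
apply: submx_trans (submxMr _ hy) _.
have mN : mxmodule V (NN S).
  exact: (NN_module _ p_pr card_k chk tauK tauM pi2 redpi kerred annpi p_pi rd_gen dS).
by have /mxmoduleP := mN; apply; rewrite inE.
Qed.

Lemma equiv_rows x : (forall j,
   (\sum_j' P (GL_red red x) j' j *: fhat (fun i => ix j' i) -
    (cB (fun i => ix j i))^-1 *: rowF (fun v => fmon t (fun i => ix j i) (vact v (GLval x))) <= NN S)%MS) ->
  equiv x.
Proof.
move=> h; apply/row_subP=> j; rewrite raddfB /= !row_mul rowK -scalemxAl rowF_act.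
apply: etrans (h j); congr (_ - _ <= _)%MS.
rewrite mulmx_sum_row; apply: eq_bigr => j' _.
by rewrite rowK !mxE invgK.
Qed.

Lemma rowF_scale_ext c F F' : (forall v, F v = c * F' v) -> rowF F = c *: rowF F'.
Proof. by move=> h; rewrite -rowFZ; apply: rowF_ext. Qed.

Lemma fmon_hom l : (forall i, l i <= td t i)%N ->
  mhom (nd t) (mon0 (fun i => nd t i - sd t i - l i)%N (fun i => sd t i + l i)%N).
Proof. by move=> hl; apply: hom_mon0 => i; have := st_le rd_gen t i; have := hl i; lia. Qed.

Lemma equiv_row_mod (x : {'GL_2[A]}) j (R : 'rV[E]_N0) :
  rowF (fun v => mon0 (fun i => nd t i - sd t i - ix j i)%N (fun i => sd t i + ix j i)%N (vact v (GLval x)) * Dp t.2 v) = R ->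
  (\sum_j' P (GL_red red x) j' j *: fhat (fun i => ix j' i) -
    ((cB (fun i => ix j i))^-1 * \prod_(i in t.2) fr (red (\det (GLval x))) i) *: R <= NN S)%MS ->
  (\sum_j' P (GL_red red x) j' j *: fhat (fun i => ix j' i) -
    (cB (fun i => ix j i))^-1 *: rowF (fun v => fmon t (fun i => ix j i) (vact v (GLval x))) <= NN S)%MS.
Proof.
move=> eR h; have := mod_main (GLval x) (fmon_hom (ix_le j)); rewrite eR => h2.
set X := rowF _ in h2; rewrite -[rowF _]/X.
have -> : (cB (fun i => ix j i))^-1 *: X = (cB (fun i => ix j i))^-1 *: (X - (\prod_(i in t.2) fr (red (\det (GLval x))) i) *: R)
   + ((cB (fun i => ix j i))^-1 * \prod_(i in t.2) fr (red (\det (GLval x))) i) *: R.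
  by rewrite scalerBr scalerA subrK.
rewrite opprD addrCA addmx_sub // ?eqmx_opp ?scalemx_sub //.
Qed.

Lemma equiv_T a (ua : a \is a GRing.unit) : equiv (TG ua).
Proof.
apply: equiv_rows => j; set m := fun i => (sd t i + ix j i)%N.
apply: (equiv_row_mod (R := (\prod_i fr (red a) i ^+ m i) *: rowF (fmon t (fun i => ix j i)))).
  apply: rowF_scale_ext => v; rewrite /fmon /mon mulrA; congr (_ * _).
  rewrite /mon0 -big_split /=; apply: eq_bigr => i _.
  rewrite cx_act // dx_act // !mxE /= rmorph1 rmorph0 (fr1 p) (fr0 iota p_pr) mul1r !mul0r addr0 add0r.
  by rewrite exprMn mulrCA.
rewrite (bigD1 j) //= [X in _ + X - _]big1 ?addr0 => [|j' ne]; last first.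
  have [i ni] : exists i, (ix j' i : nat) != ix j i.
    apply/existsP; apply: contraNT ne; rewrite negb_exists => /forallP h.
    by apply/eqP/ix_inj/ffunP=> i; apply: val_inj; apply/eqP/negPn/h.
  have [e1 e2 e3 e4] := red_T iota red p_pr i ua.
  by rewrite ixE (bigD1 i) //= (symc_T _ _ _ e1 e2 e3 e4) (negPf ni) mulr0n mul0r mulr0 scale0r.
rewrite ixE det_T iota_e /fhat !scalerA.
suffices -> : \prod_i symc (td t i) (twist_mx p iota i (GL_red red (TG ua))) (ix j i) (ix j i) =
   \prod_i fr (red a) i ^+ ix j i.
  rewrite det22 !mxE /= mulr0 subr0 mul1r.
  have -> : \prod_i fr (red a) i ^+ m i = (\prod_i fr (red a) i ^+ sd t i) * \prod_i fr (red a) i ^+ ix j i.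
    by rewrite -big_split; apply: eq_bigr => i _; rewrite exprD.
  rewrite (_ : _ *: _ - _ *: _ = 0) ?sub0mx //; apply/eqP; rewrite subr_eq0; apply/eqP; congr (_ *: _); ring.
apply: eq_bigr => i _; have [e1 e2 e3 e4] := red_T iota red p_pr i ua.
by rewrite (symc_T _ _ _ e1 e2 e3 e4) eqxx mulr1n expr1n mul1r /fr rmorphXn.
Qed.

Lemma nd_sd2 i : nd t i = (2 * sd t i + td t i)%N.
Proof. by have [/(nd_in rd_gen)[]|/(nd_out rd_gen)[]] := boolP (i \in t.1); lia. Qed.

Lemma sum_onto (F : fT -> 'rV[E]_N0) (X : 'M[E]_N0) (h : 'I_n -> fT) : injective h ->
  (forall phi, (forall j, h j != phi) -> (F phi <= X)%MS) ->
  (\sum_phi F phi - \sum_j F (h j) <= X)%MS.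
Proof.
move=> hinj hX; pose A0 := [set h j | j in [set: 'I_n]].
have -> : \sum_j F (h j) = \sum_(phi in A0) F phi.
  by rewrite big_imset /=; [apply: eq_bigl => j; rewrite inE | move=> a b _ _; apply: hinj].
rewrite (bigID (mem A0)) /= addrAC subrr add0r summx_sub // => phi nphi.
by apply: hX => j; apply: contra nphi => /eqP <-; apply/imsetP; exists j; rewrite ?inE.
Qed.

Lemma bin_refl_i l i : (l <= td t i)%N ->
  ('C(sd t i + (td t i - l), sd t i))%:R = (-1) ^+ sd t i * ('C(sd t i + l, sd t i))%:R :> E.
Proof.
move=> hl; have [iJ|niJ] := boolP (i \in t.1).
  have [_ h _ _ _] := nd_in rd_gen iJ.
  rewrite -(bin_reflect p_pr (chE iota chk)); last by move: h hl; clear; lia.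
  by congr (_%:R); congr 'C(_, _); move: h hl; clear; lia.
by have [-> _ _ _ _] := nd_out rd_gen niJ; rewrite !bin0 expr0 mul1r.
Qed.

(** Since nd = 2 sd + td, this element exchanges l and td - l. The sign of det^e splits into that of
    the D_i and that of the reflected binomials. *)
Lemma equiv_w : equiv (lambda_GL (0 : A)).
Proof.
apply: equiv_rows => j; pose l' i := (td t i - ix j i)%N.
have fN i : fr (-1) i = -1 by rewrite frN // fr1.
have hl' i : (l' i <= td t i)%N by apply: leq_subr.
have detw : red (\det (GLval (lambda_GL (0 : A)))) = -1.
  by rewrite det22 !mxE /= mulr0 sub0r mulr1 rmorphN1.
apply: (equiv_row_mod (R := rowF (fmon t l'))).
  apply: rowF_ext => v; rewrite /fmon /mon; congr (_ * _).
  apply: eq_bigr => i _; rewrite cx_act // dx_act // !mxE /= rmorph1 rmorph0 (fr1 p) (fr0 iota p_pr).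
  rewrite !mul1r !mul0r addr0 add0r mulrC; congr (_ ^+ _ * _ ^+ _);
  have := ix_le j i; rewrite nd_sd2 /l'; move: (ix j i : nat); clear; lia.
have lt' i : (l' i < p)%N.
  by apply: leq_ltn_trans (hl' i) _; apply: leq_ltn_trans (leq_addl _ _) (st_lt rd_gen t i).
have [|j' ej'] := ix_onto (phi := [ffun i => Ordinal (lt' i)]); first by move=> i; rewrite ffunE; apply: hl'.
have ij' i : ix j' i = l' i :> nat by rewrite ej' ffunE.
rewrite (bigD1 j') //= [X in _ + X - _]big1 ?addr0 => [|j2 ne]; last first.
  have [i ni] : exists i, (ix j2 i : nat) != l' i.
    apply/existsP; apply: contraNT ne; rewrite negb_exists => /forallP h.
    by apply/eqP/ix_inj/ffunP=> i; apply: val_inj; rewrite /= ij'; apply/eqP/negPn/h.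
  have [e1 e2 e3 e4] := red_w iota red p_pr i.
  by rewrite ixE (bigD1 i) //= (symc_w _ _ _ e1 e2 e3 e4) -/(l' i) (negPf ni) mul0r mulr0 scale0r.
rewrite ixE det_w iota_e [X in _ * X]big1 => [|i _]; last first.
  have [e1 e2 e3 e4] := red_w iota red p_pr i.
  by rewrite (symc_w _ _ _ e1 e2 e3 e4) -/(l' i) ij' eqxx.
have -> : rowF (fmon t l') = rowF (fmon t (fun i => ix j' i)).
  by apply: mon_ext => i; rewrite ij'.
have ecB : cB (fun i => ix j' i) = (\prod_i fr (-1) i ^+ sd t i) * cB (fun i => ix j i).
  rewrite /cB !natr_prod -big_split; apply: eq_bigr => i _ /=.
  by rewrite ij' bin_refl_i // fN.
have s0 : \prod_i fr (-1) i ^+ sd t i != 0 :> E.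
  by apply/prodf_neq0 => i _; rewrite fN signr_eq0.
rewrite /fhat scalerA mulr1 ecB invfM.
rewrite (_ : _ *: _ - _ *: _ = 0) ?sub0mx //; apply/eqP; rewrite subr_eq0; apply/eqP; congr (_ *: _).
have -> : red (\det (lambda_mx (0 : A))) = -1 by [].
by rewrite mulrACA divff // mul1r mulrC.
Qed.

Lemma exprDn_p (x y : E) m : (m < p)%N ->
  (x + y) ^+ m = \sum_(i < p) (x ^+ (m - i) * y ^+ i) *+ 'C(m, i).
Proof.
move=> lt; rewrite exprDn (big_ord_widen p (fun i => (x ^+ (m - i) * y ^+ i) *+ 'C(m, i))) //.
by rewrite big_mkcond; apply: eq_bigr => i _; case: ifP => // /negbT; rewrite -leqNgt => h; rewrite bin_small ?mulr0n.
Qed.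

Lemma mon0_U (m : 'I_f -> nat) a v : (forall i, m i < p)%N -> (forall i, m i <= nd t i)%N ->
  mon0 (fun i => nd t i - m i)%N m (vact v (up_mx a)) =
  \sum_(phi : fT) (\prod_i ('C(m i, phi i)%:R * fr (red a) i ^+ (m i - phi i))) *
      mon0 (fun i => nd t i - phi i)%N (fun i => phi i : nat) v.
Proof.
move=> mp mn; rewrite /mon0.
have h i : cx (vact v (up_mx a)) i ^+ (nd t i - m i) * dx (vact v (up_mx a)) i ^+ m i =
   \sum_(l < p) ('C(m i, l)%:R * fr (red a) i ^+ (m i - l)) * (cx v i ^+ (nd t i - l) * dx v i ^+ l).
  rewrite cx_act // dx_act // !mxE /= rmorph1 rmorph0 (fr1 p) (fr0 iota p_pr) !mul1r mul0r addr0.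
  rewrite exprDn_p // mulr_sumr; apply: eq_bigr => l _.
  have [le|gt] := leqP l (m i); last by rewrite bin_small // mulr0n mulr0 !mul0r.
  have -> : (nd t i - l = (nd t i - m i) + (m i - l))%N by move: le (mn i); clear; lia.
  by rewrite -mulr_natr exprMn exprD; ring.
rewrite (eq_bigr _ (fun i _ => h i)) bigA_distr_bigA /=.
by apply: eq_bigr => phi _; rewrite -big_split.
Qed.

Lemma equiv_U a : equiv (UG a).
Proof.
apply: equiv_rows => j; pose m i := (sd t i + ix j i)%N.
have mp i : (m i < p)%N.
  by apply: leq_ltn_trans (st_lt rd_gen t i); rewrite leq_add2l.
have mn i : (m i <= nd t i)%N by apply: leq_trans (st_le rd_gen t i); rewrite leq_add2l.
pose cf (phi : fT) := \prod_i ('C(m i, phi i)%:R * fr (red a) i ^+ (m i - phi i)).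
pose R (phi : fT) := rowF (mon (fun i => nd t i - phi i)%N (fun i => phi i : nat) t.2).
apply: (equiv_row_mod (R := \sum_(phi : fT) cf phi *: R phi)).
  rewrite (rowF_ext (F' := fun v => \sum_(phi : fT) cf phi * mon (fun i => nd t i - phi i)%N (fun i => phi i : nat) t.2 v)).
    by rewrite rowF_sum; apply: eq_bigr => phi _; rewrite rowFZ.
  move=> v; transitivity (mon0 (fun i => nd t i - m i)%N m (vact v (up_mx a)) * Dp t.2 v).
    by congr (_ * _); apply: mon0_ext => i //; rewrite /m subnDA.
  by rewrite mon0_U // mulr_suml; apply: eq_bigr => phi _; rewrite -mulrA.
have -> : \prod_(i in t.2) fr (red (\det (GLval (UG a)))) i = 1.
  by rewrite big1 // => i _; rewrite det22 !mxE /= mulr0 subr0 mulr1 rmorph1 fr1.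
rewrite mulr1 scaler_sumr.
have lth j' i : (sd t i + ix j' i < p)%N.
  by apply: leq_ltn_trans (st_lt rd_gen t i); rewrite leq_add2l.
pose h j' : fT := [ffun i => Ordinal (lth j' i)].
have hinj : injective h.
  move=> j1 j2 e1; apply: ix_inj; apply/ffunP=> i; apply: val_inj => /=.
  by apply: (@addnI (sd t i)); have := congr1 (fun z : fT => z i : nat) e1; rewrite !ffunE.
pose F phi := (cB (fun i => ix j i))^-1 *: (cf phi *: R phi).
have -> : \sum_j' P (GL_red red (UG a)) j' j *: fhat (fun i => ix j' i) = \sum_j' F (h j').
  apply: eq_bigr => j' _; rewrite /F /fhat !scalerA.
  have -> : R (h j') = rowF (fmon t (fun i => ix j' i)).
    by apply: mon_ext => i; rewrite ffunE //= subnDA.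
  congr (_ *: _); rewrite (P_U red p_pr ixE).
  apply: (mulIf (cB_neq0 (ix_le j'))); rewrite mulfVK ?(cB_neq0 (ix_le j')) //.
  apply: (mulfI (cB_neq0 (ix_le j))); rewrite -[in RHS]mulrA mulVKf ?(cB_neq0 (ix_le j)) //.
  rewrite /cB /cU /cf !natr_prod -!big_split; apply: eq_bigr => i _ /=.
  rewrite !ffunE /= /m subnDl.
  by rewrite mulrA -natrM -bin_trinomial natrM; ring.
rewrite -opprB eqmx_opp; apply: sum_onto => // phi nphi; rewrite /F scalemx_sub //.
have [c0|c0] := eqVneq (cf phi) 0; first by rewrite c0 scale0r sub0mx.
rewrite scalemx_sub //.
have phm i : (phi i <= m i)%N.
  rewrite leqNgt; apply/negP=> lt; case/eqP: c0; rewrite /cf (bigD1 i) //=.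
  by rewrite bin_small // mul0r mul0r.
have em i : (nd t i - phi i + phi i = nd t i)%N by rewrite subnK // (leq_trans (phm i)).
(* A monomial with a d-exponent below sd at an index of J has a c-exponent of at least p there, and
   drops to a lower stratum by a carry. *)
have [/existsP[i /andP[iJ lt]]|/existsPn hs] := boolP [exists i, (i \in t.1) && (phi i < sd t i)%N].
  apply: submx_trans NN_sdn; apply: (mon_carry iota red tau pi p_pr card_k chk rd_gen tT iJ em); apply/orP; left.
  by have [-> _ _ _ _] := nd_in rd_gen iJ; move: lt (prime_gt0 p_pr); clear; lia.
have sp i : (sd t i <= phi i)%N.
  have [iJ|niJ] := boolP (i \in t.1); first by have := hs i; rewrite iJ /= -leqNgt.
  by have [-> _ _ _ _] := nd_out rd_gen niJ.
have lt2 i : (phi i - sd t i < p)%N by apply: leq_ltn_trans (leq_subr _ _) (ltn_ord _).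
have [|j' ej'] := ix_onto (phi := [ffun i => Ordinal (lt2 i)]).
  move=> i; rewrite ffunE /=; have := phm i; rewrite /m -(leq_subLR) => h1.
  exact: leq_trans h1 (ix_le j i).
by case/eqP: (nphi j'); apply/ffunP=> i; apply: val_inj; rewrite /h !ffunE /= ej' ffunE /= subnKC.
Qed.

Lemma equiv_all x : equiv x.
Proof.
apply: (GL2_gen (unit_red tauK pi2 kerred) (H := equiv)).
- exact: equivM.
- exact: equiv_U.
- exact: equiv_w.
- exact: equiv_T.
Qed.

Lemma td_lt i : (td t i < p)%N.
Proof. by apply: leq_ltn_trans (leq_addl _ _) (st_lt rd_gen t i). Qed.

Lemma not_tle x : x \in S -> ~~ tle t x.
Proof.
move=> xS; apply: contra ntS => tx; have [_ cl] := dS; exact: cl xS tT tx.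
Qed.

(** For l = td the exponents on J are p - 1, hence different from [ad], which is at most p - 3. *)
Lemma fmon_notin : ~~ (rowF (fmon t (td t)) <= NN S)%MS.
Proof.
apply/negP=> h; have p6 := p_ge6 p_pr card_k chk rd_gen.
have p1 : (1 < p)%N by apply: leq_trans p6.
pose m i := (sd t i + td t i)%N.
have mp i : (m i < p)%N := st_lt rd_gen t i.
have k0 : NN S *m Lcol p iota tau pi (num p m) t.2 = 0.
  apply: (NN_Lcol0 iota p_pr card_k chk tauK tauM pi2 redpi kerred annpi rd_gen not_tle mp).
    by move=> i _; apply: leq_addr.
  move=> j jJ e1; have [_ h1 _ h2 _] := nd_in rd_gen jJ; have := e1 j; rewrite /m.
  by move: h1 h2 p6; clear; lia.
have [z ez] := submxP h; have := Lcol_neq0 iota p_pr card_k chk tauK tauM pi2 redpi kerred annpi rd_gen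
   (fun i => nd t i - sd t i - td t i)%N (m := m) t.2.
rewrite -/(fmon t (td t)) -[rowF (mon _ _ _)]/(rowF (fmon t (td t))) ez -mulmxA k0 mulmx0 mxE.
have le : (num p m <= q.-1)%N by rewrite -ltnS prednK ?expn_gt0 ?prime_gt0 // num_lt.
by move=> /(_ le)/eqP; rewrite eq_sym oner_eq0.
Qed.

Lemma Bm_notin : ~~ (Bm <= NN S)%MS.
Proof.
have [|jt ej] := ix_onto (phi := [ffun i => Ordinal (td_lt i)]); first by move=> i; rewrite ffunE.
apply: contra fmon_notin => h.
have -> : rowF (fmon t (td t)) = cB (fun i => ix jt i) *: row jt Bm.
  rewrite rowK /fhat scalerA divff ?cB_neq0 // scale1r.
  by apply: mon_ext => i; rewrite ej ffunE.
by rewrite scalemx_sub // (submx_trans (row_sub _ _)).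
Qed.

(** The functional detects the one monomial of [fmon_notin]; irreducibility extends this to the
    others. *)
Lemma fmon_notin_all l : (forall i, l i <= td t i)%N -> ~~ (rowF (fmon t l) <= NN S)%MS.
Proof.
move=> hl; have lp i : (l i < p)%N by apply: leq_ltn_trans (hl i) (td_lt i).
have [|j ej] := ix_onto (phi := [ffun i => Ordinal (lp i)]); first by move=> i; rewrite ffunE; apply: hl.
have mU : mxmodule V (NN S).
  exact: (NN_module iota p_pr card_k chk tauK tauM pi2 redpi kerred annpi p_pi rd_gen dS).
have eqv x : x \in ('GL_2[A])%g -> (rs x *m Bm - Bm *m V x <= NN S)%MS.
  by move=> _; have := equiv_all x^-1%g; rewrite /equiv invgK; exact.
have irr := modeled_irr p_pr card_k chk tauK td_lt ix_inj ix_le ix_onto ixE.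
apply: contra (hom_row_notin mU irr Bm_notin eqv j) => h.
have el : rowF (fmon t (fun i => ix j i)) = rowF (fmon t l) by apply: mon_ext => i; rewrite ej ffunE.
by rewrite rowK scalemx_sub // el.
Qed.

Lemma strat_iso : sec_iso V (NN S) (NN (t |: S)) rs.
Proof.
have mU : mxmodule V (NN S).
  exact: (NN_module iota p_pr card_k chk tauK tauM pi2 redpi kerred annpi p_pi rd_gen dS).
have mW : mxmodule V (NN (t |: S)).
  exact: (NN_module iota p_pr card_k chk tauK tauM pi2 redpi kerred annpi p_pi rd_gen dtS).
apply: (sec_iso_hom (B := Bm)) => //.
- by apply: NN_mono; apply: subsetUr.
- exact: (modeled_irr p_pr card_k chk tauK td_lt ix_inj ix_le ix_onto ixE).
- apply/row_subP=> j; rewrite rowK scalemx_sub //.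
  apply: submx_trans (WW_NN _ _ _ _ _ _ (setU11 t S)).
  exact: fmon_WW.
- apply: NN_le => x; rewrite in_setU1 => /orP[/eqP->|xS]; last first.
    by apply: submx_trans (addsmxSr _ _); apply: WW_NN.
  apply: submx_trans (WW_top iota red tau pi p_pr card_k chk rd_gen tT) _.
  rewrite addsmx_sub (submx_trans NN_sdn (addsmxSr _ _)) andbT.
  apply: submx_trans (addsmxSl _ _); apply/sumsmx_subP => l /forallP hl; rewrite genmxE.
  have [j ej] := ix_onto hl.
  have -> : rowF (fmon t (fun i => l i)) = cB (fun i => ix j i) *: row j Bm.
    by rewrite rowK /fhat scalerA divff ?scale1r ?ej // cB_neq0.
  by rewrite scalemx_sub // row_sub.
- exact: Bm_notin.
move=> x _; have := equiv_all x^-1%g; rewrite /equiv invgK; exact.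
Qed.

End Stratum.

(** * Nonsplit extensions between neighbouring strata *)

Hypothesis ub0 : ub != 0.
Local Notation Lcol := (Lcol p iota tau pi).
Local Notation fT := {ffun 'I_f -> 'I_p}.
Local Notation avd := (avoid (ThetaS f) (@tle f)).
Implicit Types (e m l : 'I_f -> nat) (psi : fT).

Lemma mon0_Uexp e m a v : (forall i, m i < p)%N ->
  mon0 e m (vact v (up_mx a)) =
  \sum_(psi : fT) (\prod_i ('C(m i, psi i)%:R * fr (red a) i ^+ psi i)) *
      mon0 (fun i => e i + psi i)%N (fun i => m i - psi i)%N v.
Proof.
move=> mp; rewrite /mon0.
have h i : cx (vact v (up_mx a)) i ^+ e i * dx (vact v (up_mx a)) i ^+ m i =
   \sum_(x < p) ('C(m i, x)%:R * fr (red a) i ^+ x) * (cx v i ^+ (e i + x) * dx v i ^+ (m i - x)).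
  rewrite cx_act // dx_act // !mxE /= rmorph1 rmorph0 (fr1 p) (fr0 iota p_pr) !mul1r mul0r addr0.
  rewrite addrC (exprDn_p _ _ (mp i)) mulr_sumr; apply: eq_bigr => x _.
  by rewrite -mulr_natr exprMn exprD; ring.
rewrite (eq_bigr _ (fun i _ => h i)) bigA_distr_bigA /=.
by apply: eq_bigr => psi _; rewrite -big_split.
Qed.

(** The coefficient of u^psi when every D_i keeps its leading term. The binomials vanish where psi
    exceeds m, so that the truncated difference does no harm. *)
Definition Wc e m I psi : 'rV[E]_N0 :=
  (\prod_i 'C(m i, psi i))%:R *: rowF (mon (fun i => e i + psi i)%N (fun i => m i - psi i)%N I).

Lemma Wc_WW t e m psi : (forall i, e i + m i = nd t i)%N -> (Wc e m t.2 psi <= WW t)%MS.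
Proof.
move=> em; rewrite /Wc; have [/forallP le|/forallPn[i gt]] := boolP [forall i, psi i <= m i]%N.
  rewrite scalemx_sub //; apply: mon_WW => // i; have := le i; have := em i; clear; lia.
by rewrite (bigD1 i) //= bin_small ?mul0n ?scale0r ?sub0mx // ltnNge.
Qed.

Lemma Tm_U0 e m I u : (forall i, m i < p)%N ->
  rowF (Tm p iota red tau pi (mon0 e m) I (up_mx (tau u)) set0) =
  \sum_(psi : fT) (\prod_i fr u i ^+ psi i) *: Wc e m I psi.
Proof.
move=> mp; rewrite (rowF_ext (F' := fun v => \sum_(psi : fT) (\prod_i fr u i ^+ psi i * (\prod_i 'C(m i, psi i))%:R) *
    mon (fun i => e i + psi i)%N (fun i => m i - psi i)%N I v)).
  by rewrite rowF_sum; apply: eq_bigr => psi _; rewrite rowFZ -scalerA.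
move=> v; rewrite TmE ?sub0set // setD0 big_set0 mulr1 big1 => [|i _]; last first.
  by rewrite det22 !mxE /= mulr0 subr0 mulr1 rmorph1 fr1.
rewrite mul1r mon0_Uexp // mulr_suml tauK; apply: eq_bigr => psi _.
by rewrite big_split /= natr_prod -mulrA [X in X * _]mulrC.
Qed.

Lemma U_mod t e m (Y : {set TT}) u : t \in ThetaS f -> (forall i, e i + m i = nd t i)%N ->
  (forall i, m i < p)%N -> (forall D, D \subset t.2 -> D != set0 -> tD t D \in Y) ->
  (rowF (fun v => mon e m t.2 (vact v (up_mx (tau u)))) -
     \sum_(psi : fT) (\prod_i fr u i ^+ psi i) *: Wc e m t.2 psi <= NN Y)%MS.
Proof.
move=> tT em mp hY.
rewrite (rowF_ext (act_expand p iota red tau pi (mon0 e m) t.2 (up_mx (tau u)))) rowF_sum (bigD1 set0) //=.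
rewrite Tm_U0 // addrAC subrr add0r summx_sub // => D D0.
have [sD|nD] := boolP (D \subset t.2); last first.
  by rewrite (rowF_ext (Tm0 p iota red tau pi _ _ nD)) rowF0 sub0mx.
have hF : mhom (nd t) (mon0 e m) by apply: hom_mon0.
apply: submx_trans (Tm_WW p_pr card_k chk tauK tauM pi2 redpi kerred annpi p_pi rd_gen _ tT sD hF) _.
exact/WW_NN/hY.
Qed.

Lemma SwC x y : Sw red tau pi x y = Sw red tau pi y x.
Proof. by rewrite /Sw addrC. Qed.

(** The entries are Teichmuller lifts, so only the carry remains. Its arguments are ordered so that
    the summation index of [fr_Sw] is the power of u. *)
Lemma RR_U (i : 'I_f) u v : RR (up_mx (tau u)) i v = cx v i * fr (Sw red tau pi (red v.2) (red v.1 * u)) i.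
Proof.
rewrite /RR /DD /cx det22 !mxE /= mulr0 subr0 mulr1 rmorph1 fr1 mul1r -frB // -frM; congr fr.
rewrite /detv /vact !mxE /= mulr1 mulr0 addr0 mulr1.
rewrite (coD tauK pi2 redpi kerred annpi) !(coM tauK tauM pi2 redpi kerred annpi) !rmorphD !rmorphM tauK.
by rewrite (co_tau tauK pi2 redpi kerred annpi) SwC; ring.
Qed.

(** The coefficients when D_i alone is replaced by its carry: those of [fr_Sw] at i - 1, binomial
    ones elsewhere. *)
Definition c2 m (i i' : 'I_f) (x : nat) : E := if i' == ord_pred i then
  (if x == 0%N then 0 else ('C(p, x) %/ p)%:R) else ('C(m i', x))%:R.
Definition m2 m (i : 'I_f) psi (i' : 'I_f) := (if i' == ord_pred i then p - psi i' else m i' - psi i')%N.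
Definition W2 e m i I psi : 'rV[E]_N0 := (- (fr ub i * \prod_i' c2 m i i' (psi i'))) *:
  rowF (mon (fun i' => e i' + psi i' + eps i i')%N (m2 m i psi) (I :\ i)).

(** As m is 0 at i - 1, the powers of u_(i-1) come from the carry alone and stay below p, as
    [extract] requires. *)
Lemma Tm_U1 e m i I u : i \in I -> m (ord_pred i) = 0%N -> (forall i', m i' < p)%N ->
  rowF (Tm p iota red tau pi (mon0 e m) I (up_mx (tau u)) [set i]) =
  \sum_(psi : fT) (\prod_i fr u i ^+ psi i) *: W2 e m i I psi.
Proof.
move=> iI m0 mp; rewrite (rowF_ext (F' := fun v => \sum_(psi : fT) (\prod_i' fr u i' ^+ psi i') *
   ((- (fr ub i * \prod_i' c2 m i i' (psi i'))) *
    mon (fun i' => e i' + psi i' + eps i i')%N (m2 m i psi) (I :\ i) v))).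
  by rewrite rowF_sum; apply: eq_bigr => psi _; rewrite !rowFZ.
move=> v; rewrite TmE ?sub1set // big1 ?mul1r => [|i' _]; last first.
  by rewrite det22 !mxE /= mulr0 subr0 mulr1 rmorph1 fr1.
rewrite big_set1 RR_U (fr_Sw iota p_pr card_k chk tauK tauM pi2 redpi kerred annpi p_pi).
pose S := \sum_(j < p | (j : nat) != 0%N) ('C(p, j) %/ p)%:R *
  (dx v (ord_pred i) ^+ (p - j) * fr (red v.1 * u) (ord_pred i) ^+ j).
rewrite -/(dx v (ord_pred i)) -/S.
have key : mon0 e m (vact v (up_mx (tau u))) * S =
   \sum_(psi : fT) (\prod_i' (c2 m i i' (psi i') * fr u i' ^+ psi i')) *
     mon0 (fun i' => e i' + psi i')%N (m2 m i psi) v.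
  pose G i' := \sum_(x < p) (c2 m i i' x * fr u i' ^+ x) * (cx v i' ^+ (e i' + x) *
     dx v i' ^+ (if i' == ord_pred i then p - x else m i' - x)%N).
  transitivity (\prod_i' G i'); last first.
    by rewrite bigA_distr_bigA /=; apply: eq_bigr => psi _; rewrite -big_split.
  rewrite /mon0 (bigD1 (ord_pred i)) //= [RHS](bigD1 (ord_pred i)) //= mulrAC; congr (_ * _).
    rewrite m0 expr0 mulr1 cx_act // !mxE /= rmorph1 rmorph0 (fr1 p) (fr0 iota p_pr) mul1r mul0r addr0.
    rewrite /S /G mulr_sumr big_mkcond; apply: eq_bigr => x _; rewrite /c2 eqxx.
    case: eqP => [->|_] /=; first by rewrite !mul0r.
    by rewrite frM exprMn exprD; ring.
  apply: eq_bigr => i' ni; rewrite /G cx_act // dx_act // !mxE /= rmorph1 rmorph0 (fr1 p) (fr0 iota p_pr).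
  rewrite !mul1r mul0r addr0 addrC (exprDn_p _ _ (mp i')) mulr_sumr; apply: eq_bigr => x _.
  by rewrite /c2 (negPf ni) -mulr_natr tauK exprMn exprD; ring.
transitivity (- (fr ub i * cx v i * (mon0 e m (vact v (up_mx (tau u))) * S) * Dp (I :\ i) v)); first by ring.
rewrite key mulr_sumr mulr_suml -sumrN; apply: eq_bigr => psi _.
rewrite big_split /= /mon.
have -> : mon0 (fun i' => e i' + psi i' + eps i i')%N (m2 m i psi) v = mon0 (fun i' => e i' + psi i')%N (m2 m i psi) v * cx v i.
  rewrite -[cx v i]expr1 cxX_mon0 mon0M; apply: mon0_ext => i'; last by rewrite addn0.
  by rewrite mul1n.
by ring.
Qed.

Section Step.

Variables (t t' : TT) (Z : 'M[E]_N0).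
Hypotheses (tT : t \in ThetaS f) (t't : t' \in sdn t) (rk' : trk t = (trk t').+1).
Hypotheses (mZ : mxmodule V Z) (sYZ : (NN (avd t t') <= Z)%MS).
Hypothesis sNZ : (NN (dn t) <= Z + NN (sdn t))%MS.

Lemma t'T : t' \in ThetaS f.
Proof. by have [] := sdown_in t't. Qed.

Lemma sdn_avd x : x \in sdn t' -> x \in avd t t'.
Proof.
move=> xS; have [xT xt' nx] := sdown_in xS; have [t'T t't2 nt'] := sdown_in t't.
have lt1 := tle_rk xt' nx.
rewrite in_set in_setD1 in_set xT (tle_trans xt' t't2) !andbT; apply/andP; split.
  by apply: contraTneq lt1 => ->; rewrite rk' -leqNgt leqnSn.
apply/negP=> h; have ne : t' != x by rewrite eq_sym.
by have := tle_rk h ne; rewrite ltnNge ltnW.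
Qed.

Lemma sdn_split x : x \in sdn t -> x = t' \/ x \in avd t t'.
Proof.
move=> xS; have [xT xt nx] := sdown_in xS.
have [h|h] := boolP (tle t' x); last by right; rewrite in_set xS.
left; apply/eqP; apply: contraT => ne; have ne' : t' != x by rewrite eq_sym.
by have := tle_rk h ne'; have := tle_rk xt nx; rewrite rk' ltnS leqNgt => /negPf->.
Qed.

Let e' (la : fT) i := (nd t' i - sd t' i - la i)%N.
Let m' (la : fT) i := (sd t' i + la i)%N.

(** Modulo [Z], the monomial of t is a combination of top monomials of t', since [Z] contains the
    other lower strata. Translate this relation by the unipotents and extract coefficients; the
    unknown [kap] is the same for all psi, so psi can be chosen to defeat it. *)
Lemma step_core l (w : fT -> 'rV[E]_N0) : (forall i, l i <= td t i)%N ->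
  (forall u, (rowF (fun v => fmon t l (vact v (up_mx (tau u)))) -
     \sum_(psi : fT) (\prod_i fr u i ^+ psi i) *: w psi <= NN (avd t t'))%MS) ->
  exists kap : fT -> E, forall psi,
    (w psi - \sum_(la : fT | [forall i, la i <= td t' i]%N) kap la *: Wc (e' la) (m' la) t'.2 psi <= Z)%MS.
Proof.
move=> hl hw.
have tdn : t \in dn t by rewrite in_set tT tle_refl.
have h1 : (rowF (fmon t l) <= Z + NN (sdn t))%MS.
  apply: submx_trans sNZ; apply: submx_trans (WW_NN _ _ _ _ _ _ tdn); exact: fmon_WW.
have h2 : (NN (sdn t) <= topS p iota red tau pi rd t' + Z)%MS.
  apply: NN_le => x /sdn_split[->|xY].
    apply: submx_trans (WW_top iota red tau pi p_pr card_k chk rd_gen t'T) _.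
    rewrite addsmxS //; apply: submx_trans sYZ; apply: NN_mono.
    by apply/subsetP=> y; apply: sdn_avd.
  by apply: submx_trans (addsmxSr _ _); apply: submx_trans sYZ; apply: WW_NN.
have h3 : (rowF (fmon t l) <= topS p iota red tau pi rd t' + Z)%MS.
  by apply: submx_trans h1 _; rewrite addsmx_sub addsmxSr.
have /sub_addsmxP[[a b] /= eab] := h3.
have /sub_sumsmxP[c ec] : (a *m topS p iota red tau pi rd t' <= topS p iota red tau pi rd t')%MS by apply: submxMl.
pose kap (la : fT) := ((c la *m <<rowF (fmon t' (fun i => la i))>>%MS) *m pinvmx (rowF (fmon t' (fun i => la i)))) 0 0.
have ek la : c la *m <<rowF (fmon t' (fun i => la i))>>%MS = kap la *: rowF (fmon t' (fun i => la i)).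
  rewrite -mul_scalar_mx /kap -mx11_scalar mulmxKpV //.
  by rewrite -(genmxE (rowF _)) submxMl.
exists kap; apply: (extract (iota := iota) p_pr card_k) => u.
pose g := UG (tau u).
pose Y := rowF (fmon t l) - \sum_(la : fT | [forall i, la i <= td t' i]%N) kap la *: rowF (fmon t' (fun i => la i)).
have YZ : (Y *m V g^-1%g <= Z)%MS.
  apply: mxmodule_trans; rewrite ?groupV ?inE //.
  rewrite /Y eab ec (eq_bigr _ (fun la _ => ek la)) addrAC subrr add0r submxMl //.
pose Q (la : fT) := rowF (fun v => fmon t' (fun i => la i) (vact v (up_mx (tau u)))) -
   \sum_(psi : fT) (\prod_i fr u i ^+ psi i) *: Wc (e' la) (m' la) t'.2 psi.
have QZ (la : fT) : [forall i, la i <= td t' i]%N -> (Q la <= Z)%MS.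
  move=> /forallP hla; apply: submx_trans sYZ; apply: U_mod => //.
  - exact: t'T.
  - by move=> i; rewrite /e' /m'; have := st_le rd_gen t' i; have := hla i; clear; lia.
  - by move=> i; apply: leq_ltn_trans (st_lt rd_gen t' i); rewrite leq_add2l.
  - by move=> D sD D0; apply: sdn_avd; apply: tD_sdn => //; apply: t'T.
have -> : \sum_(psi : fT) (\prod_i fr u i ^+ psi i) *:
    (w psi - \sum_(la : fT | [forall i, la i <= td t' i]%N) kap la *: Wc (e' la) (m' la) t'.2 psi)
  = Y *m V g^-1%g - (rowF (fun v => fmon t l (vact v (up_mx (tau u)))) - \sum_(psi : fT) (\prod_i fr u i ^+ psi i) *: w psi)
    + \sum_(la : fT | [forall i, la i <= td t' i]%N) kap la *: Q la.
  rewrite /Y mulmxBl rowF_act mulmx_suml.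
  under eq_bigr do rewrite scalerBr; rewrite sumrB.
  under [X in _ - X]eq_bigr do rewrite scaler_sumr.
  rewrite [X in _ - X]exchange_big /=.
  under [X in _ = _ + X]eq_bigr do rewrite /Q scalerBr; rewrite sumrB.
  have -> : \sum_(la : fT | [forall i, la i <= td t' i]%N) kap la *: rowF (fmon t' (fun i => la i)) *m V g^-1%g =
    \sum_(la : fT | [forall i, la i <= td t' i]%N) kap la *: rowF (fun v => fmon t' (fun i => la i) (vact v (up_mx (tau u)))).
    by apply: eq_bigr => la _; rewrite -scalemxAl rowF_act.
  have -> : \sum_(la : fT | [forall i, la i <= td t' i]%N) \sum_(psi : fT) (\prod_i fr u i ^+ psi i) *: (kap la *: Wc (e' la) (m' la) t'.2 psi) =
     \sum_(la : fT | [forall i, la i <= td t' i]%N) kap la *: \sum_(psi : fT) (\prod_i fr u i ^+ psi i) *: Wc (e' la) (m' la) t'.2 psi.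
    by apply: eq_bigr => la _; rewrite scaler_sumr; apply: eq_bigr => psi _; rewrite scalerA [RHS]scalerA; congr (_ *: _); apply: mulrC.
  have aux (a1 b1 x1 s1 : 'rV[E]_N0) : a1 - b1 = x1 - s1 - (x1 - a1) + (s1 - b1).
    by rewrite opprB [x1 - s1 + _]addrC !subrKA.
  exact: aux.
rewrite addmx_sub //; last by rewrite summx_sub // => la hla; rewrite scalemx_sub // QZ.
by rewrite addmx_sub // eqmx_opp (submx_trans (hw u)).
Qed.

Lemma sdn_not_tle x : x \in sdn t' -> ~~ tle t' x.
Proof. by move=> /sdn_avd; rewrite in_set => /andP[]. Qed.

Lemma step_finish (X : 'rV[E]_N0) m : (X <= Z)%MS -> (X <= WW t')%MS ->
  (forall i, m i < p)%N -> (forall i, i \in t'.1 -> sd t' i <= m i)%N ->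
  (forall i, i \in t'.1 -> ~ (m =1 ad t')) ->
  (X *m Lcol (num p m) t'.2) 0 0 != 0 ->
  ~~ (NN (dn t') :&: Z <= NN (sdn t'))%MS.
Proof.
move=> XZ XW mp sm nem XL; apply/negP=> h; case/eqP: XL.
have t'dn : t' \in dn t' by rewrite in_set t'T tle_refl.
have hX : (X <= NN (sdn t'))%MS.
  apply: submx_trans h; rewrite sub_capmx XZ andbT.
  by apply: submx_trans XW _; apply: WW_NN.
have [z ->] := submxP hX.
by rewrite -mulmxA (NN_Lcol0 iota p_pr card_k chk tauK tauM pi2 redpi kerred annpi rd_gen sdn_not_tle mp sm nem) mulmx0 mxE.
Qed.

Lemma num_le_top m : (forall i, m i < p)%N -> (num p m <= q.-1)%N.
Proof. by move=> mp; rewrite -ltnS prednK ?expn_gt0 ?prime_gt0 // num_lt. Qed.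

Lemma em' (la : fT) : [forall i, la i <= td t' i]%N -> forall i, (e' la i + m' la i = nd t' i)%N.
Proof. by move=> /forallP h i; rewrite /e' /m'; have := st_le rd_gen t' i; have := h i; clear; lia. Qed.

Lemma mp' (la : fT) : [forall i, la i <= td t' i]%N -> forall i, (m' la i < p)%N.
Proof.
by move=> /forallP h i; apply: leq_ltn_trans (st_lt rd_gen t' i); rewrite leq_add2l.
Qed.

Lemma ordS_eq (i j : 'I_f) : (ord_pred i == j) = (i == ordS j).
Proof. by rewrite (can2_eq (@ord_predK f) (@ordSK f)). Qed.

Lemma step_J j : j \in t.1 -> t' = tJ t j -> ~~ (NN (dn t') :&: Z <= NN (sdn t'))%MS.
Proof.
(* When j leaves J, [sd] at j + 1 grows from [ad] to [ad + 1] if j + 1 is in J; [l] makes up for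
   this. For f = 1 it serves instead to lift m_j above the degree of t'. *)
move=> jJ et'; pose l i := ((i == ordS j) && (ordS j \in t.1) : nat).
have J' i : (i \in t'.1) = (i != j) && (i \in t.1) by rewrite et' !inE.
have I' : t'.2 = t.2 by rewrite et'.
have ad' i : ad t' i = ad t i by rewrite /ad I'.
have hl i : (l i <= td t i)%N.
  rewrite /l; have [->|//] := eqVneq i (ordS j); have [sJ|//] := boolP (ordS j \in t.1).
  by have [_ _ _ _] := nd_in rd_gen sJ.
pose m i := (sd t i + l i)%N; pose e i := (nd t i - sd t i - l i)%N.
have mp i : (m i < p)%N by apply: leq_ltn_trans (st_lt rd_gen t i); rewrite leq_add2l.
have em i : (e i + m i = nd t i)%N.
  by rewrite /e /m; have := st_le rd_gen t i; have := hl i; clear; lia.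
have hw u : (rowF (fun v => fmon t l (vact v (up_mx (tau u)))) -
     \sum_(psi : fT) (\prod_i fr u i ^+ psi i) *: Wc e m t.2 psi <= NN (avd t t'))%MS.
  apply: U_mod => // D sD D0; rewrite in_set tD_sdn //=; apply/negP=> /andP[].
  rewrite I' /= => /subsetP h _; case/set0Pn: D0 => i iD.
  by have := h i (subsetP sD i iD); rewrite !inE iD.
have [kap hk] := step_core hl hw.
(* The coefficient of u_j^(m_j): the lower terms of theta' have too small a
   degree at j to contribute. *)
pose psi : fT := [ffun i => if i == j then Ordinal (mp j) else Ordinal (prime_gt0 p_pr)].
have psiE i : psi i = (if i == j then m j else 0%N) :> nat by rewrite ffunE; case: eqP.
pose ms i := (m i - psi i)%N.
have mj : (ad t j + (ord_pred j \notin t'.1) <= m j)%N.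
  rewrite /m /l /sd jJ /= J' negb_and negbK ordS_eq.
  have [e1|ne] := eqVneq j (ordS j); first by rewrite {2 4}e1 -e1 jJ /=; case: (_ \in _); clear; lia.
  by case: (ord_pred j \in t.1) => /=; clear; lia.
have mj' : (nd t' j < m j)%N.
  rewrite /nd ad' (J' j) eqxx /= muln0 addn0; have [_ _ _ h _] := nd_in rd_gen jJ; move: mj h.
  by case: (ord_pred j \in t'.1) => /=; clear; lia.
have zero (la : fT) : [forall i, la i <= td t' i]%N -> Wc (e' la) (m' la) t'.2 psi = 0.
  move=> hla; rewrite /Wc (bigD1 j) //= bin_small ?mul0n ?scale0r // psiE eqxx.
  by apply: leq_ltn_trans mj'; rewrite -(em' hla j) leq_addl.
have XZ : (rowF (mon (fun i => e i + psi i)%N ms t.2) <= Z)%MS.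
  have := hk psi; rewrite big1 ?subr0 => [|la hla]; last by rewrite zero // scaler0.
  rewrite /Wc big1 ?scale1r // => i _; rewrite psiE; case: eqP => [->|_]; first by rewrite binn.
  by rewrite bin0.
have ndj : (p <= nd t j)%N.
  by have [-> _] := nd_in rd_gen jJ; have [_ _] := nd_in rd_gen jJ; move: (prime_gt0 p_pr); clear; lia.
apply: (step_finish (X := rowF (mon (fun i => e i + psi i)%N ms t.2)) (m := ms)) => //.
- rewrite et'; apply: (mon_carry_WW iota red tau pi p_pr card_k chk rd_gen jJ) => [i|].
    by rewrite -em /ms psiE; case: eqP => [->|_]; clear; lia.
  by rewrite psiE eqxx em ndj.
- by move=> i; apply: leq_ltn_trans (mp i); apply: leq_subr.
- move=> i; rewrite J' => /andP[nij iJ]; rewrite /ms psiE (negPf nij) subn0 /m /sd J' nij iJ /=.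
  rewrite J' ad' ordS_eq /l; have [e1|ne] /= := eqVneq i (ordS j).
    by rewrite e1 ordSK jJ -e1 iJ /=; clear; lia.
  by case: (ord_pred i \in t.1) => /=; clear; lia.
- move=> i _ e1; have := e1 j; rewrite /ms psiE eqxx subnn ad'.
  by have [_ _ _ h _] := nd_in rd_gen jJ; move: h; clear; lia.
rewrite I' (Lcol_neq0 iota p_pr card_k chk tauK tauM pi2 redpi kerred annpi rd_gen) ?oner_eq0 //.
by apply: num_le_top => i; apply: leq_ltn_trans (mp i); apply: leq_subr.
Qed.

(** M = 0 has to be excluded because of M' = Q. *)
Lemma dvdn_top (M M' Q : nat) : (M <= Q)%N -> (M' <= Q)%N -> M != M' -> M != 0%N ->
  ~~ ((0 < Q - M + M') && (Q %| Q - M + M'))%N.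
Proof.
move=> le le' ne n0; apply/negP=> /andP[pos /dvdnP[c ec]].
have : c = 1%N by move: ec pos le le' n0; clear; case: c => [|[|c]] //=; nia.
by move=> e1; move: ec ne le; rewrite e1; clear; lia.
Qed.

Lemma step_I i : i \in t.2 -> t' = tD t [set i] -> ~~ (NN (dn t') :&: Z <= NN (sdn t'))%MS.
Proof.
(* When i leaves I and i - 1 enters J, [sd] at i in J grows from r_i - 1 to r_i; [l] makes up for
   this. *)
move=> iI et'; pose l i' := ((i' == i) && (i \in t.1) : nat).
have p6 := p_ge6 p_pr card_k chk rd_gen; have p1 : (1 < p)%N by apply: leq_trans p6.
have npJ : ord_pred i \notin t.1 by have /ThetaSP h := tT; apply: h.
have J' x : (x \in t'.1) = (x \in t.1) || (x == ord_pred i).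
  by rewrite et' !inE in_shift inE (can2_eq (@ordSK f) (@ord_predK f)).
have I' : t'.2 = t.2 :\ i by rewrite et'.
have hl x : (l x <= td t x)%N.
  rewrite /l; have [->|//] := eqVneq x i; have [sJ|//] := boolP (i \in t.1).
  by have [_ _ _ _] := nd_in rd_gen sJ.
pose m x := (sd t x + l x)%N; pose e x := (nd t x - sd t x - l x)%N.
have mp x : (m x < p)%N by apply: leq_ltn_trans (st_lt rd_gen t x); rewrite leq_add2l.
have em x : (e x + m x = nd t x)%N.
  by rewrite /e /m; have := st_le rd_gen t x; have := hl x; clear; lia.
have m0 : m (ord_pred i) = 0%N.
  rewrite /m /l; have [-> _ _ _ _] := nd_out rd_gen npJ.
  (* The case f = 1, where i - 1 is i. *)
  case: eqP => [e1|//]; have nJ : i \notin t.1 by rewrite -e1.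
  by rewrite (negPf nJ).
have hw u : (rowF (fun v => fmon t l (vact v (up_mx (tau u)))) -
     \sum_(psi : fT) (\prod_i fr u i ^+ psi i) *: (Wc e m t.2 psi + W2 e m i t.2 psi) <= NN (avd t t'))%MS.
  rewrite (rowF_ext (act_expand p iota red tau pi (mon0 e m) t.2 (up_mx (tau u)))) rowF_sum.
  have s1 : [set i] != set0 :> {set 'I_f} by apply/set0Pn; exists i; rewrite inE.
  rewrite (bigD1 set0) //= (bigD1 [set i]) //= Tm_U0 // Tm_U1 //.
  under [X in _ - X]eq_bigr do rewrite scalerDr.
  rewrite big_split /=.
  have aux (a1 b1 x1 : 'rV[E]_N0) : a1 + (b1 + x1) - (a1 + b1) = x1 by rewrite addrA [_ + x1]addrC addrK.
  rewrite aux summx_sub // => D /andP[D0 D1].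
  have [sD|nD] := boolP (D \subset t.2); last first.
    by rewrite (rowF_ext (Tm0 p iota red tau pi _ _ nD)) rowF0 sub0mx.
  have hF : mhom (nd t) (mon0 e m) by apply: hom_mon0.
  apply: submx_trans (Tm_WW p_pr card_k chk tauK tauM pi2 redpi kerred annpi p_pi rd_gen _ tT sD hF) _.
  apply: WW_NN; rewrite in_set tD_sdn //=; apply/negP=> /andP[].
  rewrite I' /= => /subsetP h _; have sDi : D \subset [set i].
    apply/subsetP=> x xD; rewrite inE; apply: contraT => nx.
    by have := h x; rewrite !inE nx (subsetP sD) // xD => /(_ isT).
  by move: sDi; rewrite subset1 (negPf D1) (negPf D0).
have [kap hk] := step_core hl hw.
(* The coefficient of u_(i-1), to which D_i contributes through its carry. *)
pose psi : fT := [ffun x => if x == ord_pred i then Ordinal p1 else Ordinal (prime_gt0 p_pr)].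
have psiE x : psi x = (x == ord_pred i) :> nat by rewrite ffunE; case: eqP.
pose ms := m2 m i psi.
have msE x : ms x = if x == ord_pred i then p.-1 else m x.
  by rewrite /ms /m2 psiE; case: eqP => _; rewrite ?subn1 ?subn0.
have msp x : (ms x < p)%N by rewrite msE; case: eqP => // _; rewrite prednK // ltnW.
have Wc0 : Wc e m t.2 psi = 0.
  by rewrite /Wc (bigD1 (ord_pred i)) //= m0 psiE eqxx bin0n mul0n scale0r.
have W2E : W2 e m i t.2 psi = - fr ub i *: rowF (mon (fun x => e x + psi x + eps i x)%N ms t'.2).
  rewrite /W2 -I' big1 ?mulr1 // => x _; rewrite /c2 psiE; case: eqP => _ /=.
    by rewrite bin1 divnn ltnW.
  by rewrite bin0.
have num_ms : num p ms != 0%N.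
  rewrite num_eq0 //; apply/forallPn; exists (ord_pred i); rewrite msE eqxx.
  by move: (p1); clear; lia.
apply: (step_finish (X := Wc e m t.2 psi + W2 e m i t.2 psi -
   \sum_(la : fT | [forall i, la i <= td t' i]%N) kap la *: Wc (e' la) (m' la) t'.2 psi) (m := ms)) => //.
- rewrite Wc0 add0r W2E addmx_sub // ?eqmx_opp ?scalemx_sub //.
    apply: mon_WW => // x; rewrite {1}et' (nd_tD rd_gen) ?sub1set // -em msE psiE /eps !inE.
    rewrite (can2_eq (@ordSK f) (@ord_predK f)); case: (x =P ord_pred i) => [->|_] /=.
      by rewrite m0; move: (p1); clear; case: (_ == _) => /=; lia.
    by clear; case: (_ == _) => /=; lia.
  by rewrite summx_sub // => la hla; rewrite scalemx_sub // Wc_WW //; apply: em'.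
- move=> x; rewrite J' msE; have [->|nx] := eqVneq x (ord_pred i).
    by move=> _; have := st_lt rd_gen t' (ord_pred i); move: (p1); clear; lia.
  rewrite orbF => xJ; rewrite /m /l.
  have ->: sd t' x = if ord_pred x \in t'.1 then ad t' x else (ad t' x).+1 by rewrite /sd J' xJ.
  rewrite /sd xJ /= J'; case: (eqVneq x i) xJ => [->|nxi] xJ /=.
    rewrite eqxx orbT (negPf npJ) xJ /ad I' !inE eqxx iI /=.
    by have := rd_gen i; clear; lia.
  have -> : ad t' x = ad t x by rewrite /ad I' !inE nxi.
  by case: (ord_pred x \in t.1); case: (ord_pred x == ord_pred i) => /=; clear; lia.
- move=> x _ e1; have := e1 (ord_pred i); rewrite msE eqxx /ad.
  by have := rd_gen (ord_pred i); move: (p6); clear; lia.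
rewrite Wc0 add0r W2E mulmxBl mulmx_suml mxE -scalemxAl mxE.
rewrite (Lcol_neq0 iota p_pr card_k chk tauK tauM pi2 redpi kerred annpi rd_gen); last exact: num_le_top.
rewrite [X in _ + X]mxE summxE big1 ?subr0 ?mulr1 => [|la hla].
  by rewrite oppr_eq0 fr_eq0.
rewrite -scalemxAl mxE /Wc -scalemxAl [X in _ * X]mxE.
(* The extraction lowers the d-exponent of a correction term at i - 1 by one, to at most p - 2,
   while the functional asks for p - 1; if that exponent was 0, the term has coefficient 0. *)
have [e0|n0] := eqVneq (m' la (ord_pred i)) 0%N.
  by rewrite (bigD1 (ord_pred i)) //= e0 psiE eqxx bin0n mul0n mul0r mulr0.
have lp x : (m' la x - psi x < p)%N by apply: leq_ltn_trans (leq_subr _ _) (mp' hla x).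
rewrite (Lcol_eq0 iota p_pr card_k tauK tauM pi2 redpi kerred annpi) ?mulr0 //.
apply: dvdn_top => //; [exact: num_le_top | exact: num_le_top | ].
apply/eqP=> /(num_inj p1 msp lp)/(_ (ord_pred i)); rewrite msE psiE eqxx.
by have := mp' hla (ord_pred i); move: n0; clear; lia.
Qed.

Lemma step_cover : ~~ (NN (dn t') :&: Z <= NN (sdn t'))%MS.
Proof.
have [t'T' t't2 nt'] := sdown_in t't.
have [[j jJ h]|[i iI h]] := tle_cover t'T' t't2 nt'.
  apply: (step_J jJ); apply/eqP; apply: contraT => ne.
  have := tle_rk h ne; have := tJ_rk jJ; rewrite rk' => -[->].
  by rewrite ltnn.
apply: (step_I iI); apply/eqP; apply: contraT => ne.
have := tle_rk h ne; have := tD1_rk tT iI; rewrite rk' => -[->].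
by rewrite ltnn.
Qed.

End Step.

End Strata.

Lemma num_digits p f a : (a < p ^ f)%N -> (\sum_(i < f) (a %/ p ^ i %% p) * p ^ i = a)%N.
Proof.
elim: f a => [|f IHf] a lt.
  by rewrite big_ord0; move: lt; rewrite expn0 ltnS leqn0 => /eqP.
have [p0|p0] := posnP p; first by move: lt; rewrite p0 exp0n.
rewrite big_ord_recl expn0 divn1 muln1 [RHS](divn_eq a p) [RHS]addnC; congr (_ + _)%N.
rewrite -[in RHS](IHf (a %/ p)%N) ?ltn_divLR -?expnSr // big_distrl /=.
by apply: eq_bigr => i _; rewrite /bump /= add1n -divnMA -expnS -mulnA -expnSr.
Qed.

Lemma modeled_ext p f (k : finFieldType) (E : fieldType) (iota : {rmorphism k -> E})
    (t t' : 'I_f -> nat) P s e :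
  t =1 t' -> modeled p iota t P s e -> modeled p iota t' P s e.
Proof.
move=> tt' [ix [inj bd onto co]]; exists ix; split=> //.
- by move=> j i; rewrite -tt'; apply: bd.
- by move=> phi h; apply: onto => i; rewrite tt'.
- by move=> g j' j; rewrite co; congr (_ * _); apply: eq_bigr => i _; rewrite tt'.
Qed.

(** * The generators and the main theorem *)

Section Weights.

Variables (p f : nat) (k : finFieldType) (E : fieldType) (iota : {rmorphism k -> E}).
Hypotheses (p_pr : prime p) (card_k : #|k| = (p ^ f)%N) (chk : p \in [pchar k]).
Variable r : 'Z_(p ^ f).-1.
Hypothesis r_gen : generic r.
Local Notation TT := ({set 'I_f} * {set 'I_f})%type.
Local Notation q := (p ^ f)%N.
Local Notation rd := (digit r).
Implicit Types t : TT.

Lemma q1_gt1 : (1 < q.-1)%N.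
Proof.
have p6 := p_ge6 p_pr card_k chk r_gen; have f0 := f_gt0 card_k.
have : (p ^ 1 <= p ^ f)%N by rewrite leq_exp2l // (leq_trans _ p6).
by move: p6; rewrite expn1; move: (p ^ f)%N; clear; lia.
Qed.

Lemma zrep_le (a : 'Z_q.-1) : (zrep a <= q.-1)%N.
Proof.
rewrite /zrep; case: eqP => // _; have := ltn_ord a.
by rewrite [X in (_ < X)%N]Zp_cast ?q1_gt1 // => /ltnW.
Qed.

Lemma zrepE (a : 'Z_q.-1) : zrep a = num p (digit a).
Proof.
rewrite /num /digit num_digits // (leq_ltn_trans (zrep_le a)) // prednK //.
by rewrite expn_gt0 prime_gt0.
Qed.

Lemma zrep_nat n : (0 < n)%N -> (n < q.-1)%N -> zrep (n%:R : 'Z_q.-1) = n.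
Proof.
move=> n0 ltn; have e := val_Zp_nat q1_gt1 n; rewrite modn_small // in e.
by rewrite /zrep -val_eqE /= e eqn0Ngt n0.
Qed.

Lemma natr_zrep (a : 'Z_q.-1) : (zrep a)%:R = a.
Proof.
rewrite /zrep; case: eqP => [->|_]; last by rewrite natr_Zp.
by apply/val_inj; rewrite /= val_Zp_nat ?q1_gt1 // modnn.
Qed.

(** By genericity the subtraction of 2 p^I from r needs no borrowing. *)
Lemma num_ad t : (num p (ad rd t) + 2 * ppow p t.2 = num p rd)%N.
Proof.
rewrite ppow_num /num big_distrr -big_split; apply: eq_bigr => i _ /=.
rewrite mulnA -mulnDl /ad; congr (_ * _)%N.
by have := r_gen i; case: (i \in t.2); clear; lia.
Qed.

Lemma ad_ltp t i : (ad rd t i < p)%N.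
Proof. exact: (ad_lt r_gen t i). Qed.

Lemma ad_gt0 t i : (0 < ad rd t i)%N.
Proof. by rewrite /ad; have := r_gen i; case: (i \in t.2); clear; lia. Qed.

Lemma num_ad_gt0 t : (0 < num p (ad rd t))%N.
Proof.
rewrite lt0n num_eq0 ?prime_gt1 //; apply/forallPn; exists (Ordinal (f_gt0 card_k)).
by rewrite -lt0n ad_gt0.
Qed.

Lemma num_ad_lt t : (num p (ad rd t) < q.-1)%N.
Proof.
have p1 := prime_gt1 p_pr; rewrite ltn_neqAle; apply/andP; split; last first.
  by rewrite -ltnS prednK ?expn_gt0 ?(ltnW p1) // num_lt //; apply: ad_ltp.
apply/negP=> /eqP /(num_eq_top p1 (ad_ltp t))/(_ (Ordinal (f_gt0 card_k))).
by rewrite /ad; have := r_gen (Ordinal (f_gt0 card_k)); move: (p1) (rd _) (_ \in _); clear; lia.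
Qed.

Lemma theta_wtE t : theta_wt r t = (num p (ad rd t))%:R.
Proof. by rewrite /theta_wt -{1}[r]natr_zrep zrepE -(num_ad t) natrD addrK. Qed.

Lemma digit_theta_wt t i : digit (theta_wt r t) i = ad rd t i.
Proof.
rewrite /digit theta_wtE zrep_nat ?num_ad_gt0 ?num_ad_lt //.
by rewrite numE ?prime_gt1 //; apply: ad_ltp.
Qed.

Lemma s_exp_theta t : s_exp t.1 (theta_wt r t) = num p (sd rd t).
Proof. by apply: eq_bigr => i _; rewrite /s_digit digit_theta_wt. Qed.

Lemma t_digit_theta t i : t_digit t.1 (theta_wt r t) i = td p rd t i.
Proof. by rewrite /t_digit digit_theta_wt. Qed.

Lemma sigma_theta_modeled t :
  modeled p iota (td p rd t) (sigma_theta iota p_pr card_k r t) (enum 'I_f)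
    (num p (sd rd t) + ppow p t.2).
Proof.
apply: (modeled_ext (t_digit_theta t)).
have -> : (num p (sd rd t) + ppow p t.2 = ppow p t.2 + (s_exp t.1 (theta_wt r t) + 0))%N.
  by rewrite addn0 s_exp_theta addnC.
apply: modeled_det; apply: modeled_det; apply: modeled_foldr; last exact: enum_uniq.
by move=> i; rewrite t_digit_theta; apply: leq_ltn_trans (leq_addl _ _) (st_lt r_gen t i).
Qed.

End Weights.

Section Structure.

Variables (p f : nat) (k : finFieldType) (E : fieldType) (iota : {rmorphism k -> E}).
Variables (A : finComUnitRingType).
Variables (red : {rmorphism A -> k}) (tau : k -> A) (pi : A) (ub : k).
Hypotheses (p_pr : prime p) (card_k : #|k| = (p ^ f)%N) (chk : p \in [pchar k]).
Hypotheses (tauK : cancel tau red) (tauM : {morph tau : x y / x * y}).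
Hypotheses (pi2 : pi * pi = 0) (redpi : red pi = 0).
Hypothesis kerred : forall a, red a = 0 -> exists b, a = pi * b.
Hypothesis annpi : forall a, pi * a = 0 -> red a = 0.
Hypothesis p_pi : p%:R = pi * tau ub.
Variable r : 'Z_(p ^ f).-1.
Hypothesis r_gen : generic r.
Hypotheses (p_odd : odd p) (ub0 : ub != 0).
Local Notation rd := (digit r).

Local Notation TT := ({set 'I_f} * {set 'I_f})%type.
Local Notation fn := (A * A -> E).
Local Notation sd := (sd rd).
Local Notation td := (td p rd).
Local Notation V := (regular_repr E 'GL_2[A]).
Local Notation N0 := (gcard 'GL_2[A]).
Local Notation rowF := (@rowF E A).
Local Notation NN := (NN p iota red tau pi rd).
Local Notation sdn := (sdown (ThetaS f) (@tle f)).
Local Notation dn := (down (ThetaS f) (@tle f)).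
Local Notation dcl := (dclosed (ThetaS f) (@tle f)).
Local Notation fr := (fr p iota).
Local Notation cx := (cx p iota red).
Local Notation dx := (dx p iota red).
Local Notation DD := (DD p iota red tau pi).
Local Notation mon0 := (mon0 p iota red).
Local Notation nd := (nd p rd).
Local Notation ad := (ad rd).
Local Notation mon := (mon p iota red tau pi).
Local Notation Dp := (Dp p iota red tau pi).
Implicit Types (F : fn) (I J D : {set 'I_f}) (t : TT).

Local Notation co := (co red tau pi).
Local Notation fmon := (fmon p iota red tau pi rd).

Lemma coN a : co (- a) = - co a.
Proof.
have t1 : tau (-1) = -1 by rewrite (tauN p_pr p_odd chk tauK tauM pi2 kerred) (tau1 tauK tauM pi2 kerred).
have c1 : co (-1) = 0 by rewrite -t1 (co_tau tauK pi2 redpi kerred annpi).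
rewrite -mulN1r (coM tauK tauM pi2 redpi kerred annpi) c1 mul0r add0r rmorphN1 mulN1r.
by [].
Qed.

(** The p at an index of J is one factor at the next index, where [nd] has given it up. *)
Lemma prod_nd t (x : k) : \prod_i fr x i ^+ nd t i = \prod_i fr x i ^+ ad t i.
Proof.
have h i : fr x i ^+ nd t i = fr x i ^+ (ad t i - (ord_pred i \in t.1)) * fr x (ordS i) ^+ (i \in t.1).
  by rewrite /nd exprD exprM -fr_ordS.
rewrite (eq_bigr _ (fun i _ => h i)) big_split /=.
rewrite [X in _ * X](reindex_inj (can_inj (@ord_predK f))) /= -big_split; apply: eq_bigr => i _ /=.
rewrite ord_predK -exprD subnK //; apply: leq_trans (ad_gt0 r_gen t i).
by case: (_ \in _).
Qed.

(** A positive power of some c_i makes the monomial vanish where c is not a unit, as [f_elt]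
    does. *)
Lemma nd_sd_pos t : exists i, (0 < nd t i - sd t i)%N.
Proof.
have p6 := p_ge6 p_pr card_k chk r_gen.
have hJ i : i \in t.1 -> (0 < nd t i - sd t i)%N.
  by move=> iJ; have [-> _ _ _ _] := nd_in r_gen iJ; move: p6; clear; lia.
pose i0 := Ordinal (f_gt0 card_k).
have [iJ|niJ] := boolP (i0 \in t.1); first by exists i0; apply: hJ.
have [jJ|njJ] := boolP (ord_pred i0 \in t.1); first by exists (ord_pred i0); apply: hJ.
exists i0; rewrite /nd /sd niJ (negPf niJ) (negPf njJ) /= muln0 addn0 !subn0.
exact: (ad_gt0 r_gen).
Qed.

Lemma lambda_B2 (h : {'GL_2[A]}) l :
  ((h * lambda_GL l)%g \in B2 A) = ((h : 'M_2) 1 0 * l + (h : 'M_2) 1 1 == 0).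
Proof. by rewrite inE GL_MxE mulmx22 !mxE /= mulr1. Qed.

Lemma chi_lambda (h : {'GL_2[A]}) l :
  chi iota red r (h * lambda_GL l)%g = iota (red ((h : 'M_2) 1 0)) ^+ zrep r.
Proof. by rewrite /chi GL_MxE mulmx22 !mxE /= mulr1 mulr0 addr0 rmorphXn. Qed.

(** The hypotheses hold for the coordinates l1, l2 of -d / c. The monomial contributes the power r -
    2 p^I of c and each D_i a square, which gives r in total; every d and every D_i gives a sign. *)
Lemma fmon0E t v l1 l2 : red v.2 = - (red v.1 * l1) -> detv red tau pi v = - (red v.1 ^+ 2 * l2) ->
  fmon t (fun _ => 0%N) v = (-1) ^+ (\sum_i sd t i + #|t.2|) *
    (iota (red v.1) ^+ zrep r * iota (l1 ^+ num p (sd t) * l2 ^+ ppow p t.2)).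
Proof.
move=> ed eD; rewrite /fmon /mon /mon0 /Dp.
have fN x i : fr (- x) i = - fr x i by apply: frN.
have e1 : \prod_i (cx v i ^+ (nd t i - sd t i - 0) * dx v i ^+ (sd t i + 0)) =
   (-1) ^+ (\sum_i sd t i) * ((\prod_i fr (red v.1) i ^+ ad t i) * \prod_i fr l1 i ^+ sd t i).
  rewrite -prod_nd -prodrXr -!big_split; apply: eq_bigr => i _ /=.
  rewrite subn0 addn0 /dx ed fN frM [(- (fr _ _ * _)) ^+ _]exprNn exprMn /cx.
  have -> : nd t i = (nd t i - sd t i + sd t i)%N.
    by rewrite subnK // (leq_trans (leq_addr _ _) (st_le r_gen t i)).
  by rewrite addnK exprD; ring.
have e2 : \prod_(i in t.2) DD v i = (-1) ^+ #|t.2| *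
   ((\prod_i fr (red v.1) i ^+ (2 * (i \in t.2))%N) * \prod_(i in t.2) fr l2 i).
  rewrite -prodr_const (bigID (mem t.2) xpredT) /= [X in _ * (_ * X * _)]big1 => [|i /negPf->]; last by rewrite muln0.
  rewrite mulr1 -!big_split; apply: eq_bigr => i /= ->.
  by rewrite /DD eD fN frM // muln1 frX //; ring.
rewrite e1 e2 exprD rmorphM !rmorphXn -!prod_fr (zrepE p_pr card_k chk r_gen).
have -> : iota l2 ^+ ppow p t.2 = \prod_(i in t.2) fr l2 i.
  by rewrite /ppow -prodrXr.
rewrite -(num_ad r_gen t).
have -> : iota (red v.1) ^+ (num p (ad t) + 2 * ppow p t.2) =
   (\prod_i fr (red v.1) i ^+ ad t i) * \prod_i fr (red v.1) i ^+ (2 * (i \in t.2))%N.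
  rewrite exprD -prod_fr ppow_num; congr (_ * _).
  rewrite prod_fr /num big_distrr; congr (_ ^+ _); by apply: eq_bigr => i _; apply: mulnA.
by ring.
Qed.

(** The only lambda with [h * lambda_GL lambda] in [B2] is -d / c. If c is not a unit there is none,
    and both sides are 0. *)
Lemma f_eltE t (h : {'GL_2[A]}) :
  fmon t (fun _ => 0%N) ((h : 'M_2) 1 0, (h : 'M_2) 1 1) =
  (-1) ^+ (\sum_i sd t i + #|t.2|) *
    f_elt iota red tau pi r (s_exp t.1 (theta_wt r t)) (ppow p t.2) h.
Proof.
rewrite /f_elt (s_exp_theta p_pr card_k chk r_gen).
set c := (h : 'M_2) 1 0; set d := (h : 'M_2) 1 1.
have [c0|c0] := eqVneq (red c) 0.
  have [i hi] := nd_sd_pos t.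
  rewrite /fmon /mon /mon0 (bigD1 i) //= /cx c0 (fr0 iota p_pr) subn0 expr0n eqn0Ngt hi !mul0r.
  rewrite [X in _ = _ * X]big1 ?mulr0 // => l _; rewrite /ind_tensor lambda_B2 -/c -/d; case: eqP => // e.
  have d0 : red d = 0 by move: (congr1 red e); rewrite rmorphD rmorphM c0 mul0r add0r rmorph0.
  have := GL_unitmx h; rewrite unitmxE (unit_red tauK pi2 kerred) det22 rmorphB !rmorphM.
  by rewrite c0 d0 !mulr0 subrr eqxx.
have cu : c \is a GRing.unit by rewrite (unit_red tauK pi2 kerred).
pose lam := - (c^-1 * d); pose l1 := red lam; pose l2 := co lam.
have elam : c * lam + d = 0 by rewrite /lam mulrN mulrA divrr // mul1r addNr.
have ed : d = - (c * lam) by rewrite /lam mulrN mulrA divrr // mul1r opprK.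
have ered : red (c, d).2 = - (red (c, d).1 * l1) by rewrite /= ed rmorphN rmorphM.
have edet : detv red tau pi (c, d) = - (red (c, d).1 ^+ 2 * l2).
  rewrite /detv /= ed coN (coM tauK tauM pi2 redpi kerred annpi) -/l1 -/l2.
  have -> : red (- (c * lam)) = - (red c * l1) by rewrite rmorphN (rmorphM red).
  by ring.
rewrite (fmon0E _ ered edet); congr (_ * _).
rewrite (bigD1 (l1, l2)) //= big1 ?addr0 => [|[x y] ne] /=; last first.
  rewrite /ind_tensor lambda_B2 -/c -/d; case: eqP => // e.
  have e2 : tau x + tau y * pi = lam.
    by apply: (mulrI cu); apply: (addIr d); rewrite elam.
  case/eqP: ne; rewrite /l1 /l2 -e2 mulrC.
  by rewrite (red_tp tauK redpi) (co_tp tauK pi2 redpi kerred annpi) tauK.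
rewrite /ind_tensor lambda_B2 -/c -/d chi_lambda.
by rewrite [tau l2 * pi]mulrC /l1 /l2 -(coE tauK pi2 kerred) elam eqxx.
Qed.

Lemma f_elt_row t : rowF (fmon t (fun _ => 0%N)) = (-1) ^+ (\sum_i sd t i + #|t.2|) *:
  fun_row 'GL_2[A] (f_elt iota red tau pi r (s_exp t.1 (theta_wt r t)) (ppow p t.2)).
Proof. by apply/rowP=> i; rewrite !mxE f_eltE. Qed.

Local Notation sg := (sigma_mod iota p_pr card_k red r).
Local Notation M := (M_theta iota red tau pi r).

Lemma sigma_ix t : exists ix : 'I_(rdegree (sigma_theta iota p_pr card_k r t)) -> {ffun 'I_f -> 'I_p},
  [/\ injective ix, forall j i, (ix j i <= td t i)%N,
      forall phi : {ffun 'I_f -> 'I_p}, (forall i, phi i <= td t i)%N -> exists j, ix j = phi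
    & forall g j' j, sigma_theta iota p_pr card_k r t g j' j =
        iota (\det (GLval g) ^+ (num p (sd t) + ppow p t.2)) *
        \prod_i symc (td t i) (twist_mx p iota i g) (ix j' i) (ix j i)].
Proof.
have [ix [inj bd onto co]] := sigma_theta_modeled iota p_pr card_k chk r_gen t.
exists ix; split=> // [j i|phi h|g j' j]; first by case: (bd j i).
  by apply: onto => // i; rewrite mem_enum.
by rewrite co big_enum.
Qed.

Lemma sigma_irr t : mx_irreducible (sg t).
Proof.
have [ix [inj bd onto co]] := sigma_ix t.
apply: (modeled_irr p_pr card_k chk tauK _ inj bd onto co) => i.
by apply: leq_ltn_trans (leq_addl _ _) (st_lt r_gen t i).
Qed.

Lemma sigma_inj t t' : mx_rsim (sg t) (sg t') -> t = t'.
Proof.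
move=> h; apply: (wt_inj p_pr r_gen); apply: (weight_inj p_pr card_k); try exact: (wt_lt p_pr card_k r_gen).
move=> x x0; have m t1 := sigma_theta_modeled iota p_pr card_k chk r_gen t1.
exact: (modeled_weight p_pr card_k chk tauK (unit_red tauK pi2 kerred) (m t) (m t') h).
Qed.

Lemma sigma_strat (S : {set TT}) t : dcl S -> t \in ThetaS f -> t \notin S -> dcl (t |: S) ->
  sec_iso V (NN S) (NN (t |: S)) (sg t).
Proof.
move=> dS tT ntS dtS; have [ix [inj bd onto co]] := sigma_ix t.
exact: (strat_iso p_pr card_k chk tauK tauM pi2 redpi kerred annpi p_pi r_gen tT dS ntS dtS inj bd onto co).
Qed.

Lemma NN_gen (S : {set TT}) (X : 'M[E]_N0) : S \subset ThetaS f ->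
  (forall x, x \in S -> (NN (dn x) <= X)%MS) -> (NN S <= X)%MS.
Proof.
move=> sS h; apply: NN_le => t tS; apply: submx_trans (h t tS); apply: WW_NN.
by rewrite in_set (subsetP sS) // tle_refl.
Qed.

Lemma tle_sdown_cover t x : t \in ThetaS f -> x \in sdn t ->
  exists2 t', t' \in sdn t & trk t = (trk t').+1 /\ tle x t'.
Proof.
move=> tT /sdown_in[xT xt nx]; have [[j jJ h]|[i iI h]] := tle_cover xT xt nx.
  by exists (tJ t j); [apply: tJ_sdown | split=> //; apply: tJ_rk].
exists (tD t [set i]); last by split=> //; apply: tD1_rk.
apply: tD_sdn => //; first by rewrite sub1set.
by apply/set0Pn; exists i; rewrite inE.
Qed.

Let le_rk (x y : TT) : x \in ThetaS f -> y \in ThetaS f -> tle x y -> x != y -> (trk x < trk y)%N.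
Proof. by move=> _ _; apply: tle_rk. Qed.
Let N_mod S := NN_module iota p_pr card_k chk tauK tauM pi2 redpi kerred annpi p_pi r_gen (S := S).
Let s_irr (t : TT) : t \in ThetaS f -> mx_irreducible (sg t) := fun _ => sigma_irr t.
Let s_inj (t t' : TT) : t \in ThetaS f -> t' \in ThetaS f -> mx_rsim (sg t) (sg t') -> t = t' :=
  fun _ _ => @sigma_inj t t'.
Let step (t t' : TT) (Z : 'M[E]_N0) : t \in ThetaS f -> t' \in sdn t -> trk t = (trk t').+1 ->
  mxmodule V Z -> (NN (avoid (ThetaS f) (@tle f) t t') <= Z)%MS -> (NN (dn t) <= Z + NN (sdn t))%MS ->
  ~~ (NN (dn t') :&: Z <= NN (sdn t'))%MS.
Proof.
move=> tT t't rk' mZ s1 s2.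
exact: (step_cover p_pr card_k chk tauK tauM pi2 redpi kerred annpi p_pi r_gen ub0 tT t't rk' mZ s1 s2).
Qed.

Let N_mono := NN_mono p iota red tau pi rd.
Let N_zero := NN_set0 p iota red tau pi rd.
Let S_down := submodule_down (@tle_refl f) (@tle_trans f) le_rk N_zero N_mono NN_gen N_mod
  s_irr s_inj sigma_strat tle_sdown_cover step.
Let S_JH := JH_strat le_rk N_zero N_mono N_mod s_irr s_inj sigma_strat.
Let S_cosocle := cosocle_down (@tle_refl f) (@tle_trans f) le_rk N_zero N_mono NN_gen N_mod
  s_irr s_inj sigma_strat tle_sdown_cover step.
Let S_unique := cosocle_unique (@tle_refl f) (@tle_trans f) le_rk N_zero N_mono NN_gen N_mod
  s_irr s_inj sigma_strat tle_sdown_cover step.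

(** The generator is a top monomial up to sign, hence outside the lower strata, and a submodule
    containing it contains everything by [submodule_down]. *)
Lemma M_down t : t \in ThetaS f -> (M t :=: NN (dn t))%MS.
Proof.
move=> tT; have tdn : t \in dn t by rewrite in_set tT tle_refl.
have erow := f_elt_row t.
set u := fun_row _ _ in erow.
have fW : (rowF (fmon t (fun _ => 0%N)) <= NN (dn t))%MS.
  by apply: submx_trans (WW_NN _ _ _ _ _ _ tdn); apply: fmon_WW.
have eu : u = (-1) ^+ (\sum_i sd t i + #|t.2|) *: rowF (fmon t (fun _ => 0%N)).
  by rewrite erow scalerA -expr2 sqrr_sign scale1r.
have dd : dcl (dn t) := dclosed_down (ThetaS f) (@tle_trans f) t.
apply/eqmxP/andP; split.
  by apply: cyclic_mx_sub; [apply: N_mod | rewrite -/u eu scalemx_sub].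
apply: S_down => //; first exact: cyclic_mx_module.
have ds := dclosed_sdown (@tle_trans f) le_rk tT.
have [ix [inj bd onto co]] := sigma_ix t.
have nt : t \notin sdn t by rewrite in_setD1 eqxx.
have dt : dcl (t |: sdn t) by rewrite setD1K.
apply/negP=> h; have := fmon_notin_all p_pr card_k chk tauK tauM pi2 redpi kerred annpi p_pi r_gen tT
  ds nt dt inj bd onto co erefl (l := fun _ => 0%N) (fun _ => leq0n _).
case/negP; apply: submx_trans h; rewrite sub_capmx fW erow scalemx_sub //.
exact: cyclic_mx_id.
Qed.

Lemma down_top : dn (set0, setT) = ThetaS f.
Proof.
apply/setP=> x; rewrite in_set; case: (boolP (x \in ThetaS f)) => //= /ThetaSP h.
rewrite /tle /= subsetT set0U; apply/subsetP=> i iJ; rewrite in_shift inE inE andbT.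
by apply: contraL iJ => /h; rewrite ordSK.
Qed.

Lemma top_Theta : (set0, setT) \in ThetaS f.
Proof. by rewrite inE set0I. Qed.

Lemma JH_set_eq_eqmx (X Y : 'M[E]_N0) (P Q : TT -> Prop) : (X :=: Y)%MS -> (forall x, P x <-> Q x) ->
  JH_set_eq V X P sg -> JH_set_eq V Y Q sg.
Proof.
have tr (X' Y' : 'M[E]_N0) m (s' : mx_representation E 'GL_2[A] m) :
    (X' :=: Y')%MS -> JH_constituent V X' s' -> JH_constituent V Y' s'.
  by move=> e [U [cU [lU hU]]]; exists U, cU; split=> //; apply: eqmx_trans lU e.
move=> eXY ePQ [h1 h2]; split=> [t /ePQ/h1/(tr _ _ _ _ eXY)//|m s' /(tr _ _ _ _ (eqmx_sym eXY))/h2[t /ePQ Qt rt]].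
by exists t.
Qed.

Lemma multiplicity_free_eqmx (X Y : 'M[E]_N0) : (X :=: Y)%MS -> multiplicity_free V X -> multiplicity_free V Y.
Proof. by move=> e h U cU lU; apply: h; apply: eqmx_trans lU (eqmx_sym e). Qed.

Lemma has_cosocle_eqmx (X Y : 'M[E]_N0) m (s : mx_representation E 'GL_2[A] m) :
  (X :=: Y)%MS -> has_cosocle V X s -> has_cosocle V Y s.
Proof.
move=> e [R [mR [mX [rad rs]]]]; have mY : mxmodule V Y by rewrite -(eqmx_module V e).
exists R, mR, mY; split; last by apply: mx_rsim_trans rs; apply: section_eqmx => //; apply: eqmx_sym.
have em K : max_submod V K X <-> max_submod V K Y.
  by split; apply: max_submod_eqmx => //; apply: eqmx_sym.
move=> W; rewrite (rad W) e; split=> -[sW h]; split=> // K mK /em; exact: h.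
Qed.

Theorem structure_M :
  (multiplicity_free V (M (set0, setT)) /\ JH_set_eq V (M (set0, setT)) (@Theta f) sg) /\
  (forall th : TT, Theta th ->
     [/\ (M th <= M (set0, setT))%MS, has_cosocle V (M th) (sg th),
         (forall N : 'M[E]_N0, mxmodule V N -> (N <= M (set0, setT))%MS ->
            has_cosocle V N (sg th) -> (N :=: M th)%MS)
       & JH_set_eq V (M th) (fun th' => Theta th' /\ Theta_le th' th) sg]).
Proof.
have eT := M_down top_Theta; rewrite down_top in eT.
have dT : dcl (ThetaS f) by split.
have JHT : multiplicity_free V (NN (ThetaS f)) /\ JH_set_eq V (NN (ThetaS f)) (fun x => x \in ThetaS f) sg.
  by apply: S_JH => //; apply/set0Pn; exists (set0, setT); apply: top_Theta.
split; first split.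
- exact: multiplicity_free_eqmx (eqmx_sym eT) JHT.1.
- apply: JH_set_eq_eqmx (eqmx_sym eT) _ JHT.2 => x.
  by split=> /ThetaP.
move=> t /ThetaP tT; have et := M_down tT.
have dd : dcl (dn t) := dclosed_down (ThetaS f) (@tle_trans f) t.
split.
- by rewrite et eT; apply: NN_mono; case: dd.
- exact: has_cosocle_eqmx (eqmx_sym et) (S_cosocle tT).
- move=> N mN; rewrite eT => sN cN; apply: eqmx_trans (eqmx_sym et).
  exact: S_unique dT tT mN sN cN.
- have [|_ JHt] := S_JH dd; first by apply/set0Pn; exists t; rewrite in_set tT tle_refl.
  apply: JH_set_eq_eqmx (eqmx_sym et) _ JHt => x; rewrite in_set.
  by split=> [/andP[/ThetaP h1 /tleP]|[/ThetaP-> /tleP]].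
Qed.

End Structure.

(** * From the local field to the ring of length two *)

Lemma uniformizer_prime (p : nat) (p_pr : prime p)
  (Qp : fieldType) (vp : Qp -> int) (hQp : padic_numbers p vp)
  (F : fieldExtType Qp) (w : F -> int) (hF : unramified_extension vp w)
  (O : idomainType) (inc : {rmorphism O -> F}) (hO : valuation_ring w inc)
  (varpi : O) (varpi_neq0 : varpi != 0) (hvarpi : w (inc varpi) = 1) :
  exists2 y, p%:R = varpi * y & forall z, y <> varpi * z.
Proof.
have [_ natQ _ _] := hQp; have [p0 vpp] := natQ p (prime_gt0 p_pr).
have [[wM _ _] wv] := hF; have [inj_inc inO] := hO.
have inc0 x : (inc x == 0) = (x == 0) by rewrite -(inj_eq inj_inc) rmorph0.
have pF : (p%:R : F) = (p%:R : Qp)%:A by rewrite scaler_nat.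
have pF0 : (p%:R : F) != 0.
  by rewrite pF scaler_eq0 oner_eq0 orbF.
(* Here F is unramified: p keeps the valuation 1. *)
have wp : w p%:R = 1 by rewrite pF wv // vpp logn_prime // eqxx.
have wz : w (p%:R / inc varpi) = 0.
  have := wM (p%:R / inc varpi) (inc varpi); rewrite divfK ?inc0 // wp hvarpi.
  rewrite mulf_eq0 invr_eq0 inc0 (negPf pF0) (negPf varpi_neq0) => /(_ isT isT).
  by rewrite -{1}[1]add0r => /addIr.
have [|y ey] := (inO (p%:R / inc varpi)).1; first by rewrite /v_ge wz lexx orbT.
exists y; first by apply: inj_inc; rewrite rmorphM ey rmorph_nat mulrC divfK ?inc0.
move=> z eyz; have z0 : z != 0.
  apply: contra_neq pF0 => z0; rewrite -[LHS](divfK (x := inc varpi)) ?inc0 // -ey eyz z0.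
  by rewrite mulr0 rmorph0 mul0r.
have : v_ge w (inc z) 0 by apply/inO; exists z.
move: wz; rewrite -ey eyz rmorphM wM ?inc0 // hvarpi /v_ge inc0 (negPf z0) /=.
by move: (w _); lia.
Qed.

Theorem theorem5p12
  (p : nat) (p_pr : prime p) (p_odd : odd p)
  (* F / Q_p finite unramified, with normalized valuation w *)
  (Qp : fieldType) (vp : Qp -> int) (hQp : padic_numbers p vp)
  (F : fieldExtType Qp) (w : F -> int) (hF : unramified_extension vp w)
  (* O = valuation ring, with uniformizer varpi *)
  (O : idomainType) (inc : {rmorphism O -> F}) (hO : valuation_ring w inc)
  (varpi : O) (varpi_neq0 : varpi != 0) (hvarpi : w (inc varpi) = 1)
  (* A = O / m^2, k = O / m, q = p ^ f *)
  (A : finComUnitRingType) (pr : {rmorphism O -> A}) (hA : quotient_by pr (varpi ^+ 2))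
  (f : nat) (k : finFieldType) (card_k : #|k| = (p ^ f)%N)
  (red : {rmorphism A -> k}) (hk : quotient_by (red \o pr) varpi)
  (teich : k -> O) (hteich : teichmuller (red \o pr) teich)
  (E : fieldType) (iota : {rmorphism k -> E})
  (r : 'Z_(p ^ f).-1) (r_gen : generic r) :
  let V := regular_repr E 'GL_2[A] in
  let M := M_theta iota red (pr \o teich) (pr varpi) r in
  let s := sigma_mod iota p_pr card_k red r in
  let M_top := M (set0, setT) in
  (multiplicity_free V M_top /\ JH_set_eq V M_top (@Theta f) s) /\
  (forall th : {set 'I_f} * {set 'I_f}, Theta th ->
     [/\ (M th <= M_top)%MS,
         has_cosocle V (M th) (s th),
         (forall N : 'M[E]_(gcard 'GL_2[A]), mxmodule V N -> (N <= M_top)%MS ->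
            has_cosocle V N (s th) -> (N :=: M th)%MS)
       & JH_set_eq V (M th) (fun th' => Theta th' /\ Theta_le th' th) s]).
Proof.
have [y ep ny] := uniformizer_prime p_pr hQp hF hO varpi_neq0 hvarpi.
have [surA kerA] := hA; have [_ kerk] := hk; have [teichK teichM] := hteich.
pose tau := pr \o teich; pose pi := pr varpi.
have tauK : cancel tau red by move=> x; apply: teichK.
have tauM : {morph tau : x y / x * y} by move=> x y'; rewrite /tau /= teichM rmorphM.
have pi2 : pi * pi = 0.
  by rewrite -rmorphM; apply/kerA; exists 1; rewrite mulr1 expr2.
have redpi : red pi = 0 by apply/kerk; exists 1; rewrite mulr1.
have kerred a : red a = 0 -> exists b, a = pi * b.
  have [x <-] := surA a => /kerk[z ->]; exists (pr z).
  by rewrite rmorphM.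
have annpi a : pi * a = 0 -> red a = 0.
  have [x <-] := surA a; rewrite -rmorphM => /kerA[z]; rewrite expr2 -mulrA => /(mulfI varpi_neq0) ex.
  by apply/kerk; exists z.
(* The residue class of p / varpi, nonzero because [y] is prime to [varpi]. *)
pose ub := red (pr y).
have ub0 : ub != 0 by apply/eqP=> /kerk[z /ny].
have p_pi : p%:R = pi * tau ub.
  rewrite -(rmorph_nat pr) ep rmorphM; apply: (pi_red pi2 kerred).
  by rewrite tauK.
exact: (structure_M iota p_pr card_k (card_finPcharP card_k p_pr) tauK tauM pi2 redpi kerred annpi
  p_pi r_gen p_odd ub0).
Qed.
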